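(* Let $D\subset\mathbb{C}$ be a domain and let $\mathcal{F}$ be a family of meromorphic functions on $D$. Suppose that one of the following two alternatives holds: (A) for every $f\in\mathcal{F}$, all poles of $f$ have multiplicity at least $3$ and all zeros of $f$ have multiplicity at least $2$; or (B) for every $f\in\mathcal{F}$, all poles of $f$ have multiplicity at least $2$ and all zeros of $f$ have multiplicity at least $3$. Suppose moreover that every pair $f,g\in\mathcal{F}$ shares the value $1$ IM in $D$. Then $\mathcal{F}$ is normal in $D$.
   Context: A domain is a nonempty connected open subset of $\mathbb{C}$. Two functions $f,g$ share the value $1$ IM in $D$ if $\{z\in D: f(z)=1\}=\{z\in D: g(z)=1\}$. A family of meromorphic functions on $D$ is normal in $D$ if every sequence in the family has a subsequence which converges uniformly on compact subsets of $D$, with respect to the spherical metric, to a meromorphic function on $D$ or to the constant $\infty$. *)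

(* Defs.v *)
From mathcomp Require Import all_boot all_order all_algebra.
From mathcomp Require Import all_classical all_reals all_analysis.
From mathcomp Require Import complex.

Set Implicit Arguments.
Unset Strict Implicit.
Unset Printing Implicit Defensive.

Import Order.TTheory GRing.Theory Num.Theory.
Import numFieldNormedType.Exports.
Import ComplexField.Normc.

Local Open Scope classical_set_scope.
Local Open Scope ring_scope.
Local Open Scope complex_scope.

(* R[i] has no normed module structure of its own; its regular algebra R[i]^o
   is a normed module over R[i], so derivable _ z 1 on it is complex
   differentiability at z. *)
Notation CC R := (R[i])^o.

(* Riemann sphere, None being the point at infinity. *)
Notation sphere R := (option (CC R)).

Section Meromorphic.
Variable R : realType.
Implicit Types (D : set (CC R)) (f g l : CC R -> sphere R) (h : CC R -> CC R).
Implicit Types (F : set (CC R -> sphere R)) (u : nat -> CC R -> sphere R).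

Definition domain D : Prop := [/\ D !=set0, open D & connected D].

Definition holomorphic_at h (z0 : CC R) : Prop :=
  \forall z \near z0, derivable h z 1.

(* The complex value of f, with a dummy value 0 where f is infinite. *)
Definition finval f (z : CC R) : CC R := odflt 0 (f z).

Definition regular_point f (z0 : CC R) : Prop :=
  (\forall z \near z0, f z <> None) /\ holomorphic_at (finval f) z0.

(* Isolated singularity at which |f| tends to infinity. *)
Definition is_pole f (z0 : CC R) : Prop :=
  [/\ f z0 = None,
      \forall z \near z0^', regular_point f z
    & normc (finval f z) @[z --> z0^'] --> +oo].

(* Functions are total; only the values on D matter. The constant infinity is
   not meromorphic, as poles are isolated. *)
Definition meromorphic D f : Prop :=
  forall z, D z -> regular_point f z \/ is_pole f z.

Definition zero_of_multiplicity f (z0 : CC R) (m : nat) : Prop :=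
  f z0 = Some 0 /\
  exists h, [/\ holomorphic_at h z0, h z0 != 0
    & \forall z \near z0, f z = Some ((z - z0) ^+ m * h z)].

Definition pole_of_multiplicity f (z0 : CC R) (m : nat) : Prop :=
  is_pole f z0 /\
  exists h, [/\ holomorphic_at h z0, h z0 != 0
    & \forall z \near z0^', f z = Some (h z / (z - z0) ^+ m)].

(* A zero of a function vanishing identically has no finite multiplicity (it
   has infinite multiplicity), hence satisfies the condition for every k. *)
Definition zeros_multiplicity_ge D f (k : nat) : Prop :=
  forall z m, D z -> zero_of_multiplicity f z m -> (k <= m)%N.

Definition poles_multiplicity_ge D f (k : nat) : Prop :=
  forall z m, D z -> pole_of_multiplicity f z m -> (k <= m)%N.

Definition share_one_IM D f g : Prop :=
  [set z | D z /\ f z = Some 1] = [set z | D z /\ g z = Some 1].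

(* Half the Euclidean distance of the stereographic images on the unit sphere. *)
Definition chordal_dist (p q : sphere R) : R :=
  match p, q with
  | Some z, Some w => normc (z - w) /
      (Num.sqrt (1 + normc z ^+ 2) * Num.sqrt (1 + normc w ^+ 2))
  | Some z, None | None, Some z => (Num.sqrt (1 + normc z ^+ 2))^-1
  | None, None => 0
  end.

(* Great-circle distance on the unit sphere, i.e. the distance induced by
   2 |dz| / (1 + |z|^2): an arc of length t has chord 2 sin (t / 2). *)
Definition spherical_dist (p q : sphere R) : R := 2 * asin (chordal_dist p q).

Definition spherical_cvg_on_compacts D u l : Prop :=
  forall K : set (CC R), compact K -> K `<=` D ->
  forall e : R, 0 < e ->
  \forall n \near \oo, forall z, K z -> spherical_dist (u n z) (l z) < e.

Definition normal_family D F : Prop :=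
  forall u, (forall n, F (u n)) ->
  exists s : nat -> nat, {homo s : m n / (m < n)%N} /\
  exists l, (meromorphic D l \/ forall z, D z -> l z = None) /\
    spherical_cvg_on_compacts D (u \o s) l.

End Meromorphic.

(* Main.v *)
(** The heart of the proof is a conformal metric with cone singularities on the
    sphere, with density
      |w|^(-p/30) |w-1|^(-28/30) sqrt ((1 + |w|^(1/30)) (1 + |w-1|^(1/30))),
    whose curvature is at most a negative constant. For p = 14 (alternative A) or
    p = 19 (alternative B), its pull-back by f vanishes at the zeros and at the
    poles of f, by the lower bounds on their multiplicities.

    Fix z0 in D. By the sharing hypothesis, either all members of the family are
    identically 1 near z0, or there is a disc around z0, independent of f, in
    which f takes the value 1 at most at z0. Multiplying the pull-back by
    |z - z0|^(29/30) makes it vanish at z0 as well, and costs nothing in the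
    curvature because ln |z - z0| is harmonic. The Ahlfors-Schwarz argument (the
    second derivative test at a maximum) then bounds the spherical derivative of
    f by C |z - z0|^(-29/30), with C independent of f. The exponent is less
    than 1, so this integrates to a Hoelder estimate at z0: the family is
    equicontinuous at every point of D for the chordal metric. The
    Arzela-Ascoli theorem gives a convergent subsequence, and Weierstrass'
    theorem, applied to the functions or to their inverses, shows that the
    limit is meromorphic or identically infinite.

    Cauchy's formula is obtained from Goursat's theorem for triangles, with
    integrals of continuous functions defined as limits of dyadic sums. *)
Require Import Defs.
From mathcomp Require Import all_boot all_order all_algebra.
From mathcomp Require Import all_classical all_reals all_analysis.
From mathcomp Require Import complex ring lra zify.

Set Implicit Arguments.
Unset Strict Implicit.
Unset Printing Implicit Defensive.

Import Order.TTheory GRing.Theory Num.Theory.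
Import numFieldNormedType.Exports.
Import ComplexField.Normc.

Local Open Scope classical_set_scope.
Local Open Scope ring_scope.
Local Open Scope complex_scope.

(** Call c a cone exponent when the density behaves like |w|^(-c) in a local coordinate. Here the
    exponents are p/30 at 0, 28/30 at 1 and (33 - p)/30 at infinity. Their sum 61/30 exceeds 2,
    which negative curvature forces by Gauss-Bonnet. The powers of |w| and |w-1| alone are flat,
    since ln |w| is harmonic; the factors 1 + |w|^(1/30) and 1 + |w-1|^(1/30) produce the curvature.
    A map of local multiplicity m pulls |w|^(-c) |dw| back to order m - 1 - c m, positive when c < 1
    - 1/m. So multiplicities 2 and 3 allow c < 1/2 and c < 2/3, and 14/30 and 19/30 are the largest
    such multiples of 1/30; p exchanges their places at 0 and infinity. At 1 no multiplicity is
    known: a simple 1-point has order -28/30, which the factor |z - z0|^(29/30) makes positive, and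
    29/30 < 1 keeps the final bound integrable. Positivity of all these orders keeps the maximum of
    [psi] away from zeros, poles and z0. *)

Section NormC.
Variable R : realType.
Local Notation C := (CC R).
Implicit Types (x y z w : C).

(** The norm of [CC R] has values in [R[i]]; every estimate is carried out on the real number
    [normc x] instead. *)
Lemma normE x : `|x| = (normc x)%:C. Proof. by case: x. Qed.

Lemma normc_ge0 x : 0 <= normc x.
Proof. by case: x => a b; exact: sqrtr_ge0. Qed.

Lemma normc_leD x y : normc (x + y) <= normc x + normc y.
Proof. exact: le_normcD. Qed.

Lemma normc_opp x : normc (- x) = normc x.
Proof. exact: normcN. Qed.

Lemma normc_mul x y : normc (x * y) = normc x * normc y.
Proof. exact: normcM. Qed.

Lemma normc_inv x : normc x^-1 = (normc x)^-1.
Proof. exact: normcV. Qed.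

Lemma normc_div x y : normc (x / y) = normc x / normc y.
Proof. by rewrite normc_mul normc_inv. Qed.

Lemma normc_zero : normc (0 : C) = 0. Proof. exact: normc0. Qed.
Lemma normc_one : normc (1 : C) = 1. Proof. exact: normc1. Qed.

Lemma normc_exp x n : normc (x ^+ n) = normc x ^+ n.
Proof.
by elim: n => [|n IH]; rewrite ?expr0 ?normc_one// !exprS normc_mul IH.
Qed.

Lemma normc_distC x y : normc (x - y) = normc (y - x).
Proof. by rewrite -normc_opp opprB. Qed.

Lemma normc_leB x y : normc (x - y) <= normc x + normc y.
Proof. by rewrite -(normc_opp y) normc_leD. Qed.

Lemma normc_dist_tri z x y : normc (x - y) <= normc (x - z) + normc (z - y).
Proof. by rewrite -[x - y](subrKA z) normc_leD. Qed.

Lemma normc_lerB x y : normc x - normc y <= normc (x - y).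
Proof. by rewrite lerBlDr -{1}[x](subrK y) normc_leD. Qed.

Lemma normc_dist_le x y : `|normc x - normc y| <= normc (x - y).
Proof.
rewrite ler_norml normc_lerB andbT lerNl opprB normc_distC; exact: normc_lerB.
Qed.

Lemma normc_eq0 x : (normc x == 0) = (x == 0).
Proof.
apply/eqP/eqP => [|->]; [exact: eq0_normc|exact: normc_zero].
Qed.

Lemma normc_gt0 x : (0 < normc x) = (x != 0).
Proof. by rewrite lt_def normc_ge0 andbT normc_eq0. Qed.

Lemma normc_real (a : R) : normc (a%:C : C) = `|a|.
Proof. by rewrite /normc /= expr0n addr0 sqrtr_sqr. Qed.

Lemma normc_nat n : normc (n%:R : C) = n%:R.
Proof.
have -> : (n%:R : C) = (n%:R : R)%:C by rewrite rmorph_nat.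
by rewrite normc_real normr_nat.
Qed.

Lemma normc_sqr x : normc x ^+ 2 = complex.Re x ^+ 2 + complex.Im x ^+ 2.
Proof. by case: x => a b /=; rewrite sqr_sqrtr// addr_ge0 ?sqr_ge0. Qed.

Lemma normc_geRe x : `|complex.Re x| <= normc x.
Proof.
rewrite -(@ler_pXn2r _ 2) ?nnegrE ?normc_ge0 ?normr_ge0// normc_sqr real_normK ?num_real//.
by rewrite lerDl sqr_ge0.
Qed.

Lemma normc_geIm x : `|complex.Im x| <= normc x.
Proof.
rewrite -(@ler_pXn2r _ 2) ?nnegrE ?normc_ge0 ?normr_ge0// normc_sqr real_normK ?num_real//.
by rewrite lerDr sqr_ge0.
Qed.

Lemma normc_leReIm x : normc x <= `|complex.Re x| + `|complex.Im x|.
Proof.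
rewrite -(@ler_pXn2r _ 2) ?nnegrE ?normc_ge0 ?addr_ge0 ?normr_ge0// normc_sqr.
by rewrite sqrrD !real_normK ?num_real// lerD2r lerDl mulrn_wge0// mulr_ge0.
Qed.

(** Balls of [CC R] have radii in [R[i]]; a positive radius is real, because the order of [R[i]]
    compares only numbers with equal imaginary parts. *)
Lemma nbhs_normcP z (P : set C) :
  nbhs z P <-> exists2 e : R, 0 < e & forall w, normc (w - z) < e -> P w.
Proof.
split.
  move=> /nbhs_ballP[e /= e0]; case: e e0 => e e'.
  rewrite ltcE/= => /andP[/eqP e'0 e0] sub; exists e => // w wz.
  apply: sub; rewrite -ball_normE /ball_/= normE e'0 ltcR.
  by rewrite normc_distC.
move=> [e e0 sub]; apply/nbhs_ballP; exists e%:C => /=; first by rewrite ltcR.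
move=> w; rewrite -ball_normE /ball_/= normE ltcR normc_distC; exact: sub.
Qed.

Lemma dnbhs_normcP z (P : set C) :
  dnbhs z P <-> exists2 e : R, 0 < e & forall w, normc (w - z) < e -> w != z -> P w.
Proof.
rewrite /dnbhs /within/=; split.
  move/nbhs_normcP => [e e0 H]; exists e => // w /H; exact.
move=> [e e0 H]; apply/nbhs_normcP; exists e => // w /H; exact.
Qed.

Lemma cvg_normcP (T : Type) (F : set_system T) {FF : Filter F} (f : T -> C) (a : C) :
  f x @[x --> F] --> a <-> forall e : R, 0 < e -> \forall x \near F, normc (f x - a) < e.
Proof.
split.
  move=> fa e e0; apply: (fa [set y | normc (y - a) < e]).
  by apply/nbhs_normcP; exists e.
move=> H A /nbhs_normcP[e e0 sub].
by apply: filterS (H e e0) => x /sub.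
Qed.

Lemma cvg_normc (T : Type) (F : set_system T) {FF : Filter F} (f : T -> C) (a : C) :
  f x @[x --> F] --> a -> normc (f x) @[x --> F] --> normc a.
Proof.
move=> /cvg_normcP H; apply/cvgrPdist_lt => e e0.
apply: filterS (H e e0) => x; apply: le_lt_trans.
by rewrite distrC; exact: normc_dist_le.
Qed.

Lemma ccvgP (f : C -> C) z (a : C) : f w @[w --> z] --> a <->
  forall e : R, 0 < e -> \forall w \near z, normc (f w - a) < e.
Proof. exact: (@cvg_normcP C (nbhs z) (nbhs_filter z) f a). Qed.

Lemma near_normc z (e : R) : 0 < e -> \forall w \near z, normc (w - z) < e.
Proof. by move=> e0; apply/nbhs_normcP; exists e. Qed.

(** The disc is closed in a square, which is the continuous image of a product of two real
    segments. *)
Lemma compact_closed_disc z (r : R) : compact [set w : C | normc (w - z) <= r].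
Proof.
pose f (p : R * R) : C := p.1 +i* p.2.
have cf : continuous f.
  move=> [a b]; apply/cvg_normcP => e e0.
  have e2 : 0 < e / 2 by rewrite divr_gt0.
  apply: (filterS (P := [set p | `|a - p.1| < e / 2 /\ `|b - p.2| < e / 2])).
    move=> p [h1 h2]; apply: (le_lt_trans (normc_leReIm _)) => /=.
    by rewrite [e]splitr ltrD// distrC.
  exists ([set x | `|a - x| < e / 2], [set y | `|b - y| < e / 2]).
    by split; apply/nbhs_ballP; exists (e / 2) => //= x; rewrite -ball_normE.
  by [].
pose a := complex.Re z; pose b := complex.Im z.
have K : compact (f @` (`[a - r, a + r] `*` `[b - r, b + r])).
  apply: continuous_compact; last by apply: compact_setX; exact: segment_compact.
  by apply: continuous_subspaceT.
apply: (subclosed_compact _ K).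
  rewrite (_ : mkset _ = ~` [set w | r < normc (w - z)]); last first.
    by apply/seteqP; split => w /=; rewrite leNgt => /negP.
  apply: open_closedC; rewrite openE => w /= rw.
  apply/nbhs_normcP; exists (normc (w - z) - r); first by rewrite subr_gt0.
  move=> v vw /=; have := normc_dist_tri v w z; rewrite (normc_distC w v); lra.
move=> w /= wr; exists (complex.Re w, complex.Im w); last by case: (w).
have hr := le_trans (normc_geRe (w - z)) wr.
have hi := le_trans (normc_geIm (w - z)) wr.
move: hr hi; rewrite !ler_norml /a /b.
have -> : complex.Re (w - z) = complex.Re w - complex.Re z by case: (w); case: (z).
have -> : complex.Im (w - z) = complex.Im w - complex.Im z by case: (w); case: (z).
by move=> /andP[? ?] /andP[? ?]; split => /=; rewrite in_itv/=; apply/andP; split; lra.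
Qed.

End NormC.

(** * Complex differentiability *)

Section ComplexDerivative.
Variable R : realType.
Local Notation C := (CC R).
Implicit Types (f g : C -> C) (z w l : C).

(* Caratheodory's form of complex differentiability at [z]: the difference
   quotient extends to a function which is continuous at [z]. *)
Definition cderiv f z l : Prop :=
  exists2 phi : C -> C, phi w @[w --> z] --> l &
    \forall w \near z, f w - f z = phi w * (w - z).

Lemma ccvg_cst (c z : C) : (fun=> c) w @[w --> z] --> c.
Proof. by apply/ccvgP => e e0; apply: filterE => w; rewrite subrr normc_zero. Qed.

Lemma ccvg_id z : (fun w => w) w @[w --> z] --> z.
Proof. by apply/ccvgP => e e0; exact: near_normc. Qed.

Arguments ccvg_cst c z : clear implicits.
Arguments ccvg_id z : clear implicits.

Lemma ccvgD f g z (a b : C) : f w @[w --> z] --> a -> g w @[w --> z] --> b ->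
  f w + g w @[w --> z] --> a + b.
Proof. by move=> fa gb; apply: (cvgD fa gb). Qed.

Lemma ccvgM f g z (a b : C) : f w @[w --> z] --> a -> g w @[w --> z] --> b ->
  f w * g w @[w --> z] --> a * b.
Proof. by move=> fa gb; apply: (cvgM fa gb). Qed.

Lemma ccvgN f z (a : C) : f w @[w --> z] --> a -> - f w @[w --> z] --> - a.
Proof. by move=> fa; apply: (cvgN fa). Qed.

Lemma ccvgB f g z (a b : C) : f w @[w --> z] --> a -> g w @[w --> z] --> b ->
  f w - g w @[w --> z] --> a - b.
Proof. by move=> fa gb; apply: (cvgB fa gb). Qed.

Lemma ccvgV f z (a : C) : a != 0 -> f w @[w --> z] --> a ->
  (f w)^-1 @[w --> z] --> a^-1.
Proof. by move=> a0 fa; apply: (cvgV a0 fa). Qed.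

Lemma ccvgX f z (a : C) n : f w @[w --> z] --> a -> f w ^+ n @[w --> z] --> a ^+ n.
Proof.
move=> fa; elim: n => [|n IH]; first exact: ccvg_cst.
rewrite (_ : (fun w => f w ^+ n.+1) = fun w => f w * f w ^+ n); last first.
  by apply/funext => w; rewrite exprS.
by rewrite exprS; exact: ccvgM.
Qed.

Lemma ccvg_comp f g z (a b : C) : f w @[w --> z] --> a -> g w @[w --> a] --> b ->
  g (f w) @[w --> z] --> b.
Proof. by move=> fa gb; apply: (cvg_comp _ _ fa gb). Qed.

Lemma cderivP f z : derivable f z 1 <-> exists l, cderiv f z l.
Proof.
split.
  move=> /cvg_ex[l /= fl]; exists l.
  have /cvg_normcP H := fl.
  exists (fun w => if w == z then l else (f w - f z) / (w - z)).
    apply/ccvgP => e e0; have /dnbhs_normcP[d d0 K] := H _ e0.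
    apply/nbhs_normcP; exists d => // w wz; case: eqVneq => [_|wz'].
      by rewrite subrr normc_zero.
    have := K (w - z); rewrite subr0 subr_eq0 => /(_ wz wz') /=.
    by rewrite /GRing.scale/= mulr1 subrK mulrC.
  apply: filterE => w; case: eqVneq => [->|wz]; first by rewrite !subrr mulr0.
  by rewrite mulfVK// subr_eq0.
move=> [l [phi /ccvgP phil /nbhs_normcP[d d0 K]]].
apply/cvg_ex; exists l; apply/cvg_normcP => e e0.
have /nbhs_normcP[d' d'0 K'] := phil _ e0.
apply/dnbhs_normcP; exists (Num.min d d'); first by rewrite lt_min d0.
move=> h; rewrite subr0 lt_min => /andP[hd hd'] h0 /=.
rewrite /GRing.scale/= mulr1 K ?addrK// (mulrC (phi _)) mulrA mulVf// mul1r.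
by apply: K'; rewrite addrK.
Qed.

Lemma cderiv_small f z l : cderiv f z l <-> forall e : R, 0 < e ->
  \forall w \near z, normc (f w - f z - l * (w - z)) <= e * normc (w - z).
Proof.
split.
  move=> [phi /ccvgP phil H] e e0; near=> w.
  have -> : f w - f z = phi w * (w - z) by near: w.
  rewrite -mulrBl normc_mul ler_wpM2r ?normc_ge0// ltW//; near: w; exact: phil.
move=> H; exists (fun w => if w == z then l else (f w - f z) / (w - z)).
  apply/ccvgP => e e0; have e2 : 0 < e / 2 by rewrite divr_gt0.
  apply: filterS (H _ e2) => w; case: eqVneq => [_|wz]; first by rewrite subrr normc_zero.
  have wz0 : w - z != 0 by rewrite subr_eq0.
  have -> : f w - f z - l * (w - z) = ((f w - f z) / (w - z) - l) * (w - z).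
    by rewrite mulrBl mulfVK.
  rewrite normc_mul ler_pM2r ?normc_gt0//; move/le_lt_trans; apply.
  by rewrite ltr_pdivrMr// ltr_pMr// ltr1n.
apply: filterE => w; case: eqVneq => [->|wz]; first by rewrite !subrr mulr0.
by rewrite mulfVK// subr_eq0.
Unshelve. all: by end_near. Qed.

Lemma cderiv_cont f z l : cderiv f z l -> f w @[w --> z] --> f z.
Proof.
move=> [phi phil H].
have E : \forall w \near z, phi w * (w - z) + f z = f w.
  by apply: filterS H => w <-; rewrite subrK.
apply: cvg_trans (near_eq_cvg E) _.
have := ccvgD (ccvgM phil (ccvgB (ccvg_id z) (ccvg_cst z z))) (ccvg_cst (f z) z).
by rewrite subrr mulr0 add0r.
Qed.

Lemma cderiv_unique f z l l' : cderiv f z l -> cderiv f z l' -> l = l'.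
Proof.
move=> /cderiv_small H /cderiv_small H'; apply/eqP; rewrite -subr_eq0 -normc_eq0.
rewrite eq_le normc_ge0 andbT; apply/ler_addgt0Pl => e e0; rewrite addr0.
have e2 : 0 < e / 2 by rewrite divr_gt0.
have /nbhs_normcP[d d0 K] : \forall w \near z,
    normc (f w - f z - l * (w - z)) <= e / 2 * normc (w - z) /\
    normc (f w - f z - l' * (w - z)) <= e / 2 * normc (w - z).
  by apply: filterI; [exact: H|exact: H'].
pose h : C := (d / 2)%:C; have h0 : 0 < normc h.
  by rewrite normc_real gtr0_norm divr_gt0.
have zh : z + h - z = h by rewrite addrC addKr.
have [] := K (z + h).
  by rewrite zh normc_real gtr0_norm ?divr_gt0// ltr_pdivrMr// ltr_pMr// ltr1n.
rewrite zh => A B; rewrite -(ler_pM2r h0) -normc_mul.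
have -> : (l - l') * h = (f (z + h) - f z - l' * h) - (f (z + h) - f z - l * h) by ring.
by apply: (le_trans (normc_leB _ _)); rewrite [e]splitr mulrDl addrC; exact: lerD.
Qed.

Lemma cderiv_near f g z l : (\forall w \near z, f w = g w) -> cderiv f z l -> cderiv g z l.
Proof.
move=> E [phi phil H]; exists phi => //; have Ez := nbhs_singleton E.
by near=> w; rewrite -(_ : f w = g w) -?Ez; near: w.
Unshelve. all: by end_near. Qed.

Lemma cderiv_cst (c : C) z : cderiv (fun=> c) z 0.
Proof.
by exists (fun=> 0); [exact: ccvg_cst|apply: filterE => w; rewrite subrr mul0r].
Qed.

Lemma cderiv_id z : cderiv (fun w => w) z 1.
Proof. by exists (fun=> 1); [exact: ccvg_cst|apply: filterE => w; rewrite mul1r]. Qed.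

Lemma cderivD f g z l l' :
  cderiv f z l -> cderiv g z l' -> cderiv (fun w => f w + g w) z (l + l').
Proof.
move=> [phi c1 h1] [psi c2 h2]; exists (fun w => phi w + psi w); first exact: (ccvgD c1 c2).
near=> w; rewrite mulrDl -(_ : f w - f z = phi w * (w - z)); last by near: w.
by rewrite -(_ : g w - g z = psi w * (w - z)); [ring|near: w].
Unshelve. all: by end_near. Qed.

Lemma cderivM f g z l l' : cderiv f z l -> cderiv g z l' ->
  cderiv (fun w => f w * g w) z (l * g z + f z * l').
Proof.
move=> [phi c1 h1] G; have gz := cderiv_cont G; move: G => [psi c2 h2].
exists (fun w => phi w * g w + f z * psi w).
  exact: (ccvgD (ccvgM c1 gz) (ccvgM (ccvg_cst (f z) z) c2)).
near=> w; rewrite mulrDl mulrAC -(_ : f w - f z = phi w * (w - z)); last by near: w.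
by rewrite -mulrA -(_ : g w - g z = psi w * (w - z)); [ring|near: w].
Unshelve. all: by end_near. Qed.

Lemma cderivZ f z l (c : C) : cderiv f z l -> cderiv (fun w => c * f w) z (c * l).
Proof. by move=> H; have := cderivM (cderiv_cst c z) H; rewrite mul0r add0r. Qed.

Lemma cderivN f z l : cderiv f z l -> cderiv (fun w => - f w) z (- l).
Proof.
move=> /(cderivZ (-1)); rewrite mulN1r; apply: cderiv_near.
by apply: filterE => w; rewrite mulN1r.
Qed.

Lemma cderivB f g z l l' :
  cderiv f z l -> cderiv g z l' -> cderiv (fun w => f w - g w) z (l - l').
Proof. by move=> h /cderivN; exact: cderivD. Qed.

Lemma cderiv_subC (a : C) z : cderiv (fun w => w - a) z 1.
Proof. by have := cderivB (cderiv_id z) (cderiv_cst a z); rewrite subr0. Qed.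

Lemma cderivX f z l n : cderiv f z l ->
  cderiv (fun w => f w ^+ n) z (n%:R * f z ^+ n.-1 * l).
Proof.
move=> H; elim: n => [|n IH].
  by rewrite !mul0r; exact: cderiv_cst.
have := cderivM H IH.
have -> : l * f z ^+ n + f z * (n%:R * f z ^+ n.-1 * l) = n.+1%:R * f z ^+ n.+1.-1 * l.
  case: n {IH} => [|n] /=; first by rewrite !expr0; ring.
  by rewrite exprS -natr1; ring.
by apply: cderiv_near; apply: filterE => w; rewrite exprS.
Qed.

Lemma near_neq0 f z : f w @[w --> z] --> f z -> f z != 0 -> \forall w \near z, f w != 0.
Proof.
move=> /ccvgP H fz0; rewrite -normc_gt0 in fz0.
apply: filterS (H _ fz0) => w; apply: contraTneq => ->.
by rewrite sub0r normc_opp ltxx.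
Qed.

Lemma cderivV f z l : f z != 0 -> cderiv f z l ->
  cderiv (fun w => (f w)^-1) z (- l / f z ^+ 2).
Proof.
move=> fz0 F; have fc := cderiv_cont F; have fn := near_neq0 fc fz0.
move: F => [phi c h].
exists (fun w => - phi w / (f w * f z)).
  rewrite expr2; apply: (ccvgM (ccvgN c) (ccvgV _ (ccvgM fc (ccvg_cst (f z) z)))).
  by rewrite mulf_neq0.
near=> w; have fw : f w != 0 by near: w.
rewrite mulrAC mulNr -(_ : f w - f z = phi w * (w - z)); last by near: w.
by field; apply/andP.
Unshelve. all: by end_near. Qed.

Lemma cderivF f g z l l' : g z != 0 -> cderiv f z l -> cderiv g z l' ->
  cderiv (fun w => f w / g w) z ((l * g z - f z * l') / g z ^+ 2).
Proof.
move=> g0 F G; have := cderivM F (cderivV g0 G).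
by congr cderiv; field.
Qed.

Lemma cderiv_comp f g z l l' : cderiv f z l -> cderiv g (f z) l' ->
  cderiv (fun w => g (f w)) z (l' * l).
Proof.
move=> F [psi c2 h2]; have fc := cderiv_cont F; move: F => [phi c1 h1].
exists (fun w => psi (f w) * phi w).
  exact: (ccvgM (ccvg_comp fc c2) c1).
near=> w; rewrite -mulrA -(_ : f w - f z = phi w * (w - z)); last by near: w.
by near: w; exact: (fc _ h2).
Unshelve. all: by end_near. Qed.

End ComplexDerivative.
Arguments ccvg_cst {R} c z.
Arguments ccvg_id {R} z.
Arguments cderiv_id {R} z.
Arguments cderiv_cst {R} c z.
Arguments cderiv_subC {R} a z.

(** * Dyadic integrals and Goursat's theorem *)

Section DyadicIntegral.
Variable R : realType.
Local Notation C := (CC R).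
Implicit Types (h g : R -> C) (l : C).

Definition lhalf h : R -> C := fun t => h (t / 2).
Definition rhalf h : R -> C := fun t => h ((1 + t) / 2).

(* The left Riemann sum of [h] over 2 ^ k equal parts of [0, 1]; the recursion
   makes the bisection of an integral a computation rule. *)
Fixpoint dsum h (k : nat) : C :=
  if k is k'.+1 then (dsum (lhalf h) k' + dsum (rhalf h) k') / 2 else h 0.

Definition dint h l : Prop :=
  forall e : R, 0 < e -> exists N, forall k, (N <= k)%N -> normc (dsum h k - l) < e.

(** Two-sided even at 0 and 1, where s may leave the segment: the paths used here are defined on all
    of R, so no subspace topology is involved. *)
Definition cont01 h : Prop := forall t, 0 <= t <= 1 -> forall e : R, 0 < e ->
  exists2 d : R, 0 < d & forall s, `|s - t| < d -> normc (h s - h t) < e.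

Let half_itv (t : R) : 0 <= t <= 1 -> 0 <= t / 2 <= 1.
Proof. by move=> /andP[? ?]; apply/andP; split; lra. Qed.

Let half1_itv (t : R) : 0 <= t <= 1 -> 0 <= (1 + t) / 2 <= 1.
Proof. by move=> /andP[? ?]; apply/andP; split; lra. Qed.

Lemma cseq_cauchy (a : nat -> C) :
  (forall e : R, 0 < e -> exists N, forall m n, (N <= m)%N -> (N <= n)%N ->
    normc (a m - a n) <= e) ->
  exists l, forall e : R, 0 < e -> exists N, forall k, (N <= k)%N -> normc (a k - l) < e.
Proof.
move=> H.
have R_cauchy (u : nat -> R) : (forall m n, `|u m - u n| <= normc (a m - a n)) ->
    exists l : R, forall e : R, 0 < e -> exists N, forall k, (N <= k)%N -> `|u k - l| < e.
  move=> ua.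
  have : cvgn u.
    apply/cauchy_cvgP/cauchy_exP => e e0; have e2 : 0 < e / 2 by rewrite divr_gt0.
    have [N HN] := H _ e2; exists (u N); exists N => // k /= Nk.
    rewrite -ball_normE /ball_/=; have := ua N k; have := HN _ _ (leqnn N) Nk; lra.
  move=> /cvgrPdist_lt cu; exists (limn u) => e /cu[N _ HN].
  by exists N => k Nk; rewrite distrC; exact: HN.
have [x Hx] : exists l : R, forall e : R, 0 < e -> exists N, forall k, (N <= k)%N ->
    `|complex.Re (a k) - l| < e.
  apply: R_cauchy => m n; apply: le_trans (normc_geRe _).
  by case: (a m) => ? ?; case: (a n).
have [y Hy] : exists l : R, forall e : R, 0 < e -> exists N, forall k, (N <= k)%N ->
    `|complex.Im (a k) - l| < e.
  apply: R_cauchy => m n; apply: le_trans (normc_geIm _).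
  by case: (a m) => ? ?; case: (a n).
exists (x +i* y) => e e0; have e2 : 0 < e / 2 by rewrite divr_gt0.
have [N1 H1] := Hx _ e2; have [N2 H2] := Hy _ e2; exists (maxn N1 N2) => k.
rewrite geq_max => /andP[/H1 k1 /H2 k2].
have := normc_leReIm (a k - (x +i* y)); move: k1 k2; case: (a k) => p q /=; lra.
Qed.

Lemma normc_half (z : C) : normc (z / 2) = normc z / 2.
Proof.
rewrite normc_div; congr (_ / _).
exact: (normc_nat R 2).
Qed.

Lemma normc_avg (x y : C) (M : R) : normc x <= M -> normc y <= M -> normc ((x + y) / 2) <= M.
Proof.
move=> xM yM; rewrite normc_half; have := normc_leD x y; lra.
Qed.

Lemma dsum_ext h g k : (forall t, 0 <= t <= 1 -> h t = g t) -> dsum h k = dsum g k.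
Proof.
elim: k h g => [|k IH] h g E /=; first by rewrite E// lexx ler01.
by rewrite !(IH (lhalf h) (lhalf g), IH (rhalf h) (rhalf g))// => t /[dup] /half_itv ? /half1_itv ?;
  rewrite /lhalf /rhalf E.
Qed.

Lemma dsumD h g k : dsum (fun t => h t + g t) k = dsum h k + dsum g k.
Proof.
elim: k h g => [|k IH] h g //=.
by rewrite [lhalf _](_ : _ = fun t => lhalf h t + lhalf g t)//
  [rhalf _](_ : _ = fun t => rhalf h t + rhalf g t)// !IH; ring.
Qed.

Lemma dsumZ (c : C) h k : dsum (fun t => c * h t) k = c * dsum h k.
Proof.
elim: k h => [|k IH] h //=.
by rewrite [lhalf _](_ : _ = fun t => c * lhalf h t)//
  [rhalf _](_ : _ = fun t => c * rhalf h t)// !IH; ring.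
Qed.

Lemma dsum_le h (M : R) k : (forall t, 0 <= t <= 1 -> normc (h t) <= M) ->
  normc (dsum h k) <= M.
Proof.
elim: k h => [|k IH] h H /=; first by apply: H; rewrite lexx ler01.
by apply: normc_avg; apply: IH => t ht; apply: H; [exact: half_itv|exact: half1_itv].
Qed.

Lemma dsumB_le h g (M : R) k : (forall t, 0 <= t <= 1 -> normc (h t - g t) <= M) ->
  normc (dsum h k - dsum g k) <= M.
Proof.
move=> H; rewrite -mulN1r -dsumZ -dsumD; apply: dsum_le => t ht.
by rewrite mulN1r; exact: H.
Qed.

Lemma dsum_cst (c : C) k : dsum (fun=> c) k = c.
Proof. by elim: k => [//|k IH] /=; rewrite /lhalf /rhalf IH; field. Qed.

(** The left sum of t -> h (1 - t) is the right sum of h. Reversal exchanges the two halves, and at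
    depth 0 it remains to compare h 1 with h 0 on a piece of length 2 ^- k. *)
Lemma dsum_rev_le h (e : R) k :
  (forall s t, 0 <= s <= 1 -> 0 <= t <= 1 -> `|s - t| <= 2 ^- k -> normc (h s - h t) <= e) ->
  normc (dsum (fun t => h (1 - t)) k - dsum h k) <= e.
Proof.
elim: k h => [|k IH] h H /=.
  by apply: H; rewrite ?subr0 ?lexx ?ler01// normr1 expr0 invr1.
have Hh : forall u v : R, `|u - v| <= 2 ^- k -> `|(u - v) / 2| <= 2 ^- k.+1.
  move=> u v uv; rewrite normrM (@ger0_norm _ 2^-1) ?invr_ge0// exprS invfM mulrC.
  by rewrite ler_wpM2l// invr_ge0.
have E1 : lhalf (fun t => h (1 - t)) = fun t => rhalf h (1 - t).
  by apply/funext => t; rewrite /lhalf /rhalf; congr h; field.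
have E2 : rhalf (fun t => h (1 - t)) = fun t => lhalf h (1 - t).
  by apply/funext => t; rewrite /lhalf /rhalf; congr h; field.
rewrite E1 E2.
have -> : forall a b c d : C, (a + b) / 2 - (c + d) / 2 = ((a - d) + (b - c)) / 2.
  by move=> a b c d; field.
apply: normc_avg; apply: IH => s t hs ht st.
  by apply: H; [exact: half1_itv|exact: half1_itv|
     rewrite -mulrBl opprD addrACA subrr add0r Hh].
  by apply: H; [exact: half_itv|exact: half_itv|rewrite -mulrBl Hh].
Qed.

(** The sum of depth k + n refines that of depth k inside each of 2 ^ k pieces, where h oscillates
    by at most e. The hypothesis passes to the halves, whose rescaling doubles lengths. *)
Lemma dsum_cauchy_le h (e : R) k n :
  (forall s t, 0 <= s <= 1 -> 0 <= t <= 1 -> `|s - t| <= 2 ^- k -> normc (h s - h t) <= e) ->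
  normc (dsum h (k + n) - dsum h k) <= e.
Proof.
elim: k h => [|k IH] h H.
  rewrite add0n /= -(dsum_cst (h 0) n); apply: dsumB_le => t /[dup] ht /andP[t0 t1].
  by apply: H; rewrite ?lexx ?ler01// subr0 expr0 invr1 ger0_norm.
rewrite addSn /=.
have -> : forall a b c d : C, (a + b) / 2 - (c + d) / 2 = ((a - c) + (b - d)) / 2.
  by move=> a b c d; field.
have Hh : forall u v : R, `|u - v| <= 2 ^- k -> `|(u - v) / 2| <= 2 ^- k.+1.
  move=> u v uv; rewrite normrM (@ger0_norm _ 2^-1) ?invr_ge0// exprS invfM mulrC.
  by rewrite ler_wpM2l// invr_ge0.
apply: normc_avg; apply: IH => s t hs ht st.
  by apply: H; [exact: half_itv|exact: half_itv|rewrite -mulrBl Hh].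
  by apply: H; [exact: half1_itv|exact: half1_itv|
     rewrite -mulrBl opprD addrACA subrr add0r Hh].
Qed.

Lemma cont01_uniform h : cont01 h -> forall e : R, 0 < e ->
  exists2 d : R, 0 < d & forall s t, 0 <= t <= 1 -> `|s - t| < d -> normc (h s - h t) < e.
Proof.
move=> ch e e0; have e2 : 0 < e / 2 by rewrite divr_gt0.
have /compact_near_coveringP cK := @segment_compact R 0 1.
(* The covering argument runs over all d near 0; for d <= 0 the property is void. *)
pose P (d t : R) := forall s, `|s - t| < d -> normc (h s - h t) < e.
have : \forall d \near nbhs (0 : R), `[0%R, 1%R]%classic `<=` P d.
  apply: cK => t; rewrite /= in_itv/= => ht.
  have [d d0 H] := ch t ht _ e2.
  have d2 : 0 < d / 2 by rewrite divr_gt0.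
  exists ([set t' | `|t - t'| < d / 2], [set d' | `|0 - d'| < d / 2]).
    by split; apply/nbhs_ballP; exists (d / 2) => //= x; rewrite -ball_normE.
  move=> [t' d'] /= [tt']; rewrite sub0r normrN => d'2 s st'.
  have /H A : `|s - t| < d.
    have := ler_distD t' s t; have := ler_norm d'; rewrite (distrC t' t); lra.
  have /H B : `|t' - t| < d by rewrite distrC; lra.
  have := normc_dist_tri (h t) (h s) (h t'); rewrite (normc_distC (h t) (h t')); lra.
move=> /nbhs_ballP[d /= d0 H]; exists (d / 2); first by rewrite divr_gt0.
move=> s t ht st.
have := H (d / 2); rewrite -ball_normE /ball_/= sub0r normrN gtr0_norm ?divr_gt0//.
move=> /(_ _ t); rewrite /= in_itv/= => K; apply: K => //; lra.
Qed.

Lemma exp2V_lt (d : R) : 0 < d -> exists N, forall k, (N <= k)%N -> 2 ^- k < d.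
Proof.
move=> d0.
have := @cvg_geometric R 1 2^-1; rewrite ger0_norm ?invr_ge0// invf_lt1// ltr1n.
move=> /(_ isT) /cvgrPdist_lt/(_ d d0)[N _ H]; exists N => k /H/=.
by rewrite /geometric/= sub0r normrN mul1r exprVn ger0_norm// invr_ge0 exprn_ge0.
Qed.

Lemma cont01_scale h (e : R) : cont01 h -> 0 < e -> exists N, forall k, (N <= k)%N ->
  forall s t, 0 <= s <= 1 -> 0 <= t <= 1 -> `|s - t| <= 2 ^- k -> normc (h s - h t) <= e.
Proof.
move=> ch e0; have [d d0 H] := cont01_uniform ch e0; have [N HN] := exp2V_lt d0.
exists N => k Nk s t hs ht st; apply/ltW/H => //; exact: le_lt_trans st (HN _ Nk).
Qed.

Lemma dint_unique h l l' : dint h l -> dint h l' -> l = l'.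
Proof.
move=> H H'; apply/eqP; rewrite -subr_eq0 -normc_eq0 eq_le normc_ge0 andbT.
apply/ler_addgt0Pl => e e0; rewrite addr0; have e2 : 0 < e / 2 by rewrite divr_gt0.
have [N1 H1] := H _ e2; have [N2 H2] := H' _ e2.
have := H1 (maxn N1 N2) (leq_maxl _ _); have := H2 (maxn N1 N2) (leq_maxr _ _).
have := normc_dist_tri (dsum h (maxn N1 N2)) l l'; rewrite (normc_distC l (dsum _ _)); lra.
Qed.

Lemma dint_ex h : cont01 h -> exists l, dint h l.
Proof.
move=> ch.
pose u k := complex.Re (dsum h k); pose v k := complex.Im (dsum h k).
have K : forall e : R, 0 < e -> exists N, forall m n, (N <= m)%N -> (N <= n)%N ->
    normc (dsum h m - dsum h n) <= e.
  move=> e e0; have e2 : 0 < e / 2 by rewrite divr_gt0.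
  have [N HN] := cont01_scale ch e2; exists N => m n Nm Nn.
  have A : forall m, (N <= m)%N -> normc (dsum h m - dsum h N) <= e / 2.
    by move=> p Np; rewrite -(subnKC Np); apply: dsum_cauchy_le; exact: HN.
  have := A _ Nm; have := A _ Nn; have := normc_dist_tri (dsum h N) (dsum h m) (dsum h n).
  rewrite (normc_distC (dsum h N) (dsum h n)); lra.
by have [l Hl] := cseq_cauchy K; exists l => e /Hl.
Qed.

Lemma dintD h g l l' : dint h l -> dint g l' -> dint (fun t => h t + g t) (l + l').
Proof.
move=> H H' e e0; have e2 : 0 < e / 2 by rewrite divr_gt0.
have [N1 H1] := H _ e2; have [N2 H2] := H' _ e2; exists (maxn N1 N2) => k.
rewrite geq_max => /andP[k1 k2]; rewrite dsumD opprD addrACA.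
have := H1 _ k1; have := H2 _ k2; have := normc_leD (dsum h k - l) (dsum g k - l'); lra.
Qed.

Lemma dintZ (c : C) h l : dint h l -> dint (fun t => c * h t) (c * l).
Proof.
move=> H e e0; have c0 : 0 < normc c + 1 by rewrite ltr_wpDl ?normc_ge0.
have [N HN] := H (e / (normc c + 1)) (divr_gt0 e0 c0); exists N => k /HN.
rewrite dsumZ -mulrBr normc_mul ltr_pdivlMr// mulrC; apply: le_lt_trans.
by rewrite ler_wpM2r ?normc_ge0// lerDl.
Qed.

Lemma dintN h l : dint h l -> dint (fun t => - h t) (- l).
Proof.
move=> /(dintZ (-1)); rewrite mulN1r.
by rewrite (_ : (fun t => -1 * h t) = fun t => - h t)//; apply/funext => t; rewrite mulN1r.
Qed.

Lemma dintB h g l l' : dint h l -> dint g l' -> dint (fun t => h t - g t) (l - l').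
Proof. by move=> H /dintN; exact: dintD. Qed.

Lemma dint_le h l (M : R) : (forall t, 0 <= t <= 1 -> normc (h t) <= M) -> dint h l ->
  normc l <= M.
Proof.
move=> hM H; apply/ler_addgt0Pl => e e0; have [N /(_ N (leqnn _)) HN] := H _ e0.
have := dsum_le N hM; have := normc_lerB l (dsum h N); rewrite normc_distC; lra.
Qed.

Lemma dint_ext h g l : (forall t, 0 <= t <= 1 -> h t = g t) -> dint h l -> dint g l.
Proof.
move=> E H e /H[N HN]; exists N => k /HN; by rewrite (dsum_ext k E).
Qed.

Lemma dint_cst (c : C) : dint (fun=> c) c.
Proof. by move=> e e0; exists 0%N => k _; rewrite dsum_cst subrr normc_zero. Qed.

Lemma dint_split h l l' : dint (lhalf h) l -> dint (rhalf h) l' -> dint h ((l + l') / 2).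
Proof.
move=> H H' e e0; have [N1 H1] := H _ e0; have [N2 H2] := H' _ e0.
exists (maxn N1 N2).+1 => -[//|k]; rewrite ltnS geq_max => /andP[k1 k2] /=.
rewrite -mulrBl opprD addrACA normc_half.
have := normc_leD (dsum (lhalf h) k - l) (dsum (rhalf h) k - l').
have := H1 _ k1; have := H2 _ k2; lra.
Qed.

Lemma dint_rev h l : cont01 h -> dint h l -> dint (fun t => h (1 - t)) l.
Proof.
move=> ch H e e0; have e2 : 0 < e / 2 by rewrite divr_gt0.
have [N1 H1] := H _ e2; have [N2 H2] := cont01_scale ch e2.
exists (maxn N1 N2) => k; rewrite geq_max => /andP[/H1 k1 /H2 k2].
have := dsum_rev_le k2.
have := normc_dist_tri (dsum h k) (dsum (fun t => h (1 - t)) k) l; lra.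
Qed.

Lemma dsum_id k : dsum (fun t => t%:C) k = (1 - (2 ^- k)%:C) / 2.
Proof.
have A c j : dsum (fun t : R => (t / 2 + c)%:C) j = dsum (fun t => t%:C) j / 2 + c%:C.
  rewrite (_ : (fun t : R => (t / 2 + c)%:C) = fun t => 2^-1 * t%:C + c%:C).
    by rewrite dsumD dsumZ dsum_cst mulrC.
  by apply/funext => t; rewrite rmorphD rmorphM fmorphV rmorph_nat mulrC.
elim: k => [|k IH] /=; first by rewrite expr0 invr1 subrr mul0r.
have e0 : (0 : R)%:C = 0 :> C by [].
have -> : lhalf (fun t => t%:C) = fun t => (t / 2 + 0)%:C :> C.
  by apply/funext => t; rewrite addr0.
have -> : rhalf (fun t => t%:C) = fun t => (t / 2 + 2^-1)%:C :> C.
  by apply/funext => t; rewrite /rhalf addrC mulrDl mul1r.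
rewrite !A IH.
have -> : (2 ^- k.+1)%:C = 2^-1 * (2 ^- k)%:C :> C.
  by rewrite exprS invfM rmorphM fmorphV rmorph_nat.
have -> : (2^-1)%:C = 2^-1 :> C by rewrite fmorphV rmorph_nat.
by rewrite e0; move: (2 ^- k)%:C => x; field.
Qed.

(** Goursat's estimate needs the exact integral of an affine function, whose contributions cancel
    around a triangle. *)
Lemma dint_affine (a b : C) : dint (fun t => a + b * t%:C) (a + b / 2).
Proof.
apply: dintD; first exact: dint_cst.
apply: (@dintZ b (fun t => t%:C)) => e /exp2V_lt[N HN].
exists N => k /HN; rewrite dsum_id.
have -> : (1 - (2 ^- k)%:C) / 2 - 2^-1 = - ((2 ^- k)%:C / 2) :> C.
  by move: (2 ^- k)%:C => x; field.
rewrite normc_opp normc_half normc_real.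
have k0 : 0 < 2 ^- k :> R by rewrite invr_gt0 exprn_gt0.
rewrite gtr0_norm//; lra.
Qed.

Definition Int h : C := xget 0 (dint h).

Lemma IntP h : cont01 h -> dint h (Int h).
Proof. by move=> /dint_ex[l hl]; exact: (xgetI 0 hl). Qed.

Lemma IntE h l : dint h l -> Int h = l.
Proof. by move=> hl; apply: dint_unique (xgetI 0 hl) hl. Qed.

Lemma IntB h g : cont01 h -> cont01 g -> Int (fun t => h t - g t) = Int h - Int g.
Proof. by move=> /IntP H /IntP G; apply: IntE; exact: dintB. Qed.

Lemma cont01_comp (f : C -> C) (p : R -> C) : cont01 p ->
  (forall t, 0 <= t <= 1 -> f w @[w --> p t] --> f (p t)) -> cont01 (fun t => f (p t)).
Proof.
move=> cp cf t ht e e0; have /ccvgP/(_ _ e0)/nbhs_normcP[d d0 H] := cf t ht.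
by have [d' d'0 H'] := cp t ht d d0; exists d' => // s /H' /H.
Qed.

Lemma cont01_affine (a b : C) : cont01 (fun t => a + b * t%:C).
Proof.
move=> t _ e e0; have b0 : 0 < normc b + 1 by rewrite ltr_wpDl ?normc_ge0.
exists (e / (normc b + 1)); first exact: divr_gt0.
move=> s; rewrite ltr_pdivlMr// => st; apply: le_lt_trans st.
have -> : a + b * s%:C - (a + b * t%:C) = b * (s - t)%:C :> C by rewrite rmorphB; ring.
by rewrite normc_mul normc_real mulrC ler_wpM2l// lerDl.
Qed.

End DyadicIntegral.

(** * Goursat's theorem for triangles in a closed convex set *)

Section Goursat.
Variable R : realType.
Local Notation C := (CC R).
Implicit Types (f : C -> C) (p q r z w : C) (K : C -> Prop).

Definition seg f p q : C := (q - p) * Int (fun t => f (p + (q - p) * t%:C)).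

Definition tri f p q r : C := seg f p q + seg f q r + seg f r p.

Definition convexC K : Prop :=
  forall p q, K p -> K q -> forall t : R, 0 <= t <= 1 -> K (p + (q - p) * t%:C).

Section ConvexSet.
Variables (K : C -> Prop) (f : C -> C).
Hypothesis Kconvex : convexC K.
Hypothesis fcont : forall z, K z -> f w @[w --> z] --> f z.

Lemma cont01_seg p q : K p -> K q -> cont01 (fun t => f (p + (q - p) * t%:C)).
Proof.
move=> Kp Kq; apply: cont01_comp; first exact: cont01_affine.
by move=> t ht; apply/fcont/Kconvex.
Qed.

Lemma convex_mid p q : K p -> K q -> K ((p + q) / 2).
Proof.
move=> Kp Kq; have := @Kconvex p q Kp Kq 2^-1.
have -> : p + (q - p) * (2^-1)%:C = (p + q) / 2 by rewrite fmorphV rmorph_nat; field.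
by apply; apply/andP; split; lra.
Qed.

Lemma seg_split p q : K p -> K q ->
  seg f p q = seg f p ((p + q) / 2) + seg f ((p + q) / 2) q.
Proof.
move=> Kp Kq; have Km := convex_mid Kp Kq; set m := (p + q) / 2 in Km *.
have E := IntP (cont01_seg Kp Km); have E' := IntP (cont01_seg Km Kq).
set h := fun t => f (p + (q - p) * t%:C).
have L : dint (lhalf h) (Int (fun t => f (p + (m - p) * t%:C))).
  apply: dint_ext E => t _; rewrite /lhalf /h; congr f.
  by rewrite /m rmorphM fmorphV rmorph_nat; field.
have L' : dint (rhalf h) (Int (fun t => f (m + (q - m) * t%:C))).
  apply: dint_ext E' => t _; rewrite /rhalf /h; congr f.
  by rewrite /m rmorphM rmorphD rmorph1 fmorphV rmorph_nat; field.
by rewrite /seg -/h (IntE (dint_split L L')) /m; field.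
Qed.

Lemma seg_rev p q : K p -> K q -> seg f q p = - seg f p q.
Proof.
move=> Kp Kq; have c := cont01_seg Kp Kq.
rewrite /seg (IntE (dint_ext _ (dint_rev c (IntP c)))) ?mulrN -?mulNr ?opprB//.
by move=> t _ /=; congr f; rewrite rmorphB rmorph1; ring.
Qed.

(** Subdivision by the midpoints: each of the three inner segments is described twice, in opposite
    directions. *)
Lemma tri_split p q r : K p -> K q -> K r ->
  tri f p q r = tri f p ((p + q) / 2) ((r + p) / 2) + tri f ((p + q) / 2) q ((q + r) / 2)
    + tri f ((r + p) / 2) ((q + r) / 2) r
    + tri f ((r + p) / 2) ((p + q) / 2) ((q + r) / 2).
Proof.
move=> Kp Kq Kr; have Kpq := convex_mid Kp Kq; have Kqr := convex_mid Kq Kr.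
have Krp := convex_mid Kr Kp.
rewrite /tri (seg_split Kp Kq) (seg_split Kq Kr) (seg_split Kr Kp).
by rewrite (seg_rev Krp Kpq) (seg_rev Kpq Kqr) (seg_rev Kqr Krp); ring.
Qed.

Lemma seg_affine_le p q (a b : C) (M : R) : K p -> K q ->
  (forall t : R, 0 <= t <= 1 ->
    normc (f (p + (q - p) * t%:C) - (a + b * (p + (q - p) * t%:C))) <= M) ->
  normc (seg f p q - (q - p) * (a + b * ((p + q) / 2))) <= normc (q - p) * M.
Proof.
move=> Kp Kq H; rewrite /seg -mulrBr normc_mul ler_wpM2l ?normc_ge0//.
have E := IntP (cont01_seg Kp Kq).
have D := dint_affine (a + b * p) (b * (q - p)).
have -> : a + b * ((p + q) / 2) = a + b * p + b * (q - p) / 2 by field.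
apply: dint_le (dintB E D) => t ht /=.
by rewrite (_ : a + b * p + _ = a + b * (p + (q - p) * t%:C)); [exact: H|ring].
Qed.

(** The affine part integrates to 0 around the triangle, so the error M counts once for each of
    three sides of length at most s. Every point of the perimeter is within 2 s of p. *)
Lemma tri_affine_le p q r (a b : C) (M s : R) : K p -> K q -> K r ->
  (forall w, K w -> normc (w - p) <= s *+ 2 -> normc (f w - (a + b * w)) <= M) ->
  normc (p - q) <= s -> normc (q - r) <= s -> normc (r - p) <= s ->
  normc (tri f p q r) <= s * M *+ 3.
Proof.
move=> Kp Kq Kr H pq qr rp.
have s0 : 0 <= s by rewrite (le_trans (normc_ge0 _) pq).
have M0 : 0 <= M.
  by apply: le_trans (normc_ge0 _) (H p Kp _); rewrite subrr normc_zero mulrn_wge0.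
have tle (x : C) (t : R) : 0 <= t <= 1 -> normc x <= s -> normc (x * t%:C) <= s.
  move=> /andP[t0 t1] xs; rewrite normc_mul normc_real ger0_norm//.
  by rewrite -[s]mulr1 ler_pM ?normc_ge0.
have A : normc (seg f p q - (q - p) * (a + b * ((p + q) / 2))) <= normc (q - p) * M.
  apply: seg_affine_le => // t ht; apply: H; first exact: Kconvex.
  rewrite (addrC p) addrK; rewrite normc_distC in pq.
  by have := tle _ _ ht pq; rewrite mulr2n; lra.
have B : normc (seg f q r - (r - q) * (a + b * ((q + r) / 2))) <= normc (r - q) * M.
  apply: seg_affine_le => // t ht; apply: H; first exact: Kconvex.
  rewrite (_ : q + _ - p = (q - p) + (r - q) * t%:C); last by ring.
  rewrite normc_distC in pq; rewrite normc_distC in qr.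
  have := tle _ _ ht qr; have := normc_leD (q - p) ((r - q) * t%:C); rewrite mulr2n; lra.
have D : normc (seg f r p - (p - r) * (a + b * ((r + p) / 2))) <= normc (p - r) * M.
  apply: seg_affine_le => // t ht; apply: H; first exact: Kconvex.
  rewrite (_ : r + _ - p = (r - p) + (p - r) * t%:C); last by ring.
  have := rp; rewrite normc_distC => pr.
  have := tle _ _ ht pr; have := normc_leD (r - p) ((p - r) * t%:C); rewrite mulr2n; lra.
rewrite (_ : tri f p q r = (seg f p q - (q - p) * (a + b * ((p + q) / 2))) +
  (seg f q r - (r - q) * (a + b * ((q + r) / 2))) +
  (seg f r p - (p - r) * (a + b * ((r + p) / 2)))); last by rewrite /tri; field.
have A' : normc (q - p) * M <= s * M by rewrite ler_wpM2r// normc_distC.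
have B' : normc (r - q) * M <= s * M by rewrite ler_wpM2r// normc_distC.
have D' : normc (p - r) * M <= s * M by rewrite ler_wpM2r// normc_distC.
have -> : s * M *+ 3 = s * M + s * M + s * M by ring.
apply: (le_trans (normc_leD _ _)); apply: lerD; last exact: le_trans D D'.
apply: (le_trans (normc_leD _ _)).
by apply: lerD; [exact: le_trans A A'|exact: le_trans B B'].
Qed.

Record tri_in (T : C * C * C) (s : R) : Prop := TriIn {
  tri_in1 : K T.1.1; tri_in2 : K T.1.2; tri_in3 : K T.2;
  tri_side1 : normc (T.1.1 - T.1.2) <= s; tri_side2 : normc (T.1.2 - T.2) <= s;
  tri_side3 : normc (T.2 - T.1.1) <= s }.

Let J (T : C * C * C) := tri f T.1.1 T.1.2 T.2.

(** One bisection step, keeping a subtriangle that carries at least a quarter of the integral. T' is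
    chosen before s and before any membership in K, so that [choice] yields a step function on all
    triples. *)
Lemma tri_step T : exists T', forall s : R, tri_in T s ->
  [/\ tri_in T' (s / 2), normc (T'.1.1 - T.1.1) <= s & normc (J T) / 4 <= normc (J T')].
Proof.
case: T => [[p q] r].
pose T1 := ((p, (p + q) / 2), (r + p) / 2).
pose T2 := (((p + q) / 2, q), (q + r) / 2).
pose T3 := (((r + p) / 2, (q + r) / 2), r).
pose T4 := (((r + p) / 2, (p + q) / 2), (q + r) / 2).
have half (x y : C) (s : R) : y = x / 2 \/ y = - (x / 2) -> normc x <= s -> normc y <= s / 2.
  by case=> ->; rewrite ?normc_opp normc_half; lra.
suff : exists2 T', (T' = T1 \/ T' = T2) \/ (T' = T3 \/ T' = T4) & (K p -> K q -> K r ->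
    normc (J (p, q, r)) / 4 <= normc (J T')).
  move=> [T' cases large]; exists T' => s [/= Kp Kq Kr pq qr rp].
  have Kpq := convex_mid Kp Kq; have Kqr := convex_mid Kq Kr.
  have Krp := convex_mid Kr Kp; have lT := large Kp Kq Kr.
  have s0 : 0 <= s by rewrite (le_trans (normc_ge0 _) pq).
  move: cases {large} lT => [[->|->]|[->|->]] lT; (split; [split => //= | | exact: lT]).
  - by apply: half pq; left; field.
  - by apply: half qr; left; field.
  - by apply: half rp; left; field.
  - by rewrite /= subrr normc_zero.
  - by apply: half pq; left; field.
  - by apply: half qr; left; field.
  - by apply: half rp; left; field.
  - suff : normc ((p + q) / 2 - p) <= s / 2 by rewrite /=; lra.
    by apply: half pq; right; field.
  - by apply: half pq; left; field.
  - by apply: half qr; left; field.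
  - by apply: half rp; left; field.
  - suff : normc ((r + p) / 2 - p) <= s / 2 by rewrite /=; lra.
    by apply: half rp; left; field.
  - by apply: half qr; right; field.
  - by apply: half rp; right; field.
  - by apply: half pq; right; field.
  - suff : normc ((r + p) / 2 - p) <= s / 2 by rewrite /=; lra.
    by apply: half rp; left; field.
have [l1|l1] := lerP (normc (J (p, q, r)) / 4) (normc (J T1)).
  by exists T1 => //; left; left.
have [l2|l2] := lerP (normc (J (p, q, r)) / 4) (normc (J T2)).
  by exists T2 => //; left; right.
have [l3|l3] := lerP (normc (J (p, q, r)) / 4) (normc (J T3)).
  by exists T3 => //; right; left.
(* When the first three subtriangles fall short, additivity forces the fourth to be large; only this
   lower bound uses that the vertices lie in K. *)
exists T4; first by right; right.
move=> Kp Kq Kr; have E : J (p, q, r) = J T1 + J T2 + J T3 + J T4 by exact: tri_split.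
have := normc_leD (J T1 + J T2 + J T3) (J T4); rewrite -E.
have := normc_leD (J T1 + J T2) (J T3); have := normc_leD (J T1) (J T2); lra.
Qed.

Hypothesis Kclosed : forall z, (forall e : R, 0 < e -> exists2 w, K w & normc (w - z) < e) -> K z.
Hypothesis fderiv : forall z, K z -> exists l, cderiv f z l.

Theorem goursat p q r : K p -> K q -> K r -> tri f p q r = 0.
Proof.
move=> Kp Kq Kr; have [step stepP] := choice tri_step.
pose T n := iter n step ((p, q), r).
pose s := normc (p - q) + normc (q - r) + normc (r - p).
have s0 : 0 <= s by rewrite !addr_ge0 ?normc_ge0.
pose sn n := s / 2 ^+ n.
have sn0 n : 0 <= sn n by rewrite divr_ge0// exprn_ge0.
have snS n : sn n.+1 = sn n / 2 by rewrite /sn exprSr invfM mulrA.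
have Tin n : tri_in (T n) (sn n).
  elim: n => [|n IH]; last by rewrite snS; have [] := stepP (T n) _ IH.
  rewrite /sn expr0 divr1 /s; have := normc_ge0 (p - q); have := normc_ge0 (q - r).
  by have := normc_ge0 (r - p); split => //=; lra.
pose P n := (T n).1.1.
have PS n : normc (P n.+1 - P n) <= sn n by have [_ + _] := stepP _ _ (Tin n).
(* Partial sums of a geometric series; the subtracted term is what makes the induction close. *)
have PD n k : normc (P (n + k)%N - P n) <= sn n *+ 2 - sn (n + k)%N *+ 2.
  elim: k => [|k IH]; first by rewrite addn0 !subrr normc_zero.
  have := normc_dist_tri (P (n + k)%N) (P (n + k.+1)%N) (P n).
  have := PS (n + k)%N; rewrite addnS snS; lra.
have sncvg (e : R) : 0 < e -> exists N, forall k, (N <= k)%N -> sn k < e.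
  move=> e0; have s1 : 0 < s + 1 by rewrite ltr_wpDl.
  have [N HN] := exp2V_lt (divr_gt0 e0 s1); exists N => k /HN.
  rewrite ltr_pdivlMr// mulrC; apply: le_lt_trans.
  by rewrite /sn ler_wpM2r ?lerDl// invr_ge0 exprn_ge0.
have [z Hz] : exists l, forall e : R, 0 < e -> exists N, forall k, (N <= k)%N ->
    normc (P k - l) < e.
  apply: cseq_cauchy => e e0; have e4 : 0 < e / 4 by rewrite divr_gt0.
  have [N HN] := sncvg _ e4; exists N => m n Nm Nn.
  have A k : (N <= k)%N -> normc (P k - P N) <= sn N *+ 2.
    move=> Nk; rewrite -(subnKC Nk); have := PD N (k - N)%N.
    by have := sn0 (N + (k - N))%N; lra.
  have := A _ Nm; have := A _ Nn; have := normc_dist_tri (P N) (P m) (P n).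
  rewrite (normc_distC (P N) (P n)); have := HN N (leqnn _); lra.
have Pz n : normc (P n - z) <= sn n *+ 2.
  apply/ler_addgt0Pl => e e0; have [N HN] := Hz _ e0.
  have := HN (n + N)%N (leq_addl _ _); have := PD n N; have := sn0 (n + N)%N.
  have := normc_dist_tri (P (n + N)%N) (P n) z.
  by rewrite (normc_distC (P n) (P _)); lra.
have Kz : K z.
  apply: Kclosed => e e0; have [N HN] := Hz _ e0; exists (P N); last exact: HN.
  exact: tri_in1 (Tin N).
have [l /cderiv_small fl] := fderiv Kz.
have JT n : normc (J (p, q, r)) / 4 ^+ n <= normc (J (T n)).
  elim: n => [|n IH]; first by rewrite expr0 divr1.
  have [_ _] := stepP _ _ (Tin n); apply: le_trans.
  by rewrite exprSr invfM mulrA ler_wpM2r ?invr_ge0.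
apply/eqP; rewrite -normc_eq0 eq_le normc_ge0 andbT; apply/ler_addgt0Pl => e e0.
rewrite addr0.
(* On the N-th triangle the sides are at most [sn N] and its points are within 4 [sn N] of z, so the
   integral is at most 3 [sn N] (4 e' [sn N]) = 12 e' s^2 / 4^N, while it is at least 4^(-N) times
   the initial one. The d / 5 below makes 4 [sn N] < d. *)
pose e' := e / (12 * s ^+ 2 + 1).
have e'0 : 0 < e' by rewrite divr_gt0// ltr_wpDl// mulr_ge0// sqr_ge0.
have /nbhs_normcP[d d0 Hd] := fl _ e'0.
have d4 : 0 < d / 5 by rewrite divr_gt0.
have [N /(_ N (leqnn _)) HN] := sncvg _ d4.
have [K1 K2 K3 S1 S2 S3] := Tin N.
have := @tri_affine_le _ _ _ (f z - l * z) l (e' * (sn N *+ 4)) (sn N) K1 K2 K3 _ S1 S2 S3.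
have step1 w : K w -> normc (w - (T N).1.1) <= sn N *+ 2 ->
    normc (f w - (f z - l * z + l * w)) <= e' * (sn N *+ 4).
  move=> Kw wT.
  have wz : normc (w - z) <= sn N *+ 4.
    have := normc_dist_tri (P N) w z; have := Pz N; rewrite /P; lra.
  have -> : f w - (f z - l * z + l * w) = f w - f z - l * (w - z) by ring.
  apply: le_trans (Hd w _) _; last by rewrite ler_wpM2l// ltW.
  apply: le_lt_trans wz _; have := sn0 N; lra.
move=> /(_ step1) JN; have := le_trans (JT N) JN.
have pow : (2 : R) ^+ N * 2 ^+ N = 4 ^+ N by rewrite -exprMn; congr (_ ^+ _); ring.
have p4 : 0 < (4 : R) ^+ N by rewrite exprn_gt0.
have -> : sn N * (e' * (sn N *+ 4)) *+ 3 = 12 * e' * s ^+ 2 / 4 ^+ N.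
  by rewrite /sn -pow; field; rewrite expf_neq0.
rewrite ler_pM2r ?invr_gt0// => /le_trans; apply.
rewrite /e' mulrAC mulrA ler_pdivrMr; last by rewrite ltr_wpDl// mulr_ge0// sqr_ge0.
by rewrite mulrC ler_pM2l// lerDl.
Qed.

End ConvexSet.
End Goursat.

(** * Cauchy's formula *)

Section ComplexExp.
Variable R : realType.
Local Notation C := (CC R).

Definition cexp (z : C) : C :=
  (expR (complex.Re z))%:C * (cos (complex.Im z) +i* sin (complex.Im z)).

Lemma cexpD (z w : C) : cexp (z + w) = cexp z * cexp w.
Proof.
case: z w => a b [c d]; rewrite /cexp /= expRD cosD sinD rmorphM.
by apply/eqP; rewrite eq_complex /=; apply/andP; split; apply/eqP; ring.
Qed.

Lemma cis_norm (x : R) : normc (cos x +i* sin x : C) = 1.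
Proof. by rewrite /normc cos2Dsin2 sqrtr1. Qed.

Lemma normc_cexp (z : C) : normc (cexp z) = expR (complex.Re z).
Proof. by rewrite /cexp normc_mul cis_norm mulr1 normc_real ger0_norm ?expR_ge0. Qed.

Lemma cexp0 : cexp 0 = 1.
Proof. by rewrite /cexp /= expR0 cos0 sin0 mul1r. Qed.

Lemma is_derive_small (f : R -> R) (x l : R) : is_derive x 1 f l ->
  forall e : R, 0 < e -> exists2 d : R, 0 < d &
    forall h, `|h| < d -> `|f (x + h) - f x - l * h| <= e * `|h|.
Proof.
move=> /is_derive1_caratheodory[g [fg cg gx]] e e0.
have /cvgrPdist_lt/(_ _ e0)/nbhs_ballP[d /= d0 H] := cg.
exists d => // h hd; rewrite fg (addrC x) addrK -mulrBl normrM ler_wpM2r// -gx distrC.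
by apply/ltW/H; rewrite -ball_normE /ball_/= opprD addrCA subrr addr0 normrN.
Qed.

(** Only the point 0 requires the real derivatives of exp, cos and sin; the addition formula
    transports the result to every point. *)
Lemma cderiv_cexp0 : cderiv cexp 0 1.
Proof.
apply/cderiv_small => e e0; rewrite cexp0.
(* With n = |w|, the four error terms are at most 2 e' n, 2 e' n, e' n and e' n, whence the 6; e' <=
   1 ensures [expR x] <= 2. *)
pose e' := Num.min (e / 6) 1.
have e'0 : 0 < e' by rewrite lt_min divr_gt0//=.
have e'e : e' <= e / 6 by rewrite ge_min lexx.
have e'1 : e' <= 1 by rewrite ge_min lexx orbT.
have [d1 d10 H1] := is_derive_small (is_derive_expR (0 : R)) e'0.
have [d2 d20 H2] := is_derive_small (is_derive_cos (0 : R)) e'0.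
have [d3 d30 H3] := is_derive_small (is_derive_sin (0 : R)) e'0.
apply/nbhs_normcP; exists (Num.min (e' / 2) (Num.min d1 (Num.min d2 d3))).
  by rewrite !lt_min d10 d20 d30 divr_gt0.
move=> w; rewrite subr0 !lt_min => /and4P[w0 w1 w2 w3]; rewrite mul1r.
have hx := normc_geRe w; have hy := normc_geIm w.
set x := complex.Re w in hx *; set y := complex.Im w in hy *.
have {H1} := H1 x (le_lt_trans hx w1); have {H2} := H2 y (le_lt_trans hy w2).
have {H3} := H3 y (le_lt_trans hy w3).
rewrite !add0r expR0 cos0 sin0 oppr0 !mul0r !addr0 ?subr0 !mul1r => H3 H2 H1.
set n := normc w in hx hy w0 w1 w2 w3 *.
have ex : `|expR x - 1| <= e'.
  have := ler_normD (expR x - 1 - x) x; rewrite subrK => /le_trans; apply.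
  have : e' * `|x| <= 1 * `|x| by rewrite ler_wpM2r.
  lra.
have ex2 : expR x <= 2 by have := ler_norm (expR x - 1); lra.
have ex0 := expR_ge0 x.
have xn : e' * `|x| <= e' * n by rewrite ler_wpM2l// ltW.
have yn : e' * `|y| <= e' * n by rewrite ler_wpM2l// ltW.
have -> : cexp w - 1 - w = (expR x * (cos y - 1) + (expR x - 1 - x)) +i*
    (expR x * (sin y - y) + (expR x - 1) * y) :> C.
  rewrite /cexp -/x -/y; case: (w) @x @y {hx hy H1 H2 H3 ex ex2 ex0 xn yn} => a b /=.
  by apply/eqP; rewrite eq_complex /=; apply/andP; split; apply/eqP; ring.
apply: (le_trans (normc_leReIm _)) => /=.
have A1 : `|expR x * (cos y - 1)| <= 2 * (e' * n).
  by rewrite normrM (ger0_norm ex0) ler_pM// (le_trans H2).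
have A2 : `|expR x * (sin y - y)| <= 2 * (e' * n).
  by rewrite normrM (ger0_norm ex0) ler_pM// (le_trans H3).
have A3 : `|(expR x - 1) * y| <= e' * n by rewrite normrM ler_pM.
have := ler_normD (expR x * (cos y - 1)) (expR x - 1 - x).
have := ler_normD (expR x * (sin y - y)) ((expR x - 1) * y).
have n0 : 0 <= n by exact: normc_ge0.
have : e' * n <= e / 6 * n by rewrite ler_wpM2r.
lra.
Qed.

Lemma cderiv_cexp z : cderiv cexp z (cexp z).
Proof.
have H : cderiv (fun w => cexp (w - z)) z 1.
  have := @cderiv_comp _ (fun w => w - z) cexp z 1 1 (cderiv_subC z z).
  by rewrite subrr mulr1; apply; exact: cderiv_cexp0.
have := cderivZ (cexp z) H; rewrite mulr1; apply: cderiv_near.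
by apply: filterE => w; rewrite -cexpD (addrC z) subrK.
Qed.

End ComplexExp.

(** * Circular means and Cauchy's formula *)

Section CircleMeans.
Variable R : realType.
Local Notation C := (CC R).
Implicit Types (f F : C -> C) (z w : C).

Definition tau : R := pi *+ 2.

Definition circ z (r t : R) : C := z + r%:C * (cos (tau * t) +i* sin (tau * t)).

Lemma circ_norm z (r t : R) : 0 <= r -> normc (circ z r t - z) = r.
Proof. by move=> r0; rewrite /circ addrC addKr normc_mul cis_norm mulr1 normc_real ger0_norm. Qed.

Lemma circ_dist z (r r' t : R) : normc (circ z r t - circ z r' t) = `|r - r'|.
Proof.
by rewrite /circ opprD addrACA subrr add0r -mulrBl -rmorphB normc_mul cis_norm mulr1 normc_real.
Qed.

Lemma cont01_circ z (r : R) : cont01 (circ z r).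
Proof.
move=> t _ e e0; have r0 : 0 < `|r| + 1 by rewrite ltr_wpDl.
have e2 : 0 < e / 2 / (`|r| + 1) by rewrite !divr_gt0.
have cc : {for t, continuous (fun s : R => cos (tau * s))}.
  apply: (@continuous_comp _ _ _ (fun s => tau * s) cos); last exact: continuous_cos.
  exact: mulrl_continuous.
have cs : {for t, continuous (fun s : R => sin (tau * s))}.
  apply: (@continuous_comp _ _ _ (fun s => tau * s) sin); last exact: continuous_sin.
  exact: mulrl_continuous.
have /cvgrPdist_lt/(_ _ e2)/nbhs_ballP[d1 /= d10 H1] := cc.
have /cvgrPdist_lt/(_ _ e2)/nbhs_ballP[d2 /= d20 H2] := cs.
exists (Num.min d1 d2); first by rewrite lt_min d10.
move=> s; rewrite lt_min => /andP[s1 s2].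
have {}H1 := H1 s; have {}H2 := H2 s.
rewrite -ball_normE /ball_/= !(distrC t s) in H1 H2.
have := H1 s1; have := H2 s2; rewrite !(distrC _ (_ (tau * s))) => A B.
rewrite /circ opprD addrACA subrr add0r -mulrBr normc_mul normc_real.
have := normc_leReIm ((cos (tau * s) +i* sin (tau * s)) - (cos (tau * t) +i* sin (tau * t)) : C).
move=> /= D; have {D} : normc ((cos (tau * s) +i* sin (tau * s)) -
  (cos (tau * t) +i* sin (tau * t)) : C) < e / (`|r| + 1).
  have -> : e / (`|r| + 1) = e / 2 / (`|r| + 1) + e / 2 / (`|r| + 1) by field; exact: lt0r_neq0.
  exact: le_lt_trans D (ltrD B A).
rewrite ltr_pdivlMr// mulrC; apply: le_lt_trans.
by rewrite ler_wpM2r ?normc_ge0// lerDl.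
Qed.

Lemma cont01_circ_comp F z (r : R) : 0 <= r ->
  (forall w, normc (w - z) = r -> F v @[v --> w] --> F w) ->
  cont01 (fun t => F (circ z r t)).
Proof.
move=> r0 cF; apply: cont01_comp; first exact: cont01_circ.
by move=> t _; apply: cF; exact: circ_norm.
Qed.

(* In the coordinate s, where w = z + exp s, the annulus is a rectangle of height
   [tau] whose horizontal sides cancel by periodicity, so Goursat's theorem
   compares the two vertical ones. *)
Lemma circle_mean_const F z (r1 r2 : R) : 0 < r1 -> r1 <= r2 ->
  (forall w, r1 <= normc (w - z) <= r2 -> exists l, cderiv F w l) ->
  Int (fun t => F (circ z r1 t)) = Int (fun t => F (circ z r2 t)).
Proof.
move=> r10 r12 FD; have r20 := lt_le_trans r10 r12.
pose g (s : C) := F (z + cexp s).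
pose a : C := (ln r1)%:C; pose b : C := (ln r2)%:C; pose ti : C := 0 +i* tau.
pose K (s : C) := ln r1 <= complex.Re s <= ln r2.
have ReD (x y : C) : complex.Re (x + y) = complex.Re x + complex.Re y by case: x; case: y.
have Kconv : convexC K.
  move=> p q /andP[p1 p2] /andP[q1 q2] t /andP[t0 t1]; apply/andP.
  have -> : complex.Re (p + (q - p) * t%:C) = complex.Re p * (1 - t) + complex.Re q * t.
    case: (p) => x y; case: (q) => x' y' /=; ring.
  have t1' : 0 <= 1 - t by rewrite subr_ge0.
  split.
    rewrite (_ : ln r1 = ln r1 * (1 - t) + ln r1 * t); last by ring.
    by apply: lerD; rewrite ler_wpM2r.
  rewrite (_ : ln r2 = ln r2 * (1 - t) + ln r2 * t); last by ring.
  by apply: lerD; rewrite ler_wpM2r.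
have Kcl s : (forall e : R, 0 < e -> exists2 w, K w & normc (w - s) < e) -> K s.
  move=> H; have D w : normc (w - s) >= `|complex.Re w - complex.Re s|.
    by apply: le_trans (normc_geRe _); case: (w); case: (s).
  apply/andP; split; apply/ler_addgt0Pl => e /H[w /andP[w1 w2]];
    move/(le_lt_trans (D w)); rewrite ltr_norml => /andP[? ?]; lra.
have gD s : K s -> exists l, cderiv g s l.
  move=> /andP[s1 s2]; have /FD[l Fl] : r1 <= normc (z + cexp s - z) <= r2.
    rewrite (addrC z) addrK normc_cexp -[X in X <= _](@lnK _ r1)//.
    by rewrite -[X in _ && (_ <= X)](@lnK _ r2)// !ler_expR s1.
  exists (l * cexp s); apply: (@cderiv_comp _ (fun s => z + cexp s) F) => //.
  by have := cderivD (cderiv_cst z s) (cderiv_cexp s); rewrite add0r.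
have gc s : K s -> g w @[w --> s] --> g s by move=> /gD[l]; exact: cderiv_cont.
have ln12 : ln r1 <= ln r2 by rewrite ler_ln.
have Ka : K a by rewrite /K/= lexx.
have Kb : K b by rewrite /K/= lexx andbT.
have Ka' : K (a + ti) by rewrite /K/= addr0 lexx.
have Kb' : K (b + ti) by rewrite /K/= addr0 lexx andbT.
have per s : g (s + ti) = g s.
  rewrite /g cexpD; congr (F (z + _)); rewrite /cexp /= expR0 /tau cos2pi sin2pi.
  by rewrite mul1r; apply: mulr1.
(* The diagonal from a to b + ti cuts the rectangle into two triangles. *)
have T1 := goursat Kconv gc Kcl gD Ka Kb Kb'.
have T2 := goursat Kconv gc Kcl gD Ka Kb' Ka'.
have S1 := seg_rev Kconv gc Ka Kb'.
have S2 := seg_rev Kconv gc Ka' Kb'.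
have S3 := seg_rev Kconv gc Ka Ka'.
have S4 : seg g (a + ti) (b + ti) = seg g a b.
  rewrite /seg opprD addrACA subrr addr0; congr (_ * Int _).
  by apply/funext => t; rewrite addrAC per.
have E : seg g b (b + ti) = seg g a (a + ti).
  move: T1 T2; rewrite /tri S1 S2 S3 S4 => T1 T2; apply/eqP; rewrite -subr_eq0.
  by apply/eqP; rewrite -[RHS]addr0 -{1}T1 -T2; ring.
have segE (r : R) : 0 < r ->
    seg g (ln r)%:C ((ln r)%:C + ti) = ti * Int (fun t => F (circ z r t)).
  move=> r0; have E' : (ln r)%:C + ti - (ln r)%:C = ti by rewrite addrAC subrr add0r.
  rewrite /seg E'; congr (_ * Int _); apply/funext => t; rewrite /g /circ; congr (F (z + _)).
  have -> : (ln r)%:C + ti * t%:C = ln r +i* (tau * t) :> C.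
    by apply/eqP; rewrite eq_complex /=; apply/andP; split; apply/eqP; ring.
  by rewrite /cexp /= lnK.
have ti0 : ti != 0.
  rewrite eq_complex /= negb_and orbC (_ : tau != 0)//.
  by rewrite /tau mulrn_eq0 negb_or /= gt_eqF// pi_gt0.
by move: E; rewrite /a /b !segE// => /(mulfI ti0).
Qed.

Lemma circle_uniform_cont F z (r : R) : 0 <= r ->
  (forall w, normc (w - z) = r -> F v @[v --> w] --> F w) ->
  forall e : R, 0 < e -> exists2 d : R, 0 < d & forall s, `|s - r| < d ->
  forall t, 0 <= t <= 1 -> normc (F (circ z s t) - F (circ z r t)) < e.
Proof.
move=> r0 cF e e0; have e2 : 0 < e / 2 by rewrite divr_gt0.
have /compact_near_coveringP cK := @segment_compact R 0 1.
pose P (s t : R) := normc (F (circ z s t) - F (circ z r t)) < e.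
have : \forall s \near nbhs r, `[0%R, 1%R]%classic `<=` P s.
  apply: cK => t; rewrite /= in_itv/= => ht.
  have /ccvgP/(_ _ e2)/nbhs_normcP[d d0 H] := cF _ (circ_norm z t r0).
  have d2 : 0 < d / 2 by rewrite divr_gt0.
  have [d' d'0 H'] := @cont01_circ z r t ht _ d2.
  exists ([set t' | `|t - t'| < d'], [set s | `|r - s| < d / 2]).
    split; apply/nbhs_ballP; [exists d' => //= x|exists (d / 2) => //= x];
      by rewrite -ball_normE.
  move=> [t' s] /= [tt' rs]; rewrite distrC in tt'; rewrite distrC in rs.
  have A := H' _ tt'; have B := circ_dist z s r t'.
  have /H X : normc (circ z s t' - circ z r t) < d.
    have := normc_dist_tri (circ z r t') (circ z s t') (circ z r t); lra.
  have /H Y : normc (circ z r t' - circ z r t) < d by lra.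
  rewrite /P; have := normc_dist_tri (F (circ z r t)) (F (circ z s t')) (F (circ z r t')).
  by rewrite (normc_distC (F (circ z r t))); lra.
move=> /nbhs_ballP[d /= d0 H]; exists d => // s sr t ht.
by apply: (H s); rewrite ?in_itv//= -ball_normE /ball_/= distrC.
Qed.

(** Extends the constancy of the means to a circle on which F is only continuous, such as the one
    through w in Cauchy's formula, and to radius 0, where the circle is a point. *)
Lemma circle_mean_cont F z (r : R) v : 0 <= r ->
  (forall w, normc (w - z) = r -> F u @[u --> w] --> F w) ->
  (forall d : R, 0 < d -> exists s, [/\ `|s - r| < d,
    cont01 (fun t => F (circ z s t)) & Int (fun t => F (circ z s t)) = v]) ->
  Int (fun t => F (circ z r t)) = v.
Proof.
move=> r0 cF H; apply/eqP; rewrite -subr_eq0 -normc_eq0 eq_le normc_ge0 andbT.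
apply/ler_addgt0Pl => e e0; rewrite addr0; have [d d0 Hd] := circle_uniform_cont r0 cF e0.
have [s [sr cs <-]] := H d d0; have c := cont01_circ_comp r0 cF.
by rewrite normc_distC; apply: dint_le (dintB (IntP cs) (IntP c)) => t ht; exact/ltW/Hd.
Qed.

(* The mean does not depend on the radius; let the radius tend to infinity. *)
Lemma cauchy_kernel z w (r : R) : normc (w - z) < r ->
  Int (fun t => (circ z r t - z) / (circ z r t - w)) = 1.
Proof.
move=> wr; have r0 : 0 < r := le_lt_trans (normc_ge0 _) wr.
pose G u := (u - z) / (u - w).
have GD u : u != w -> exists l, cderiv G u l.
  move=> uw; eexists; apply: cderivF; [by rewrite subr_eq0|exact: cderiv_subC|exact: cderiv_subC].
have far u : r <= normc (u - z) -> u != w.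
  by move=> ur; apply: contraTneq ur => ->; rewrite -ltNge.
have E (r' : R) : r <= r' -> Int (fun t => G (circ z r t)) = Int (fun t => G (circ z r' t)).
  by move=> rr'; apply: circle_mean_const => // u /andP[ur _]; exact/GD/far.
have cG (r' : R) : r <= r' -> cont01 (fun t => G (circ z r' t)).
  move=> rr'; apply: cont01_circ_comp; first exact: le_trans (ltW r0) rr'.
  move=> u ur; have [|l] := GD u; last exact: cderiv_cont.
  by apply: far; rewrite ur.
apply/eqP; rewrite -subr_eq0 -normc_eq0 eq_le normc_ge0 andbT.
apply/ler_addgt0Pl => e e0; rewrite addr0.
(* The circle of radius r' stays at distance more than r / e from w, which makes |G - 1| at most e
   on it. *)
pose r' := r + r / e; have rr' : r <= r' by rewrite lerDl divr_ge0// ltW.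
rewrite -/(G _) (E _ rr') -(IntE (dint_cst (1 : C))).
apply: dint_le (dintB (IntP (cG _ rr')) (IntP _)) => [t ht|]; last first.
  exact: (cont01_comp (cont01_circ z r) (fun t _ => ccvg_cst 1 _)).
have r'0 : 0 <= r' by apply: le_trans rr'; exact: ltW.
have cn := circ_norm z t r'0.
have lo : r / e < normc (circ z r' t - w).
  have := normc_dist_tri w (circ z r' t) z; rewrite cn /r'; lra.
have uw : circ z r' t - w != 0.
  by rewrite -normc_gt0; apply: lt_trans lo; rewrite divr_gt0.
have -> : G (circ z r' t) - 1 = (w - z) / (circ z r' t - w) by rewrite /G; field.
rewrite normc_div ler_pdivrMr ?normc_gt0//.
by apply: le_trans (ltW wr) _; rewrite -ler_pdivrMl// mulrC ltW.
Qed.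

(* The circular means of (u - z) (f u - f w) / (u - w) are constant on either
   side of the radius |w - z|, and continuous there; the limit at radius 0
   is 0. *)
Theorem cauchy_formula f z w (r : R) : normc (w - z) < r ->
  (forall u, normc (u - z) <= r -> exists l, cderiv f u l) ->
  f w = Int (fun t => f (circ z r t) * (circ z r t - z) / (circ z r t - w)).
Proof.
move=> wr fD; have r0 : 0 < r := le_lt_trans (normc_ge0 _) wr.
have [l fl] := fD w (ltW wr); have [phi phil /nbhs_normcP[d0 d00 fphi]] := fl.
pose q u := if u == w then l else (f u - f w) / (u - w).
pose F u := (u - z) * q u.
have FD u : u != w -> normc (u - z) <= r -> exists l, cderiv F u l.
  move=> uw ur; have [l' fl'] := fD u ur; eexists.
  apply: (cderivM (cderiv_subC z u)).
  apply: (@cderiv_near _ (fun v => (f v - f w) / (v - w))).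
    apply/nbhs_normcP; exists (normc (u - w)); first by rewrite normc_gt0 subr_eq0.
    move=> v vu; rewrite /q ifN//; apply: contraTneq vu => ->.
    by rewrite normc_distC ltxx.
  apply: cderivF; [by rewrite subr_eq0| |exact: cderiv_subC].
  by apply: cderivB; [exact: fl'|exact: cderiv_cst].
have Fc u : normc (u - z) <= r -> F v @[v --> u] --> F u.
  move=> ur; have [->|uw] := eqVneq u w; last by have [l'] := FD u uw ur; exact: cderiv_cont.
  apply: ccvgM; first exact: (ccvgB (ccvg_id _) (ccvg_cst _ _)).
  rewrite /q eqxx; apply/ccvgP => e e0; move/ccvgP/(_ _ e0) : phil.
  move=> /nbhs_normcP[d1 d10 phil]; apply/nbhs_normcP.
  exists (Num.min d0 d1) => [|v]; first by rewrite lt_min d00.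
  rewrite lt_min => /andP[v0 v1]; case: eqVneq => [_|vw]; first by rewrite subrr normc_zero.
  by rewrite fphi// mulfK ?subr_eq0//; exact: phil.
pose V s := Int (fun t => F (circ z s t)).
pose sg := normc (w - z).
have sg0 : 0 <= sg by exact: normc_ge0.
have cV (s : R) : 0 <= s -> s <= r -> cont01 (fun t => F (circ z s t)).
  by move=> s0 sr; apply: (cont01_circ_comp s0) => u us; apply: Fc; rewrite us.
have V1 (s : R) : sg < s -> s <= r -> V s = V r.
  move=> sgs sr; apply: circle_mean_const => //; first exact: le_lt_trans sgs.
  move=> u /andP[us ur]; apply: FD => //; apply: contraTneq us => ->.
  by rewrite -ltNge.
have V2 : V sg = V r.
  apply: (circle_mean_cont sg0) => [u us|d d1]; first by apply: Fc; rewrite us ltW.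
  pose s := Num.min r (sg + d / 2).
  have sgs : sg < s by rewrite lt_min wr ltrDl divr_gt0.
  have sr : s <= r by rewrite ge_min lexx.
  exists s; split; [|apply: cV => //; apply: ltW; exact: le_lt_trans sgs|exact: V1].
  rewrite gtr0_norm ?subr_gt0// ltrBlDl (@le_lt_trans _ _ (sg + d / 2))//.
    by rewrite ge_min lexx orbT.
  by rewrite ltrD2l; lra.
have V0 : V r = V 0.
  have [sge|sgn] := eqVneq sg 0; first by rewrite -V2 sge.
  have sgp : 0 < sg by rewrite lt_def sgn.
  have V3 (s1 s2 : R) : 0 < s1 -> s1 <= s2 -> s2 < sg -> V s1 = V s2.
    move=> s10 s12 s2g; apply: circle_mean_const => // u /andP[us us2].
    apply: FD; last by rewrite (le_trans us2)// ltW// (lt_trans s2g).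
    by apply: contraTneq us2 => ->; rewrite -ltNge.
  have V4 (s1 : R) : 0 < s1 -> s1 < sg -> V sg = V s1.
    move=> s10 s1g; apply: (circle_mean_cont sg0) => [u us|d d1]; first by apply: Fc; rewrite us ltW.
    pose s := Num.max s1 (sg - d / 2).
    have ss : s < sg by rewrite gt_max s1g /=; lra.
    have s1s : s1 <= s by rewrite le_max lexx.
    exists s; split; [|apply: cV|]; last by rewrite [RHS](V3 s1 s).
    - rewrite distrC gtr0_norm ?subr_gt0// ltrBlDl -ltrBlDr (@lt_le_trans _ _ (sg - d / 2))//.
        by lra.
      by rewrite le_max lexx orbT.
    - exact: le_trans (ltW s10) s1s.
    - by apply: ltW; exact: lt_trans ss wr.
  rewrite -V2; apply/esym; apply: (circle_mean_cont (lexx 0)) => [u us|d d1].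
    by apply: Fc; rewrite us ltW.
  pose s := Num.min (sg / 2) (d / 2).
  have s0 : 0 < s by rewrite lt_min !divr_gt0.
  have ss : s < sg by rewrite gt_min ltr_pdivrMr// ltr_pMr// ltr1n.
  exists s; split; [|apply: cV => //; apply: ltW => //|].
  - by rewrite subr0 gtr0_norm// gt_min orbC ltr_pdivrMr// ltr_pMr// ltr1n.
  - by rewrite (lt_trans ss).
  - by apply/esym/V4.
have Vr0 : V r = 0.
  rewrite V0; apply: IntE; have -> : (fun t => F (circ z 0 t)) = fun=> 0.
    by apply/funext => t; rewrite /F /circ mul0r addr0 subrr mul0r.
  exact: dint_cst.
have cG : cont01 (fun t => (circ z r t - z) / (circ z r t - w)).
  apply: (@cont01_circ_comp (fun u => (u - z) / (u - w))); first exact: ltW.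
  move=> u ur; have uw : u - w != 0.
    by rewrite subr_eq0; apply: contraTneq wr => <-; rewrite ur ltxx.
  apply: ccvgM; first exact: (ccvgB (ccvg_id _) (ccvg_cst _ _)).
  exact: (ccvgV uw (ccvgB (ccvg_id _) (ccvg_cst _ _))).
(* On the circle F u + f w (u - z) / (u - w) = f u (u - z) / (u - w), and the means of the two terms
   on the left are 0 and f w. *)
have D := dintD (IntP (cV _ (ltW r0) (lexx _))) (dintZ (f w) (IntP cG)).
rewrite -/(V r) Vr0 cauchy_kernel// add0r mulr1 in D.
apply/esym/IntE; apply: dint_ext D => t _ /=.
have cn := circ_norm z t (ltW r0).
have uw : circ z r t != w by apply: contraTneq wr => <-; rewrite cn ltxx.
by rewrite /F /q ifN//; field; rewrite subr_eq0.
Qed.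

End CircleMeans.

(** * Cauchy-type integrals and iterated difference quotients *)

Section CauchyType.
Variable R : realType.
Local Notation C := (CC R).
Implicit Types (f F P : C -> C) (z w u v : C).

Lemma near_ball z u (r : R) : normc (u - z) < r -> \forall v \near u, normc (v - z) < r.
Proof.
move=> ur; apply/nbhs_normcP; exists (r - normc (u - z)); first by rewrite subr_gt0.
by move=> v vu; have := normc_dist_tri u v z; lra.
Qed.

Lemma cont01_bounded (h : R -> C) : cont01 h ->
  exists2 M : R, 0 < M & forall t, 0 <= t <= 1 -> normc (h t) <= M.
Proof.
move=> ch; have /compact_near_coveringP cK := @segment_compact R 0 1.
pose Q (M t : R) := normc (h t) <= M.
have : \forall M \near +oo, `[0%R, 1%R]%classic `<=` Q M.
  apply: cK => t; rewrite /= in_itv/= => ht.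
  have [d d0 H] := ch t ht 1 ltr01.
  exists ([set t' | `|t - t'| < d], [set M | normc (h t) + 1 < M]).
    split; first by apply/nbhs_ballP; exists d => //= x; rewrite -ball_normE.
    by exists (normc (h t) + 1); split => //; rewrite num_real.
  move=> [t' M] /= [tt' hM]; rewrite /Q.
  rewrite distrC in tt'; have := H _ tt'; have := normc_lerB (h t') (h t); lra.
move=> [M [_ HM]]; exists (Num.max 1 (M + 1)); first by rewrite lt_max ltr01.
move=> t ht; apply: (HM (Num.max 1 (M + 1))); last by rewrite /= in_itv.
by rewrite lt_max ltrDl ltr01 orbT.
Qed.

(** Differentiation under the integral in Caratheodory's form: k v is the difference quotient of h
    between w and v, and a Lipschitz bound uniform along the circle gives the continuity at w of its
    integral. *)
Lemma Int_cderiv (h k : C -> C -> C) z (r : R) w (L d : R) : 0 < d -> 0 <= L ->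
  (forall v, normc (v - w) < d -> cont01 (fun t => h v (circ z r t))) ->
  (forall v, normc (v - w) < d -> cont01 (fun t => k v (circ z r t))) ->
  (forall v t, normc (v - w) < d -> 0 <= t <= 1 -> let u := circ z r t in
     h v u - h w u = k v u * (v - w) /\ normc (k v u - k w u) <= L * normc (v - w)) ->
  cderiv (fun v => Int (fun t => h v (circ z r t))) w (Int (fun t => k w (circ z r t))).
Proof.
move=> d0 L0 ch ck H.
have ww : normc (w - w) < d by rewrite subrr normc_zero.
exists (fun v => Int (fun t => k v (circ z r t))).
  apply/ccvgP => e e0; have L1 : 0 < L + 1 by rewrite ltr_wpDl.
  apply/nbhs_normcP; exists (Num.min d (e / (L + 1))); first by rewrite lt_min d0 divr_gt0.
  move=> v; rewrite lt_min => /andP[vd]; rewrite ltr_pdivlMr// => ve.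
  apply: le_lt_trans ve; rewrite mulrC.
  apply: dint_le (dintB (IntP (ck _ vd)) (IntP (ck _ ww))) => t ht.
  have [_] := H v t vd ht; move/le_trans; apply; rewrite ler_wpM2r ?normc_ge0//.
  by rewrite lerDl.
apply/nbhs_normcP; exists d => // v vd.
rewrite -IntB; [|exact: ch|exact: ch]; rewrite mulrC.
apply: IntE; apply: dint_ext (dintZ (v - w) (IntP (ck _ vd))) => t ht.
by have [-> _] := H v t vd ht; rewrite mulrC.
Qed.

Section OnCircle.
Variables (z : C) (r : R) (P : C -> C).
Hypothesis r0 : 0 < r.
Hypothesis Pc : forall u, normc (u - z) = r -> P v @[v --> u] --> P u.

Let off w u : normc (w - z) < r -> normc (u - z) = r -> u - w != 0.
Proof. by move=> wr ur; rewrite subr_eq0; apply: contraTneq wr => <-; rewrite ur ltxx. Qed.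

Lemma cont01_kernel w n : normc (w - z) < r ->
  cont01 (fun t => P (circ z r t) / (circ z r t - w) ^+ n).
Proof.
move=> wr; apply: (@cont01_circ_comp _ (fun u => P u / (u - w) ^+ n)); first exact: ltW.
move=> u ur; apply: ccvgM; first exact: Pc.
apply: ccvgV; first by rewrite expf_neq0// off.
by apply: ccvgX; exact: (ccvgB (ccvg_id _) (ccvg_cst _ _)).
Qed.

Lemma near_circ_bound w : normc (w - z) < r -> exists2 d : R, 0 < d & exists2 B : R, 0 < B &
  forall v t, normc (v - w) < d -> normc (v - z) < r /\ normc (circ z r t - v)^-1 <= B.
Proof.
move=> wr; pose d := (r - normc (w - z)) / 2; have d0 : 0 < d by rewrite divr_gt0 ?subr_gt0.
exists d => //; exists d^-1; first by rewrite invr_gt0.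
move=> v t vd; have A := normc_dist_tri w v z.
have B := normc_dist_tri v (circ z r t) z; rewrite (circ_norm _ _ (ltW r0)) in B.
split; first by rewrite /d in vd; lra.
have lo : d <= normc (circ z r t - v) by rewrite /d in vd *; lra.
by rewrite normc_inv lef_pV2// posrE (lt_le_trans d0 lo).
Qed.

(** P is merely continuous on the circle; the differentiability in v comes from the kernel 1 / (u -
    v). This is what lets holomorphy pass to uniform limits. *)
Lemma cauchy_type_cderiv w : normc (w - z) < r ->
  cderiv (fun v => Int (fun t => P (circ z r t) / (circ z r t - v))) w
    (Int (fun t => P (circ z r t) / (circ z r t - w) ^+ 2)).
Proof.
move=> wr; have [d d0 [B B0 HB]] := near_circ_bound wr.
have [M M0 HM] : exists2 M : R, 0 < M & forall t, 0 <= t <= 1 -> normc (P (circ z r t)) <= M.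
  by apply: cont01_bounded; exact: (cont01_circ_comp (ltW r0) Pc).
have := @Int_cderiv (fun v u => P u / (u - v)) (fun v u => P u / ((u - w) * (u - v))) z r w
  (M * (B * B * B)) d d0.
have -> : (fun t => P (circ z r t) / ((circ z r t - w) * (circ z r t - w))) =
    (fun t => P (circ z r t) / (circ z r t - w) ^+ 2) by apply/funext => t; rewrite expr2.
apply.
- by rewrite !mulr_ge0// ltW.
- by move=> v vd; apply: (@cont01_kernel v 1); have [] := HB v 0 vd.
- move=> v vd; have [vr _] := HB v 0 vd.
  apply: (@cont01_circ_comp _ (fun u => P u / ((u - w) * (u - v)))); first exact: ltW.
  move=> u ur; apply: ccvgM; first exact: Pc.
  apply: ccvgV; first by rewrite mulf_neq0// off.
  exact: (ccvgM (ccvgB (ccvg_id _) (ccvg_cst _ _)) (ccvgB (ccvg_id _) (ccvg_cst _ _))).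
move=> v t vd ht u; have [vr Bv] := HB v t vd.
have [_ Bw] : normc (w - z) < r /\ normc (circ z r t - w)^-1 <= B.
  by apply: HB; rewrite subrr normc_zero.
have ur : normc (u - z) = r by apply: circ_norm; exact: ltW.
have uw := off wr ur; have uv := off vr ur.
split; first by field; rewrite uw uv.
have -> : P u / ((u - w) * (u - v)) - P u / ((u - w) * (u - w)) =
    P u * ((u - w)^-1 * (u - w)^-1 * (u - v)^-1) * (v - w) by field; rewrite uw uv.
rewrite normc_mul ler_wpM2r ?normc_ge0// !normc_mul.
apply: ler_pM; rewrite ?mulr_ge0 ?normc_ge0//; first exact: HM.
by rewrite !ler_pM ?mulr_ge0 ?normc_ge0.
Qed.

Lemma cauchy_type_cderiv2 w : normc (w - z) < r -> exists l,
  cderiv (fun v => Int (fun t => P (circ z r t) / (circ z r t - v) ^+ 2)) w l.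
Proof.
move=> wr; have [d d0 [B B0 HB]] := near_circ_bound wr.
have [M M0 HM] : exists2 M : R, 0 < M & forall t, 0 <= t <= 1 -> normc (P (circ z r t)) <= M.
  by apply: cont01_bounded; exact: (cont01_circ_comp (ltW r0) Pc).
pose k v u := P u * ((u - w)^-1 * (u - v)^-1 * ((u - w)^-1 + (u - v)^-1)).
eexists; apply: (@Int_cderiv (fun v u => P u / (u - v) ^+ 2) k z r w
  (M * (B * B * B * (B *+ 3))) d d0).
- by rewrite !mulr_ge0 ?mulrn_wge0// ltW.
- by move=> v vd; apply: cont01_kernel; have [] := HB v 0 vd.
- move=> v vd; have [vr _] := HB v 0 vd.
  apply: (@cont01_circ_comp _ (k v)); first exact: ltW.
  move=> u ur; apply: ccvgM; first exact: Pc.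
  have A : (u' - w)^-1 @[u' --> u] --> (u - w)^-1.
    exact: (ccvgV (off wr ur) (ccvgB (ccvg_id _) (ccvg_cst _ _))).
  have A' : (u' - v)^-1 @[u' --> u] --> (u - v)^-1.
    exact: (ccvgV (off vr ur) (ccvgB (ccvg_id _) (ccvg_cst _ _))).
  exact: (ccvgM (ccvgM A A') (ccvgD A A')).
move=> v t vd ht u; have [vr Bv] := HB v t vd.
have [_ Bw] : normc (w - z) < r /\ normc (circ z r t - w)^-1 <= B.
  by apply: HB; rewrite subrr normc_zero.
have ur : normc (u - z) = r by apply: circ_norm; exact: ltW.
have uw := off wr ur; have uv := off vr ur.
split; first by rewrite /k; field; rewrite uw uv.
have -> : k v u - k w u =
    P u * ((u - w)^-1 * (u - w)^-1 * (u - v)^-1 * ((u - w)^-1 *+ 2 + (u - v)^-1)) * (v - w).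
  by rewrite /k; field; rewrite uw uv.
rewrite normc_mul ler_wpM2r ?normc_ge0// !normc_mul.
apply: ler_pM; rewrite ?mulr_ge0 ?normc_ge0//; first exact: HM.
apply: ler_pM; rewrite ?mulr_ge0 ?normc_ge0//.
  by rewrite !ler_pM ?mulr_ge0 ?normc_ge0.
have := normc_leD ((u - w)^-1 *+ 2) (u - v)^-1.
have := normc_leD (u - w)^-1 (u - w)^-1; rewrite -mulr2n /u; lra.
Qed.

End OnCircle.

Definition hol f z (r : R) : Prop :=
  forall u, normc (u - z) < r -> exists l, cderiv f u l.

Lemma hol_le f z (r s : R) : s <= r -> hol f z r -> hol f z s.
Proof. by move=> sr H u us; apply: H; exact: lt_le_trans us sr. Qed.

Lemma holomorphic_atP f z : holomorphic_at f z <-> exists2 r : R, 0 < r & hol f z r.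
Proof.
split.
  move=> /nbhs_normcP[r r0 H]; exists r => // u /H /cderivP.
  by [].
move=> [r r0 H]; apply/nbhs_normcP; exists r => // u /H ?; exact/cderivP.
Qed.

Lemma hol_ball f z u (r s : R) : hol f z r -> normc (u - z) + s <= r -> hol f u s.
Proof.
move=> H us v vs; apply: H; have := normc_dist_tri u v z; lra.
Qed.

Lemma hol_ext f F z (r : R) : (forall u, normc (u - z) < r -> f u = F u) ->
  hol f z r -> hol F z r.
Proof.
move=> E H u ur; have [l fl] := H u ur; exists l; apply: cderiv_near fl.
by apply: filterS (near_ball ur) => v /E.
Qed.

(** The derivative is a Cauchy-type integral with squared kernel, hence differentiable again. The
    radius is halved because Cauchy's formula needs a closed disc. *)
Lemma hol_cderiv f z (r : R) : 0 < r -> hol f z r ->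
  exists2 f', hol f' z (r / 2) & forall u, normc (u - z) < r / 2 -> cderiv f u (f' u).
Proof.
move=> r0 fH; have r2 : 0 < r / 2 by rewrite divr_gt0.
pose P u := f u * (u - z).
have Pc u : normc (u - z) = r / 2 -> P v @[v --> u] --> P u.
  move=> ur; have [|l fl] := fH u; first by rewrite ur; lra.
  exact: (ccvgM (cderiv_cont fl) (ccvgB (ccvg_id _) (ccvg_cst _ _))).
pose f' v := Int (fun t => P (circ z (r / 2) t) / (circ z (r / 2) t - v) ^+ 2).
exists f' => [u ur|u ur]; first exact: (cauchy_type_cderiv2 r2 Pc ur).
have := cauchy_type_cderiv r2 Pc ur; apply: cderiv_near.
apply: filterS (near_ball ur) => v vr; apply/esym/cauchy_formula => // w wr; apply: fH; lra.
Qed.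

(** [dq n] is the n-th iterated difference quotient of f at z, so [dq n z] is the n-th Taylor
    coefficient. It is realized as the Cauchy integral of f u / (u - z)^n, which gives holomorphy
    and Cauchy's estimates without power series. *)
Lemma hol_quotients f z (r : R) : 0 < r -> hol f z r -> exists (dq : nat -> C -> C) (M : R),
  [/\ forall u, normc (u - z) < r / 2 -> dq 0%N u = f u,
      forall n, hol (dq n) z (r / 2),
      forall n u, normc (u - z) < r / 2 -> dq n u = dq n z + (u - z) * dq n.+1 u &
      forall n u, normc (u - z) < r / 4 -> normc (dq n u) <= M / (r / 2) ^+ n].
Proof.
move=> r0 fH; have s0 : 0 < r / 2 by rewrite divr_gt0.
set s := r / 2 in s0 *.
pose P n u := f u * (u - z) / (u - z) ^+ n.
have uz u : normc (u - z) = s -> u - z != 0 by move=> us; rewrite -normc_gt0 us.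
have Pc n u : normc (u - z) = s -> P n v @[v --> u] --> P n u.
  move=> us; have [|l fl] := fH u; first by rewrite us /s; lra.
  apply: ccvgM; first exact: (ccvgM (cderiv_cont fl) (ccvgB (ccvg_id _) (ccvg_cst _ _))).
  apply: ccvgV; first by rewrite expf_neq0// uz.
  by apply: ccvgX; exact: (ccvgB (ccvg_id _) (ccvg_cst _ _)).
have s0' := ltW s0.
have [M0 M00 HM0] : exists2 M : R, 0 < M & forall t, 0 <= t <= 1 ->
    normc (P 0%N (circ z s t)) <= M.
  by apply: cont01_bounded; exact: (cont01_circ_comp s0' (@Pc 0%N)).
pose dq n v := Int (fun t => P n (circ z s t) / (circ z s t - v)).
have cK n v : normc (v - z) < s -> forall u, normc (u - z) = s ->
    P n w / (w - v) @[w --> u] --> P n u / (u - v).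
  move=> vs u us; apply: ccvgM; first exact: Pc.
  apply: (ccvgV _ (ccvgB (ccvg_id _) (ccvg_cst _ _))).
  by rewrite subr_eq0; apply: contraTneq vs => <-; rewrite us ltxx.
(* (r / 4)^-1 bounds 1 / |w - u| for w on the circle of radius r / 2 and u within r / 4 of z. *)
exists dq, (M0 * (r / 4)^-1); split.
- move=> u us; rewrite /dq; apply/esym.
  rewrite (@cauchy_formula _ f z u s us); last by move=> w ws; apply: fH; rewrite /s in ws; lra.
  congr Int; apply/funext => t; by rewrite /P expr0 divr1.
- by move=> n u us; eexists; exact: (cauchy_type_cderiv s0 (@Pc n) us).
- move=> n u us; have zs : normc (z - z) < s by rewrite subrr normc_zero.
  rewrite addrC; apply/eqP; rewrite -subr_eq; apply/eqP.
  have cz := cont01_circ_comp s0' (cK n z zs).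
  have cu := cont01_circ_comp s0' (cK n u us).
  have cu1 := cont01_circ_comp s0' (cK n.+1 u us).
  rewrite /dq -IntB//; apply: IntE.
  apply: dint_ext (dintZ (u - z) (IntP cu1)) => t _ /=.
  have cn := circ_norm z t s0'; have c0 := uz _ cn.
  have cu0 : circ z s t - u != 0.
    by rewrite subr_eq0; apply: contraTneq us => <-; rewrite cn ltxx.
  by rewrite /P exprS; field; rewrite cu0 c0 expf_neq0.
- move=> n u us.
  have us' : normc (u - z) < s by rewrite /s; lra.
  apply: dint_le (IntP (cont01_circ_comp s0' (cK n u us'))) => t ht.
  have cn := circ_norm z t s0'.
  have lo : r / 4 <= normc (circ z s t - u).
    have := normc_dist_tri u (circ z s t) z; rewrite cn /s; lra.
  have r4 : 0 < r / 4 by rewrite divr_gt0.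
  rewrite !normc_div normc_exp cn -[X in X <= _]mulrAC ler_wpM2r ?invr_ge0 ?exprn_ge0//.
  have := HM0 t ht; rewrite /P expr0 divr1 => A; apply: ler_pM => //; rewrite ?normc_ge0 ?invr_ge0 ?normc_ge0//.
  by rewrite lef_pV2// posrE// (lt_le_trans r4).
Qed.

End CauchyType.

(** * Local theory of holomorphic functions *)

Section HolomorphicLocal.
Variable R : realType.
Local Notation C := (CC R).
Implicit Types (f g : C -> C) (z w u v : C).

(** m is the index of the first nonzero Taylor coefficient. If they all vanish, f u = (u - z)^n
    [dq n u] for every n, which is at most M 2 ^- n in modulus when |u - z| < r / 4. *)
Lemma hol_factor f z (r : R) : 0 < r -> hol f z r ->
  (exists2 s : R, 0 < s & forall u, normc (u - z) < s -> f u = 0) \/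
  (exists (m : nat) (g : C -> C) (s : R), [/\ 0 < s, hol g z s, g z != 0 &
     forall u, normc (u - z) < s -> f u = (u - z) ^+ m * g u]).
Proof.
move=> r0 fH; have [dq [M [dq0 dqH dqS dqM]]] := hol_quotients r0 fH.
have r2 : 0 < r / 2 by rewrite divr_gt0.
have E n u : (forall k, (k < n)%N -> dq k z = 0) -> normc (u - z) < r / 2 ->
    f u = (u - z) ^+ n * dq n u.
  elim: n => [|n IH] H ur; first by rewrite expr0 mul1r dq0.
  rewrite IH//; last by move=> k kn; apply: H; exact: ltnW.
  by rewrite dqS// H// add0r mulrA -exprSr.
have [[n n0]|H] := pselect (exists n, dq n z != 0).
  right; have ex : exists n, dq n z != 0 by exists n.
  case: (ex_minnP ex) => m m0 mmin; exists m, (dq m), (r / 2); split => //.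
  move=> u ur; apply: E => // k km; apply/eqP; apply: contraTT km => /mmin.
  by rewrite -leqNgt.
left; exists (r / 4); first by rewrite divr_gt0.
move=> u ur; have Z n : dq n z = 0.
  by apply/eqP; apply: contrapT => /negP n0; apply: H; exists n.
have ur2 : normc (u - z) < r / 2 by lra.
apply/eqP; rewrite -normc_eq0 eq_le normc_ge0 andbT; apply/ler_addgt0Pl => e e0.
rewrite addr0.
have M0 : 0 <= M by have := dqM 0%N u ur; rewrite expr0 divr1; exact: le_trans (normc_ge0 _).
have M1 : 0 < M + 1 by rewrite ltr_wpDl.
have [N /(_ N (leqnn _)) HN] := exp2V_lt (divr_gt0 e0 M1).
rewrite (E N u)// normc_mul normc_exp.
have A : normc (u - z) ^+ N <= (r / 4) ^+ N by rewrite lerXn2r ?nnegrE ?normc_ge0// ltW// divr_gt0.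
have p0 : 0 <= normc (u - z) ^+ N by rewrite exprn_ge0 ?normc_ge0.
apply: le_trans (ler_pM p0 (normc_ge0 _) A (dqM N u ur)) _.
have -> : (r / 4) ^+ N * (M / (r / 2) ^+ N) = M * 2 ^- N.
  rewrite mulrCA; congr (M * _); rewrite -expr_div_n -exprVn; congr (_ ^+ N).
  by field; rewrite gt_eqF.
rewrite ltr_pdivlMr// in HN; apply: le_trans (ltW HN); rewrite mulrC.
by rewrite ler_wpM2l ?lerDl// invr_ge0 exprn_ge0.
Qed.

Lemma hol_cont f z (r : R) u : hol f z r -> normc (u - z) < r -> f v @[v --> u] --> f u.
Proof. by move=> fH /fH[l]; exact: cderiv_cont. Qed.

(* Riemann's trick: (u - z) f u is holomorphic, and f is its difference
   quotient. *)
Lemma hol_removable f z (r : R) : 0 < r ->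
  (forall u, normc (u - z) < r -> u != z -> exists l, cderiv f u l) ->
  f v @[v --> z] --> f z -> hol f z r.
Proof.
move=> r0 fD fc.
pose k u := (u - z) * f u.
have kH : hol k z r.
  move=> u ur; have [->|uz] := eqVneq u z.
    exists (f z); exists f; first exact: fc.
    by apply: filterE => w; rewrite /k subrr mul0r subr0 mulrC.
  have [l fl] := fD u ur uz; eexists; exact: (cderivM (cderiv_subC z u) fl).
have [dq [M [dq0 dqH dqS _]]] := hol_quotients r0 kH.
have r2 : 0 < r / 2 by rewrite divr_gt0.
have zr : normc (z - z) < r / 2 by rewrite subrr normc_zero.
have E u : normc (u - z) < r / 2 -> u != z -> f u = dq 1%N u.
  move=> ur uz; have := dqS 0%N u ur; rewrite !dq0// /k subrr mul0r add0r.
  by apply: mulfI; rewrite subr_eq0.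
have Ez : f z = dq 1%N z.
  have dc := hol_cont (dqH 1%N) zr.
  apply/eqP; rewrite -subr_eq0 -normc_eq0 eq_le normc_ge0 andbT.
  apply/ler_addgt0Pl => e e0; rewrite addr0; have e2 : 0 < e / 2 by rewrite divr_gt0.
  have /ccvgP/(_ _ e2)/nbhs_normcP[d1 d10 H1] := fc.
  have /ccvgP/(_ _ e2)/nbhs_normcP[d2 d20 H2] := dc.
  pose d := Num.min (r / 2) (Num.min d1 d2) / 2.
  have d0 : 0 < d by rewrite divr_gt0// !lt_min r2 d10.
  pose u := z + d%:C; have uz : normc (u - z) = d.
    by rewrite /u addrC addKr normc_real gtr0_norm.
  have : d < Num.min (r / 2) (Num.min d1 d2) by rewrite ltr_pdivrMr// ltr_pMr ?ltr1n// !lt_min r2 d10.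
  rewrite !lt_min => /and3P[dr dd1 dd2].
  have uz' : u != z by rewrite -subr_eq0 -normc_gt0 uz.
  have := H1 u; have := H2 u; rewrite uz => /(_ dd2) A /(_ dd1) B.
  rewrite -E ?uz// in A.
  by have := normc_dist_tri (f u) (f z) (dq 1%N z); rewrite (normc_distC (f z) (f u)); lra.
move=> u ur; have [->|uz] := eqVneq u z; last exact: fD.
have [l dl] := dqH 1%N z zr; exists l; apply: cderiv_near dl.
apply/nbhs_normcP; exists (r / 2) => // w wr; have [->//|wz] := eqVneq w z.
by rewrite E.
Qed.

(** Weierstrass' theorem: Cauchy's formula survives the uniform limit, which is therefore a
    Cauchy-type integral of a continuous function. *)
Lemma hol_limit (F : nat -> C -> C) f z (r : R) : 0 < r ->
  (forall n, hol (F n) z r) ->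
  (forall e : R, 0 < e -> exists n, forall u, normc (u - z) < r -> normc (F n u - f u) <= e) ->
  hol f z (r / 2).
Proof.
move=> r0 FH Ff; have s0 : 0 < r / 2 by rewrite divr_gt0.
set s := r / 2 in s0 *; have sr : s < r by rewrite /s; lra.
have fc u : normc (u - z) < r -> f v @[v --> u] --> f u.
  move=> ur; apply/ccvgP => e e0; have e4 : 0 < e / 4 by rewrite divr_gt0.
  have [n Hn] := Ff _ e4; have /ccvgP/(_ _ e4)/nbhs_normcP[d d0 Hd] := hol_cont (FH n) ur.
  apply/nbhs_normcP; exists (Num.min d (r - normc (u - z))); first by rewrite lt_min d0 subr_gt0.
  move=> v; rewrite lt_min => /andP[vd vr].
  have vz : normc (v - z) < r by have := normc_dist_tri u v z; lra.
  have := Hn _ vz; have := Hn _ ur; have := Hd _ vd.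
  have := normc_dist_tri (F n v) (f v) (f u); have := normc_dist_tri (F n u) (F n v) (f u).
  by rewrite (normc_distC (f v) (F n v)); lra.
pose P (g : C -> C) u := g u * (u - z).
have Pc g : (forall u, normc (u - z) < r -> g v @[v --> u] --> g u) ->
    forall u, normc (u - z) = s -> P g v @[v --> u] --> P g u.
  move=> gc u us; apply: ccvgM; first by apply: gc; rewrite us.
  exact: (ccvgB (ccvg_id _) (ccvg_cst _ _)).
suff E w : normc (w - z) < s -> f w = Int (fun t => P f (circ z s t) / (circ z s t - w)).
  have := fun w => cauchy_type_cderiv s0 (Pc f fc) (w := w).
  move=> H u us; eexists; apply: cderiv_near (H u us).
  by apply: filterS (near_ball us) => v /E.
move=> ws.
apply/eqP; rewrite -subr_eq0 -normc_eq0 eq_le normc_ge0 andbT.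
apply/ler_addgt0Pl => e e0; rewrite addr0.
pose d := s - normc (w - z); have d0 : 0 < d by rewrite subr_gt0.
(* B bounds |u - z| / |u - w| for u on the circle of radius s. *)
pose B := s / d; have B0 : 0 < B by rewrite divr_gt0.
have e' : 0 < e / (1 + B) by rewrite divr_gt0// addr_gt0.
have [n Hn] := Ff _ e'.
have FC u : normc (u - z) < r -> F n v @[v --> u] --> F n u by exact: hol_cont.
have A : F n w = Int (fun t => P (F n) (circ z s t) / (circ z s t - w)).
  by apply: cauchy_formula => // u us; apply: FH; exact: le_lt_trans us sr.
have K1 := IntP (cont01_kernel s0 (Pc _ FC) 1 ws).
have K2 := IntP (cont01_kernel s0 (Pc _ fc) 1 ws).
have D : normc (F n w - Int (fun t => P f (circ z s t) / (circ z s t - w))) <= e / (1 + B) * B.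
  rewrite A; apply: dint_le (dintB K1 K2) => t ht.
  have cn := circ_norm z t (ltW s0).
  rewrite expr1 /P -mulrBl -mulrBl -mulrA normc_mul.
  apply: ler_pM; rewrite ?normc_ge0//; first by apply: Hn; rewrite cn.
  rewrite normc_div cn ler_pM2l// lef_pV2 ?posrE//.
    by have := normc_dist_tri w (circ z s t) z; rewrite cn /d; lra.
  by have := normc_dist_tri w (circ z s t) z; rewrite cn; rewrite /d in d0; lra.
have X := normc_dist_tri (F n w) (f w) (Int (fun t => P f (circ z s t) / (circ z s t - w))).
have -> : e = e / (1 + B) + e / (1 + B) * B by field; rewrite gt_eqF// addr_gt0.
apply: le_trans X _; apply: lerD => //; rewrite normc_distC; apply: Hn.
exact: lt_trans sr.
Qed.

End HolomorphicLocal.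

(** * The singular metric *)

Section Root30.
Variable R : realType.
Implicit Types (x y : R).

(** In the unit [rt], every exponent of the metric and every order of vanishing becomes an
    integer. *)
Definition rt x : R := `|x| `^ 30%:R^-1.

Lemma rt_ge0 x : 0 <= rt x. Proof. exact: powR_ge0. Qed.

Lemma rt0 : rt 0 = 0.
Proof. by rewrite /rt normr0 powR0// invr_eq0 pnatr_eq0. Qed.

Lemma rt_gt0 x : (0 < rt x) = (x != 0).
Proof.
have [->|x0] := eqVneq x 0; first by rewrite rt0 ltxx.
by rewrite /rt powR_gt0// normr_gt0.
Qed.

Lemma rtM x y : rt (x * y) = rt x * rt y.
Proof. by rewrite /rt normrM powRM. Qed.

Lemma rtX x n : rt (x ^+ n) = rt x ^+ n.
Proof.
elim: n => [|n IH]; first by rewrite !expr0 /rt normr1 powR1.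
by rewrite !exprS rtM IH.
Qed.

Lemma rtV x : rt x^-1 = (rt x)^-1.
Proof.
have [->|x0] := eqVneq x 0; first by rewrite invr0 rt0 invr0.
have rx : rt x != 0 by rewrite gt_eqF// rt_gt0.
by apply: (mulfI rx); rewrite -rtM !divff// /rt normr1 powR1.
Qed.

Lemma rtK x : 0 <= x -> rt x ^+ 30 = x.
Proof.
move=> x0; rewrite /rt -powR_mulrn ?powR_ge0// -powRrM mulVf ?pnatr_eq0//.
by rewrite powRr1// ger0_norm.
Qed.

Lemma rt_exp x : 0 < x -> rt x = expR (ln x / 30).
Proof. by move=> x0; rewrite /rt gtr0_norm// /powR gt_eqF// mulrC. Qed.

Lemma ler_rt x y : 0 <= x -> x <= y -> rt x <= rt y.
Proof.
move=> x0 xy; rewrite -(@ler_pXn2r _ 30) ?nnegrE ?rt_ge0// !rtK//.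
exact: le_trans xy.
Qed.

Lemma rt_exprK x : 0 <= x -> rt (x ^+ 30) = x.
Proof.
move=> x0; apply: (@pexpIrn _ 30) => //; rewrite ?nnegrE ?rt_ge0//.
by rewrite rtK// exprn_ge0.
Qed.

Lemma rt_cont : continuous rt.
Proof.
move=> x; have [->|x0] := eqVneq x 0.
  apply/cvgrPdist_lt => e e0; rewrite rt0.
  apply/nbhs_ballP; exists (e ^+ 30) => /=; first by rewrite exprn_gt0.
  move=> y; rewrite /ball_/= !sub0r !normrN => ye.
  rewrite ger0_norm ?rt_ge0// -(@ltr_pXn2r _ 30) ?nnegrE ?rt_ge0//; last exact: ltW.
  have -> : rt y = rt `|y| by rewrite /rt normr_id.
  by rewrite rtK.
have cE : (fun y : R => expR (30%:R^-1 * ln `|y|)) y @[y --> x] --> rt x.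
  have -> : rt x = expR (30%:R^-1 * ln `|x|) by rewrite /rt /powR normr_eq0 (negbTE x0).
  apply: (@continuous_comp _ _ _ (fun y : R => 30%:R^-1 * ln `|y|) expR); last exact: continuous_expR.
  apply: (@continuous_comp _ _ _ (fun y : R => ln `|y|) (fun y => 30%:R^-1 * y)); last exact: mulrl_continuous.
  apply: (@continuous_comp _ _ _ (fun y : R => `|y|) (@ln R)); first exact: norm_continuous.
  by apply: continuous_ln; rewrite normr_gt0.
apply: cvg_trans cE; apply: near_eq_cvg.
apply/nbhs_ballP; exists `|x| => /=; first by rewrite normr_gt0.
move=> y yx; have y0 : y != 0.
  by apply: contraTneq yx => ->; rewrite /ball /ball_/= subr0 ltxx.
by rewrite /rt /powR normr_eq0 (negbTE y0).
Qed.

End Root30.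

(** * The curvature inequality and the comparison with the spherical metric *)

Section Curvature.
Variable R : realType.
Implicit Types (A B X Y : R).

Lemma le_expn_half (k n : nat) (X : R) : (k <= n)%N -> 2^-1 <= X -> X ^+ k * 2 ^- (n - k) <= X ^+ n.
Proof.
move=> kn X2; have X0 : 0 <= X by apply: le_trans X2; rewrite invr_ge0.
rewrite -[in leRHS](subnKC kn) exprD ler_wpM2l ?exprn_ge0//.
by rewrite -exprVn lerXn2r// nnegrE invr_ge0.
Qed.

(** This is [curvature_ineq] multiplied by X^59 Y^59, with k = 59 - 2 p. If X or Y is at least 2,
    each is at most twice the other and only degrees matter: k + 5 <= 57. Otherwise both are below
    2, one of them is at least 1/2 because A + B >= 1, and its 59-th power dominates. *)
Lemma curvature_poly (k : nat) A B X Y : (k <= 52)%N -> 0 < X -> 0 < Y ->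
  X ^+ 30 = A -> Y ^+ 30 = B -> A <= B + 1 -> B <= A + 1 -> 1 <= A + B ->
  2 ^- 72 * ((1 + X) * (1 + Y) * (X ^+ k * Y ^+ 3)) <=
  Y ^+ 59 / (1 + X) ^+ 2 + X ^+ 59 / (1 + Y) ^+ 2.
Proof.
move=> k52 X0 Y0 XA YB AB BA AB1.
have X0' := ltW X0; have Y0' := ltW Y0.
have h30 : (2^-1 : R) ^+ 30 <= 2^-1.
  by rewrite -[leRHS]expr1 ler_wiXn2l// ?invr_ge0// invf_le1// ler1n.
have two30 : (2 : R) <= 2 ^+ 30 by rewrite -[leLHS]expr1 ler_weXn2l// ler1n.
have half_le (S T : R) : 0 <= S -> 0 <= T -> 2 <= S -> S ^+ 30 <= T ^+ 30 + 1 -> S / 2 <= T.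
  move=> S0 T0 S2 ST; rewrite -(@ler_pXn2r _ 30) ?nnegrE ?divr_ge0// expr_div_n.
  have : 2 <= S ^+ 30 by apply: le_trans two30 _; rewrite lerXn2r// nnegrE.
  move=> S30; have S30' : 0 <= S ^+ 30 by lra.
  have : S ^+ 30 / 2 ^+ 30 <= S ^+ 30 / 2 by rewrite ler_wpM2l// lef_pV2 ?posrE ?exprn_gt0//.
  lra.
have dbl_le (S T : R) : 0 <= S -> 0 <= T -> 1 <= S -> T ^+ 30 <= S ^+ 30 + 1 -> T <= 2 * S.
  move=> S0 T0 S1 ST; rewrite -(@ler_pXn2r _ 30) ?nnegrE ?mulr_ge0// exprMn.
  have : 1 <= S ^+ 30 by rewrite exprn_ege1.
  move=> S30; have : 2 * S ^+ 30 <= 2 ^+ 30 * S ^+ 30 by rewrite ler_wpM2r// (le_trans ler01).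
  lra.
have c0 : 0 < (2 : R) ^- 72 by rewrite invr_gt0 exprn_gt0.
have pX (a : nat) : 0 <= X ^+ a by rewrite exprn_ge0.
have pY (a : nat) : 0 <= Y ^+ a by rewrite exprn_ge0.
have q1 : 0 <= Y ^+ 59 / (1 + X) ^+ 2 by rewrite divr_ge0// exprn_ge0// addr_ge0.
have q2 : 0 <= X ^+ 59 / (1 + Y) ^+ 2 by rewrite divr_ge0// exprn_ge0// addr_ge0.
have [big|] := boolP ((2 <= X) || (2 <= Y)).
  have [X1 XY YX] : [/\ 1 <= X, X <= 2 * Y & Y <= 2 * X].
    have [X2|X2] := lerP 2 X.
      have Y2 : X / 2 <= Y by apply: half_le => //; rewrite XA YB.
      split; [lra|lra|apply: dbl_le => //; [lra|by rewrite XA YB]].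
    have Y2 : 2 <= Y by move: big; rewrite leNgt X2.
    have XY : Y / 2 <= X by apply: half_le => //; rewrite XA YB.
    by split; [lra|apply: dbl_le => //; [lra|rewrite XA YB]|lra].
  apply: (@le_trans _ _ (X ^+ 57 / 9)); last first.
    apply: (@le_trans _ _ (X ^+ 59 / (1 + Y) ^+ 2)); last by rewrite lerDr.
    have -> : X ^+ 57 / 9 = X ^+ 59 / (3 * X) ^+ 2 by field; rewrite gt_eqF.
    rewrite ler_wpM2l// lef_pV2 ?posrE ?exprn_gt0 ?addr_gt0 ?mulr_gt0//.
    by rewrite lerXn2r// ?nnegrE; lra.
  have h1 : (1 + X) * (1 + Y) <= (2 * X) * (3 * X) by apply: ler_pM; lra.
  have h2 : X ^+ k * Y ^+ 3 <= X ^+ k * (2 * X) ^+ 3.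
    by rewrite ler_wpM2l// lerXn2r// nnegrE; lra.
  have h3 : (1 + X) * (1 + Y) * (X ^+ k * Y ^+ 3) <= (2 * X) * (3 * X) * (X ^+ k * (2 * X) ^+ 3).
    by apply: ler_pM => //; rewrite mulr_ge0//; lra.
  have -> : X ^+ 57 / 9 = 9^-1 * X ^+ 57 by rewrite mulrC.
  have h4 : (2 * X) * (3 * X) * (X ^+ k * (2 * X) ^+ 3) <= 48 * X ^+ 57.
    have -> : 2 * X * (3 * X) * (X ^+ k * (2 * X) ^+ 3) = 48 * X ^+ (k + 5).
      by rewrite exprD; ring.
    by rewrite ler_wpM2l// ler_weXn2l// (leq_add k52 (leqnn 5)).
  apply: (@le_trans _ _ (2 ^- 72 * (48 * X ^+ 57))).
    by rewrite ler_wpM2l ?(ltW c0)//; exact: le_trans h3 h4.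
  rewrite mulrA ler_wpM2r//.
  have c9 : (2 : R) ^- 72 <= 2 ^- 9 by rewrite lef_pV2 ?posrE ?exprn_gt0// ler_weXn2l// ler1n.
  have : (2 : R) ^- 9 = 512^-1 by congr (_^-1); ring.
  by lra.
rewrite negb_or -!ltNge => /andP[X2 Y2].
have s1 : (X ^+ 59 + Y ^+ 59) / 9 <= Y ^+ 59 / (1 + X) ^+ 2 + X ^+ 59 / (1 + Y) ^+ 2.
  have t1 : 9^-1 <= ((1 + X) ^+ 2)^-1.
    rewrite lef_pV2 ?posrE ?exprn_gt0 ?addr_gt0//.
    have -> : (9 : R) = 3 ^+ 2 by ring.
    by rewrite lerXn2r ?nnegrE//; lra.
  have t2 : 9^-1 <= ((1 + Y) ^+ 2)^-1.
    rewrite lef_pV2 ?posrE ?exprn_gt0 ?addr_gt0//.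
    have -> : (9 : R) = 3 ^+ 2 by ring.
    by rewrite lerXn2r ?nnegrE//; lra.
  by rewrite mulrDl addrC; apply: lerD; rewrite ler_wpM2l.
apply: le_trans s1.
have h1 : (1 + X) * (1 + Y) * (X ^+ k * Y ^+ 3) <= 9 * (X ^+ k * Y ^+ 3).
  rewrite ler_wpM2r ?mulr_ge0//.
  have -> : (9 : R) = 3 * 3 by ring.
  by apply: ler_pM; lra.
apply: (@le_trans _ _ (2 ^- 72 * (9 * (X ^+ k * Y ^+ 3)))); first by rewrite ler_wpM2l// ltW.
have [Xh|Xh] := lerP 2^-1 X.
  have h2 := le_expn_half (leq_trans k52 (isT : (52 <= 59)%N)) Xh.
  have h3 : (2 : R) ^- 59 <= 2 ^- (59 - k).
    by rewrite lef_pV2 ?posrE ?exprn_gt0// ler_weXn2l ?ler1n// leq_subr.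
  have h4 : X ^+ k * 2 ^- 59 <= X ^+ 59 by apply: le_trans h2; rewrite ler_wpM2l.
  have h5 : Y ^+ 3 <= 8.
    have -> : (8 : R) = 2 ^+ 3 by ring.
    by rewrite lerXn2r ?nnegrE//; lra.
  apply: (@le_trans _ _ (X ^+ k * 2 ^- 59 * (2 ^- 13 * 72))).
    have -> : X ^+ k * 2 ^- 59 * (2 ^- 13 * 72) = 2 ^- 72 * (9 * (X ^+ k * 8)).
      by rewrite (_ : 72%N = (59 + 13)%N)// exprD invfM; field.
    by rewrite ler_wpM2l ?(ltW c0)// ler_wpM2l// ler_wpM2l.
  apply: (@le_trans _ _ (X ^+ 59 / 9)); last by rewrite ler_wpM2r// lerDl.
  apply: ler_pM; [| |exact: h4|].
  - by rewrite mulr_ge0// invr_ge0 exprn_ge0.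
  - by rewrite mulr_ge0// invr_ge0 exprn_ge0.
  have c9 : (2 : R) ^- 13 <= 2 ^- 10 by rewrite lef_pV2 ?posrE ?exprn_gt0// ler_weXn2l// ler1n.
  have : (2 : R) ^- 10 = 1024^-1 by congr (_^-1); ring.
  by lra.
(* X < 1/2 forces A <= 1/2, hence B >= 1/2 and Y >= 1/2. *)
have A2 : A <= 2^-1.
  rewrite -XA; apply: le_trans h30; rewrite lerXn2r ?nnegrE ?invr_ge0//; exact: ltW.
have Yh : 2^-1 <= Y.
  rewrite -(@ler_pXn2r _ 30) ?nnegrE ?invr_ge0// YB; apply: le_trans h30 _; lra.
have h2 := le_expn_half (isT : (3 <= 59)%N) Yh.
have Xk : X ^+ k <= 1 by rewrite exprn_ile1//; lra.
apply: (@le_trans _ _ (Y ^+ 3 * 2 ^- (59 - 3) * 9^-1)); last first.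
  by rewrite ler_wpM2r//; apply: le_trans h2 _; rewrite lerDr.
apply: (@le_trans _ _ (2 ^- 72 * (9 * (1 * Y ^+ 3)))).
  by rewrite ler_wpM2l ?(ltW c0)// ler_wpM2l// ler_wpM2r.
have -> : Y ^+ 3 * 2 ^- (59 - 3) * 9^-1 = (2 ^- 56 * 9^-1) * Y ^+ 3 by rewrite mulrAC mulrC; ring.
have -> : 2 ^- 72 * (9 * (1 * Y ^+ 3)) = (2 ^- 56 * (2 ^- 16 * 9)) * Y ^+ 3.
  by rewrite (_ : 72%N = (56 + 16)%N)// exprD invfM; ring.
rewrite ler_wpM2r// ler_wpM2l ?invr_ge0 ?exprn_ge0//.
have c9 : (2 : R) ^- 16 <= 2 ^- 9 by rewrite lef_pV2 ?posrE ?exprn_gt0// ler_weXn2l// ler1n.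
have : (2 : R) ^- 9 = 512^-1 by congr (_^-1); ring.
by lra.
Qed.

(* With A = |w|, B = |w - 1|, X = A ^ (1/30), Y = B ^ (1/30): the metric
   sqrt ((1 + X) (1 + Y)) / (X ^ p Y ^ 28) |dw| has curvature bounded above by
   a negative constant, since the right-hand side is 1800 times the Laplacian
   of the logarithm of this density. *)
Lemma curvature_ineq (p : nat) A B X Y : (4 <= p <= 29)%N -> 0 < X -> 0 < Y ->
  X ^+ 30 = A -> Y ^+ 30 = B -> A <= B + 1 -> B <= A + 1 -> 1 <= A + B ->
  2 ^- 72 * ((1 + X) * (1 + Y) / (X ^+ (2 * p) * Y ^+ 56)) <=
  X / (1 + X) ^+ 2 / A ^+ 2 + Y / (1 + Y) ^+ 2 / B ^+ 2.
Proof.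
move=> /andP[p4 p29] X0 Y0 XA YB AB BA AB1.
have kp : (59 - 2 * p <= 52)%N by lia.
have H := curvature_poly kp X0 Y0 XA YB AB BA AB1.
have Xn (a : nat) : X ^+ a != 0 by rewrite expf_neq0// gt_eqF.
have Yn (a : nat) : Y ^+ a != 0 by rewrite expf_neq0// gt_eqF.
have d0 : 0 < (X ^+ 59 * Y ^+ 59)^-1 by rewrite invr_gt0 mulr_gt0// exprn_gt0.
have := ler_wpM2r (ltW d0) H.
have -> : 2 ^- 72 * ((1 + X) * (1 + Y) * (X ^+ (59 - 2 * p) * Y ^+ 3)) / (X ^+ 59 * Y ^+ 59) =
    2 ^- 72 * ((1 + X) * (1 + Y) / (X ^+ (2 * p) * Y ^+ 56)).
  have E1 : X ^+ 59 = X ^+ (2 * p) * X ^+ (59 - 2 * p) by rewrite -exprD subnKC//; lia.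
  have E2 : Y ^+ 59 = Y ^+ 56 * Y ^+ 3 by rewrite -exprD.
  have a := Xn (2 * p)%N; have b := Xn (59 - 2 * p)%N.
  have c := Yn 56%N; have d := Yn 3%N.
  rewrite E1 E2; move: (X ^+ (2 * p)) (X ^+ (59 - 2 * p)) (Y ^+ 56) (Y ^+ 3) a b c d.
  move=> a b c d a0 b0 c0 d0'; rewrite -!mulrA; congr (_ * (_ * (_ * _))).
  by field; rewrite ?a0 ?b0 ?c0 ?d0'.
have X1 : 1 + X != 0 by rewrite gt_eqF// addr_gt0.
have Y1 : 1 + Y != 0 by rewrite gt_eqF// addr_gt0.
have a := Xn 59%N; have b := Yn 59%N.
have EA : X / A ^+ 2 = (X ^+ 59)^-1.
  by rewrite -XA -exprM; apply: (mulIf (Xn 60%N)); rewrite mulfVK// -[60%N]/(59.+1) exprS mulrC mulfK.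
have EB : Y / B ^+ 2 = (Y ^+ 59)^-1.
  by rewrite -YB -exprM; apply: (mulIf (Yn 60%N)); rewrite mulfVK// -[60%N]/(59.+1) exprS mulrC mulfK.
rewrite [X / _ / A ^+ 2]mulrAC EA [Y / _ / B ^+ 2]mulrAC EB.
move: (X ^+ 59) (Y ^+ 59) a b => a b a0 b0.
suff -> : (b / (1 + X) ^+ 2 + a / (1 + Y) ^+ 2) / (a * b) = a^-1 / (1 + X) ^+ 2 + b^-1 / (1 + Y) ^+ 2 by [].
by field; rewrite ?a0 ?b0 ?X1 ?Y1.
Qed.

(** An upper bound for the denominator of [dens], hence a lower bound for the metric: it dominates
    the spherical metric |dw| / (1 + |w|^2) up to the factor 1 / sqrt 2. The exponents 2 p and 56
    are at most 60, so each power is at most the larger of 1 and A^2, respectively B^2. *)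
Lemma density_lower (p : nat) A B X Y : (p <= 30)%N -> 0 <= X -> 0 <= Y ->
  X ^+ 30 = A -> Y ^+ 30 = B -> B <= A + 1 ->
  X ^+ (2 * p) * Y ^+ 56 <= 2 * (1 + A ^+ 2) ^+ 2.
Proof.
move=> p30 X0 Y0 XA YB BA.
have A0 : 0 <= A by rewrite -XA exprn_ge0.
have B0 : 0 <= B by rewrite -YB exprn_ge0.
have pw (S T W : R) (a : nat) : 0 <= S -> S ^+ 30 = T -> (a <= 60)%N -> 1 <= W -> T ^+ 2 <= W ->
    S ^+ a <= W.
  move=> S0 ST a60 W1 TW; have [S1|S1] := lerP S 1.
    by apply: le_trans W1; rewrite exprn_ile1.
  apply: le_trans TW; rewrite -ST -exprM ler_weXn2l//; exact: ltW.
have h1 : X ^+ (2 * p) <= 1 + A ^+ 2.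
  apply: (pw X A) => //; [lia|by rewrite lerDl sqr_ge0|by rewrite lerDr].
have h2 : Y ^+ 56 <= 2 * (1 + A ^+ 2).
  apply: (pw Y B) => //; first by have := sqr_ge0 A; lra.
  have : B ^+ 2 <= (A + 1) ^+ 2 by rewrite lerXn2r// nnegrE addr_ge0.
  have := sqr_ge0 (A - 1); rewrite !sqrrB !sqrrD; lra.
have -> : 2 * (1 + A ^+ 2) ^+ 2 = (1 + A ^+ 2) * (2 * (1 + A ^+ 2)) by ring.
by apply: ler_pM => //; rewrite exprn_ge0.
Qed.

End Curvature.

(** * Second derivatives along lines and the test at a maximum *)

Section SecondDerivativeTest.
Variable R : realType.
Local Notation C := (CC R).
Implicit Types (f g q : R -> R) (F : C -> C) (z e : C).

Lemma is_derive_of_small f (x l : R) :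
  (forall e : R, 0 < e -> exists2 d : R, 0 < d &
    forall h, `|h| < d -> `|f (x + h) - f x - l * h| <= e * `|h|) -> is_derive x 1 f l.
Proof.
move=> H; apply/is_derive1_caratheodory.
exists (fun y => if y == x then l else (f y - f x) / (y - x)); split.
- move=> y; case: eqVneq => [->|yx]; first by rewrite !subrr mulr0.
  by rewrite mulfVK// subr_eq0.
- apply/cvgrPdist_lt => e e0; rewrite eqxx; have e2 : 0 < e / 2 by rewrite divr_gt0.
  have [d d0 Hd] := H _ e2; apply/nbhs_ballP; exists d => //= y; rewrite /ball_/= => yd.
  case: eqVneq => [_|yx]; first by rewrite subrr normr0.
  have yx0 : y - x != 0 by rewrite subr_eq0.
  have := Hd (y - x); rewrite distrC subrKC => /(_ yd).
  have -> : f y - f x - l * (y - x) = - ((l - (f y - f x) / (y - x)) * (y - x)).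
    by rewrite mulrBl mulfVK// opprB.
  rewrite (distrC x y) normrN normrM ler_pM2r ?normr_gt0// => /le_lt_trans; apply.
  by rewrite ltr_pdivrMr// ltr_pMr// ltr1n.
- by rewrite eqxx.
Qed.

Lemma cderiv_line F z e (t : R) (l : C) : cderiv F (z + t%:C * e) l ->
  forall d : R, 0 < d -> exists2 s : R, 0 < s & forall h : R, `|h| < s ->
  normc (F (z + (t + h)%:C * e) - F (z + t%:C * e) - l * e * h%:C) <= d * `|h|.
Proof.
move=> /cderiv_small H d d0; have e1 : 0 < normc e + 1 by rewrite ltr_wpDl ?normc_ge0.
have /nbhs_normcP[s s0 Hs] := H _ (divr_gt0 d0 e1).
exists (s / (normc e + 1)); first by rewrite divr_gt0.
move=> h; rewrite ltr_pdivlMr// => hs.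
have E : z + (t + h)%:C * e - (z + t%:C * e) = h%:C * e by rewrite rmorphD; ring.
have := Hs (z + (t + h)%:C * e); rewrite E normc_mul normc_real.
have -> : l * (h%:C * e) = l * e * h%:C by ring.
move=> /(_ _) K; apply: le_trans (K _) _.
  by apply: le_lt_trans hs; rewrite ler_wpM2l// lerDl.
have -> : d / (normc e + 1) * (`|h| * normc e) = d * `|h| * (normc e / (normc e + 1)) by ring.
rewrite ler_piMr ?mulr_ge0 ?(ltW d0)//.
by rewrite ler_pdivrMr// mul1r lerDl.
Qed.

Lemma is_derive_Re F z e (t : R) (l : C) : cderiv F (z + t%:C * e) l ->
  is_derive t 1 (fun s : R => complex.Re (F (z + s%:C * e))) (complex.Re (l * e)).
Proof.
move=> H; apply: is_derive_of_small => d d0; have [s s0 Hs] := cderiv_line H d0.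
exists s => // h hs; apply: le_trans (Hs h hs); apply: le_trans (normc_geRe _).
case: (F _) => a b; case: (F _) => a' b'; case: (l * e) => x y /=.
by rewrite mulr0 subr0.
Qed.

Lemma is_derive_Im F z e (t : R) (l : C) : cderiv F (z + t%:C * e) l ->
  is_derive t 1 (fun s : R => complex.Im (F (z + s%:C * e))) (complex.Im (l * e)).
Proof.
move=> H; apply: is_derive_of_small => d d0; have [s s0 Hs] := cderiv_line H d0.
exists s => // h hs; apply: le_trans (Hs h hs); apply: le_trans (normc_geIm _).
case: (F _) => a b; case: (F _) => a' b'; case: (l * e) => x y /=.
by rewrite mulr0 add0r.
Qed.

Lemma is_derive_ln_normc F z e (t : R) (l : C) :
  cderiv F (z + t%:C * e) l -> F (z + t%:C * e) != 0 ->
  is_derive t 1 (fun s : R => ln (normc (F (z + s%:C * e))))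
    (complex.Re (l / F (z + t%:C * e) * e)).
Proof.
move=> H F0; have dR := is_derive_Re H; have dI := is_derive_Im H.
set a := fun s : R => complex.Re (F (z + s%:C * e)) in dR.
set b := fun s : R => complex.Im (F (z + s%:C * e)) in dI.
have ab : 0 < a t * a t + b t * b t.
  by have := normc_sqr (F (z + t%:C * e)); rewrite !expr2 => <-; rewrite mulr_gt0// normc_gt0.
have E : (fun s : R => ln (normc (F (z + s%:C * e)))) =
    fun s => 2^-1 * ln (a s * a s + b s * b s).
  apply/funext => s; have := normc_sqr (F (z + s%:C * e)).
  rewrite -/(a s) -/(b s) -!expr2 => <-; have [->|n0] := eqVneq (F (z + s%:C * e)) 0.
    (* At a zero of F both sides are 0, because [ln 0 = 0]. *)
    by rewrite normc_zero expr0n /= ln0// mulr0.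
  by rewrite lnXn ?normc_gt0// -mulr_natl; field.
have D1 : is_derive t 1 (fun s => a s * a s + b s * b s)
    ((a t * complex.Re (l * e) + a t * complex.Re (l * e)) +
     (b t * complex.Im (l * e) + b t * complex.Im (l * e))).
  exact: is_deriveD (is_deriveM dR dR) (is_deriveM dI dI).
have D2 := @is_derive1_comp R (@ln R) (fun s => a s * a s + b s * b s) t _ _
  (is_derive1_ln ab) D1.
rewrite E; apply: is_derive_eq (is_deriveZ 2^-1 D2) _.
rewrite /GRing.scale /=.
have -> : complex.Re (l / F (z + t%:C * e) * e) =
    (a t * complex.Re (l * e) + b t * complex.Im (l * e)) / (a t * a t + b t * b t).
  rewrite (mulrAC l) /a /b; rewrite /a /b in ab; move: ab; case: (F _) => x y /=.
  case: (l * e) => x' y' /= ab; field; rewrite -!expr2 in ab *; exact: lt0r_neq0.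
by field; exact: lt0r_neq0.
Qed.

(** The first derivative is carried as data, since the second-order chain rule [D2_comp] needs its
    value at 0. *)
Definition D2 f (f1 : R -> R) (c : R) : Prop :=
  (\forall t \near (0 : R), is_derive (t : R) 1 f (f1 t)) /\ is_derive (0 : R) 1 f1 c.

Lemma D2_add f (f1 : R -> R) g (g1 : R -> R) (c d : R) : D2 f f1 c -> D2 g g1 d ->
  D2 (fun t => f t + g t) (fun t => f1 t + g1 t) (c + d).
Proof.
move=> [A B] [A' B']; split; last exact: is_deriveD.
by apply: filterS2 A A' => t; exact: is_deriveD.
Qed.

Lemma D2_scale (k : R) f (f1 : R -> R) (c : R) : D2 f f1 c ->
  D2 (fun t => k * f t) (fun t => k * f1 t) (k * c).
Proof.
move=> [A B]; split; last exact: (is_deriveZ k B).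
by apply: filterS A => t A; exact: (is_deriveZ k A).
Qed.

Lemma is_derive_cont f (x l : R) : is_derive x 1 f l -> {for x, continuous f}.
Proof. by move=> [d _]; apply: differentiable_continuous; exact/derivable1_diffP. Qed.

Lemma D2_comp q (q1 : R -> R) (c2 : R) f (f1 : R -> R) (c : R) :
  (\forall y \near f 0, is_derive (y : R) 1 q (q1 y)) -> is_derive (f 0) 1 q1 c2 ->
  D2 f f1 c -> D2 (fun t => q (f t)) (fun t => q1 (f t) * f1 t) (c2 * f1 0 ^+ 2 + q1 (f 0) * c).
Proof.
move=> Hq Hq1 [A B]; have A0 := nbhs_singleton A; split.
  have fc := is_derive_cont A0.
  have Hq' : \forall t \near (0 : R), is_derive (f t) 1 q (q1 (f t)) := fc _ Hq.
  near=> t; have Q : is_derive (f t) 1 q (q1 (f t)) by near: t.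
  have A' : is_derive (t : R) 1 f (f1 t) by near: t.
  exact: (is_derive1_comp Q A').
apply: is_derive_eq (is_deriveM (is_derive1_comp Hq1 A0) B) _.
by rewrite /GRing.scale /=; ring.
Unshelve. all: by end_near. Qed.

(** At the maximum f1 vanishes. If c were positive, f1 would be positive just to the right of 0, and
    f would increase there by the mean value theorem. *)
Lemma second_derivative_test f (f1 : R -> R) (c : R) : D2 f f1 c ->
  (\forall t \near (0 : R), f t <= f 0) -> c <= 0.
Proof.
move=> [A B] M; have A0 := nbhs_singleton A.
have f10 : f1 0 = 0.
  apply/eqP; apply: contrapT => /negP n0.
  have e0 : 0 < `|f1 0| / 2 by rewrite divr_gt0// normr_gt0.
  have [d d0 Hd] := is_derive_small A0 e0.
  move: M => /nbhs_ballP[d' /= d'0 Hd'].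
  pose m := Num.min d d' / 2.
  have m0 : 0 < m by rewrite divr_gt0// lt_min d0.
  have : m < Num.min d d' by rewrite ltr_pdivrMr// ltr_pMr ?ltr1n// lt_min d0.
  rewrite lt_min => /andP[md md'].
  pose h := if 0 < f1 0 then m else - m.
  have hm : `|h| = m by rewrite /h; case: ifP => _; rewrite ?normrN gtr0_norm.
  have f1h : f1 0 * h = `|f1 0| * m.
    rewrite /h; case: ltP => [p|p]; first by rewrite gtr0_norm.
    by rewrite ler0_norm// mulrN mulNr.
  have := Hd h; rewrite hm => /(_ md); rewrite add0r f1h ler_norml => /andP[lo _].
  have := Hd' h; rewrite -?ball_normE /ball_/= sub0r normrN hm => /(_ md') fh.
  have : 0 < `|f1 0| * m by rewrite mulr_gt0// normr_gt0.
  lra.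
apply: contrapT => /negP; rewrite -ltNge => c0.
have [d d0 Hd] := is_derive_small B (divr_gt0 c0 (ltr0n R 2)).
move: A M => /nbhs_ballP[d1 /= d10 A] /nbhs_ballP[d2 /= d20 M].
pose m := Num.min d (Num.min d1 d2) / 2.
have m0 : 0 < m by rewrite divr_gt0// !lt_min d0 d10.
have : m < Num.min d (Num.min d1 d2).
  by rewrite ltr_pdivrMr// ltr_pMr ?ltr1n// !lt_min d0 d10.
rewrite !lt_min => /and3P[md md1 md2].
have der x : 0 <= x <= m -> is_derive x 1 f (f1 x).
  move=> /andP[x0 xm]; apply: A; rewrite -?ball_normE /ball_/= sub0r normrN ger0_norm//.
  exact: le_lt_trans xm md1.
have H1 x : x \in `]0, m[ -> is_derive x 1 f (f1 x).
  by rewrite in_itv/= => /andP[x0 xm]; apply: der; rewrite !ltW.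
have H2 : {within `[0, m], continuous f}.
  apply: derivable_within_continuous => x; rewrite in_itv/= => xm.
  by have [] := der x xm.
have [x + E] := MVT m0 H1 H2; rewrite in_itv/= => /andP[x0 xm].
rewrite subr0 in E.
have := Hd x; rewrite gtr0_norm// => /(_ (lt_trans xm md)).
rewrite add0r f10 subr0 ler_norml => /andP[lo _].
have cx : 0 < c * x by rewrite mulr_gt0.
have f1x : 0 < f1 x by lra.
have := M m; rewrite -?ball_normE /ball_/= sub0r normrN gtr0_norm// => /(_ md2).
have : 0 < f1 x * m by rewrite mulr_gt0.
lra.
Qed.

(** [La] is the derivative of F' / F at z, the same for all directions e. The second derivative
    depends on e through e^2 alone, which changes sign under a quarter turn: this encodes the
    harmonicity of ln |F|. *)
Lemma D2_ln_normc F z (r : R) : 0 < r -> hol F z r -> F z != 0 ->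
  exists (l La : C), cderiv F z l /\ forall e : C, exists2 f1 : R -> R,
    D2 (fun t => ln (normc (F (z + t%:C * e)))) f1 (complex.Re (La * e ^+ 2)) &
    f1 0 = complex.Re (l / F z * e).
Proof.
move=> r0 FH Fz0; have [F' F'H FF'] := hol_cderiv r0 FH.
have zz (s : R) : 0 < s -> normc (z - z) < s by rewrite subrr normc_zero.
have r2 : 0 < r / 2 by rewrite divr_gt0.
have [l' F'l] := F'H z (zz _ r2).
pose G u := F' u / F u.
have [La GL] : exists La, cderiv G z La.
  by eexists; exact: (cderivF Fz0 F'l (FF' z (zz _ r2))).
exists (F' z), La; split; first exact: FF' (zz _ r2).
move=> e; pose p (t : R) : C := z + t%:C * e.
have p0 : p 0 = z by rewrite /p mul0r addr0.
exists (fun t => complex.Re (G (p t) * e)); last by rewrite p0.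
have e1 : 0 < normc e + 1 by rewrite ltr_wpDl ?normc_ge0.
split.
  have Fc : F v @[v --> z] --> F z by apply: cderiv_cont (FF' z (zz _ r2)).
  have /nbhs_normcP[d d0 Hd] := near_neq0 Fc Fz0.
  pose m := Num.min d (r / 2); have m0 : 0 < m by rewrite lt_min d0.
  apply/nbhs_ballP; exists (m / (normc e + 1)) => /=; first by rewrite divr_gt0.
  move=> t; rewrite -?ball_normE /ball_/= sub0r normrN ltr_pdivlMr// => tm.
  have : normc (p t - z) < m.
    rewrite /p addrC addKr normc_mul normc_real; apply: le_lt_trans tm.
    by rewrite ler_wpM2l// lerDl.
  rewrite lt_min => /andP[pd pr].
  by apply: is_derive_ln_normc; [exact: FF'|exact: Hd].
have GL0 : cderiv G (z + (0 : R)%:C * e) La by rewrite -/(p 0) p0.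
have H : cderiv (fun u => G u * e) (z + (0 : R)%:C * e) (La * e).
  have := cderivM GL0 (cderiv_cst e (z + (0 : R)%:C * e)); rewrite mulr0 addr0; exact.
by have := is_derive_Re H; rewrite -mulrA -expr2.
Qed.

End SecondDerivativeTest.

(** * The Laplacian of the logarithm of the comparison function *)

Section LaplacianAtMaximum.
Variable R : realType.
Local Notation C := (CC R).
Implicit Types (f : C -> C) (z w e : C) (x : R).

(* [qf (ln A)] is ln (1 + A ^ (1/30)); [qf1] and [qf2] are its derivatives. *)
Definition qf x : R := ln (1 + expR (x / 30)).
Definition qf1 x : R := 30^-1 * (expR (x / 30) / (1 + expR (x / 30))).
Definition qf2 x : R := 900^-1 * (expR (x / 30) / (1 + expR (x / 30)) ^+ 2).

Let E30 x : is_derive x 1 (fun y : R => expR (y / 30)) (expR (x / 30) / 30).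
Proof.
have H : is_derive x 1 (fun y : R => y / 30) (30^-1 : R).
  have := is_deriveZ (30^-1 : R) (is_derive_id x (1 : R)); rewrite /GRing.scale /= mulr1.
  by congr is_derive; apply/funext => y; rewrite /= mulrC.
exact: (@is_derive1_comp R (@expR R) (fun y => y / 30) x _ _ (is_derive_expR _) H).
Qed.

Let E30_1 x : is_derive x 1 (fun y : R => 1 + expR (y / 30)) (expR (x / 30) / 30).
Proof.
have := is_deriveD (is_derive_cst (1 : R) x (1 : R)) (E30 x); rewrite add0r; exact.
Qed.

Let pos x : 0 < 1 + expR (x / 30).
Proof. by rewrite addr_gt0// expR_gt0. Qed.

Lemma is_derive_qf x : is_derive x 1 qf (qf1 x).
Proof.
apply: is_derive_eq (@is_derive1_comp R (@ln R) (fun y => 1 + expR (y / 30)) x _ _ (is_derive1_ln (pos x)) (E30_1 x)) _.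
by rewrite /qf1; field; exact: lt0r_neq0.
Qed.

Lemma is_derive_qf1 x : is_derive x 1 qf1 (qf2 x).
Proof.
have p0 := lt0r_neq0 (pos x).
have V := @is_deriveV R (fun y => 1 + expR (y / 30)) x _ 1 p0 (E30_1 x).
apply: is_derive_eq (is_deriveZ (30^-1 : R) (is_deriveM (E30 x) V)) _.
by rewrite /qf2 /GRing.scale /=; field.
Qed.

(** Along a line r^2 - |z|^2 is a quadratic polynomial in t. The sum over two orthogonal unit
    directions is -4 r^2 / (r^2 - |z|^2)^2, the curvature term of the Poincare metric of the
    disc. *)
Lemma D2_ln_cap z (r : R) (a b : R) : normc z < r ->
  exists f1 : R -> R, D2 (fun t => ln (r ^+ 2 - normc (z + t%:C * (a +i* b)) ^+ 2)) f1
    (- 2 * (a ^+ 2 + b ^+ 2) / (r ^+ 2 - normc z ^+ 2)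
     - (2 * (complex.Re z * a + complex.Im z * b)) ^+ 2 / (r ^+ 2 - normc z ^+ 2) ^+ 2).
Proof.
move=> zr; set x := complex.Re z; set y := complex.Im z.
have N0 : 0 < r ^+ 2 - normc z ^+ 2.
  by rewrite subr_gt0 ltrXn2r ?nnegrE ?normc_ge0// (le_trans (normc_ge0 z) (ltW zr)).
pose be := 2 * (x * a + y * b); pose ga := a ^+ 2 + b ^+ 2.
pose n t := (r ^+ 2 - normc z ^+ 2) - be * t - ga * (t * t).
have nE t : r ^+ 2 - normc (z + t%:C * (a +i* b)) ^+ 2 = n t.
  rewrite /n /be /ga !normc_sqr /x /y; case: (z) => x' y' /=; ring.
have dn (t : R) : is_derive t 1 n (- be - ga * (2 * t)).
  have i := is_derive_id t (1 : R).
  apply: is_derive_eq (is_deriveB (is_deriveB (is_derive_cst (r ^+ 2 - normc z ^+ 2) t (1 : R)) (is_deriveZ be i))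
    (is_deriveZ ga (is_deriveM i i))) _.
  by rewrite /GRing.scale /=; ring.
have n0 : n 0 = r ^+ 2 - normc z ^+ 2 by rewrite /n; ring.
have Dn : D2 n (fun t => - be - ga * (2 * t)) (- 2 * ga).
  split; first by apply: filterE => t; exact: dn.
  have i := is_derive_id (0 : R) (1 : R).
  apply: is_derive_eq (is_deriveB (is_derive_cst (- be) (0 : R) (1 : R)) (is_deriveZ ga (is_deriveZ (2 : R) i))) _.
  by rewrite /GRing.scale /=; ring.
have Hq : \forall y' \near n 0, is_derive (y' : R) 1 (@ln R) (y'^-1).
  rewrite n0; apply/nbhs_ballP; exists (r ^+ 2 - normc z ^+ 2) => //= y'.
  rewrite -?ball_normE /ball_/= => H; apply: is_derive1_ln.
  by have := ler_norm (r ^+ 2 - normc z ^+ 2 - y'); lra.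
have Hq1 : is_derive (n 0) 1 (fun y' : R => y'^-1) (- (n 0) ^- 2).
  have i := is_derive_id (n 0) (1 : R).
  have nn : id (n 0) != 0 by rewrite n0 lt0r_neq0.
  apply: is_derive_eq (@is_deriveV R id (n 0) 1 1 nn i) _.
  by rewrite /GRing.scale /= mulr1.
have := D2_comp Hq Hq1 Dn; rewrite n0 mulr0 mulr0 subr0 => H.
exists (fun t => (n t)^-1 * (- be - ga * (2 * t))).
rewrite (_ : (fun t => ln _) = fun t => ln (n t)); last by apply/funext => t; rewrite nE.
move: H; congr D2; rewrite /be /ga sqrrN; field; exact: lt0r_neq0.
Qed.

(** The logarithm of [psi], by [ln_psi], written as a sum of multiples to which [D2_add] and
    [D2_scale] apply. The 58 / 30 is twice 29 / 30, as [psi] contains the square of the density. *)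
Definition logdens (f f' : C -> C) z0 (p : nat) (r : R) z : R :=
  2 * ln (normc (f' z)) + 58 / 30 * ln (normc (z - z0)) +
  - (2 * p%:R / 30) * ln (normc (f z)) + - (56 / 30) * ln (normc (f z - 1)) +
  qf (ln (normc (f z))) + qf (ln (normc (f z - 1))) + 2 * ln (r ^+ 2 - normc (z - z0) ^+ 2).

(* The second derivatives of ln |F|, F holomorphic, in the directions 1 and 'i
   cancel; what remains in [s 1 0 + s 0 1] is the Laplacian. *)
Lemma D2_logdens f f' z0 z1 (p : nat) (rho r : R) : 0 < rho ->
  hol f z1 rho -> hol f' z1 rho -> cderiv f z1 (f' z1) ->
  f z1 != 0 -> f z1 - 1 != 0 -> f' z1 != 0 -> z1 - z0 != 0 -> normc (z1 - z0) < r ->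
  exists s : R -> R -> R, [/\ forall a b, exists g, D2 (fun t => logdens f f' z0 p r (z1 + t%:C * (a +i* b))) g (s a b) &
   s 1 0 + s 0 1 = normc (f' z1 / f z1) ^+ 2 * qf2 (ln (normc (f z1))) +
      normc (f' z1 / (f z1 - 1)) ^+ 2 * qf2 (ln (normc (f z1 - 1)))
      - 8 * r ^+ 2 / (r ^+ 2 - normc (z1 - z0) ^+ 2) ^+ 2].
Proof.
move=> rho0 fH f'H ff' fz fz1 f'z zz zr.
have [l1 [La1 [_ H1]]] := D2_ln_normc rho0 f'H f'z.
have idH : hol (fun u => u - z0) z1 rho by move=> u _; exists 1; exact: cderiv_subC.
have [l4 [La4 [_ H4]]] := D2_ln_normc rho0 idH zz.
have [l2 [La2 [d2 H2]]] := D2_ln_normc rho0 fH fz.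
have f1H : hol (fun u => f u - 1) z1 rho.
  by move=> u /fH[l fl]; exists (l - 0); exact: cderivB fl (cderiv_cst 1 u).
have [l3 [La3 [d3 H3]]] := D2_ln_normc rho0 f1H fz1.
have E2 : l2 = f' z1 := cderiv_unique d2 ff'.
have E3 : l3 = f' z1.
  by apply: cderiv_unique d3 _; have := cderivB ff' (cderiv_cst 1 z1); rewrite subr0.
rewrite E2 in H2; rewrite E3 in H3.
set x2 := ln (normc (f z1)); set x3 := ln (normc (f z1 - 1)).
set L2 := f' z1 / f z1; set L3 := f' z1 / (f z1 - 1).
set zeta := z1 - z0; pose N := r ^+ 2 - normc zeta ^+ 2.
have N0 : 0 < N.
  by rewrite subr_gt0 ltrXn2r ?nnegrE ?normc_ge0// (le_trans (normc_ge0 zeta) (ltW zr)).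
(* For e = 1 and e = 'i the squares of Re (L2 e) add up to |L2|^2, and likewise for L3: these are
   the positive terms of the Laplacian. *)
pose s (a b : R) := let e : C := a +i* b in
  2 * complex.Re (La1 * e ^+ 2) + 58 / 30 * complex.Re (La4 * e ^+ 2) +
  - (2 * p%:R / 30) * complex.Re (La2 * e ^+ 2) + - (56 / 30) * complex.Re (La3 * e ^+ 2) +
  (qf2 x2 * complex.Re (L2 * e) ^+ 2 + qf1 x2 * complex.Re (La2 * e ^+ 2)) +
  (qf2 x3 * complex.Re (L3 * e) ^+ 2 + qf1 x3 * complex.Re (La3 * e ^+ 2)) +
  2 * (- 2 * (a ^+ 2 + b ^+ 2) / N - (2 * (complex.Re zeta * a + complex.Im zeta * b)) ^+ 2 / N ^+ 2).
exists s; split.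
  move=> a b; set e : C := a +i* b.
  have [g1 G1 _] := H1 e; have [g4 G4 _] := H4 e; have [g2 G2 g20] := H2 e.
  have [g3 G3 g30] := H3 e; have [g5 G5] := D2_ln_cap a b zr.
  have z10 : z1 + (0 : R)%:C * e = z1 by rewrite mul0r addr0.
  have Q (g : R -> R) : \forall y \near g 0, is_derive (y : R) 1 qf (qf1 y).
    by apply: filterE => y; exact: is_derive_qf.
  have Q2 := D2_comp (Q _) (is_derive_qf1 _) G2.
  have Q3 := D2_comp (Q _) (is_derive_qf1 _) G3.
  have D := D2_add (D2_add (D2_add (D2_add (D2_add (D2_add (D2_scale 2 G1)
    (D2_scale (58 / 30) G4)) (D2_scale (- (2 * p%:R / 30)) G2)) (D2_scale (- (56 / 30)) G3)) Q2) Q3)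
    (D2_scale 2 G5).
  eexists; rewrite /s -/e; rewrite /= g20 g30 in D.
  move: D; rewrite (_ : z1 + _ * e = z1)// => D.
  rewrite (_ : (fun t => logdens _ _ _ _ _ _) = (fun t => 2 * ln (normc (f' (z1 + t%:C * e))) +
    58 / 30 * ln (normc (z1 + t%:C * e - z0)) + - (2 * p%:R / 30) * ln (normc (f (z1 + t%:C * e))) +
    - (56 / 30) * ln (normc (f (z1 + t%:C * e) - 1)) + qf (ln (normc (f (z1 + t%:C * e)))) +
    qf (ln (normc (f (z1 + t%:C * e) - 1))) + 2 * ln (r ^+ 2 - normc (z1 - z0 + t%:C * e) ^+ 2))).
    exact: D.
  by apply/funext => t; rewrite /logdens (addrAC z1).
rewrite /s !normc_sqr /N.
case: (La1) => u1 v1; case: (La2) => u2 v2; case: (La3) => u3 v3; case: (La4) => u4 v4.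
have := N0; rewrite /N normc_sqr; case: (L2) => m2 n2; case: (L3) => m3 n3.
case: (zeta) => xx yy /= N0'; field; exact: lt0r_neq0.
Qed.

End LaplacianAtMaximum.

(** * Ahlfors' bound for the pulled-back density *)

Section DensityBound.
Variable R : realType.
Local Notation C := (CC R).
Implicit Types (f : C -> C) (z w : C).

(* The square of the density at [w] applied to the tangent vector [d]. As
   0^-1 = 0, it is 0 for w = 0 and w = 1, and therefore also at the poles of
   a meromorphic function, where [finval] is 0. *)
Definition dens (p : nat) (w d : C) : R :=
  let X := rt (normc w) in let Y := rt (normc (w - 1)) in
  normc d ^+ 2 * ((1 + X) * (1 + Y) / (X ^+ (2 * p) * Y ^+ 56)).

Lemma dens_ge0 p w d : 0 <= dens p w d.
Proof. by rewrite /dens !mulr_ge0 ?invr_ge0 ?mulr_ge0 ?exprn_ge0 ?addr_ge0 ?rt_ge0 ?normc_ge0. Qed.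

(* The factor |z - z0| ^ (29/15) makes [psi] vanish at z0 when f z0 = 1, whatever
   the multiplicity; the last factor makes it vanish on the circle of radius
   [r]. *)
Definition psi f f' z0 (p : nat) (r : R) z : R :=
  dens p (f z) (f' z) * rt (normc (z - z0)) ^+ 58 * (r ^+ 2 - normc (z - z0) ^+ 2) ^+ 2.

Lemma ln_rt (x : R) : 0 < x -> ln (rt x) = ln x / 30.
Proof. by move=> x0; rewrite rt_exp// expRK. Qed.

Lemma ln_psi f f' z0 (p : nat) (r : R) z : f z != 0 -> f z - 1 != 0 -> f' z != 0 ->
  z - z0 != 0 -> normc (z - z0) < r ->
  0 < psi f f' z0 p r z /\ ln (psi f f' z0 p r z) = logdens f f' z0 p r z.
Proof.
move=> f0 f1 f'0 zz zr; rewrite /psi /dens /logdens /qf.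
set A := normc (f z); set B := normc (f z - 1).
have A0 : 0 < A by rewrite normc_gt0.
have B0 : 0 < B by rewrite normc_gt0.
have D0 : 0 < normc (f' z) by rewrite normc_gt0.
have Z0 : 0 < normc (z - z0) by rewrite normc_gt0.
have N0 : 0 < r ^+ 2 - normc (z - z0) ^+ 2.
  by rewrite subr_gt0 ltrXn2r ?nnegrE ?normc_ge0// ltW// (lt_trans Z0).
have X0 : 0 < rt A by rewrite rt_gt0 gt_eqF.
have Y0 : 0 < rt B by rewrite rt_gt0 gt_eqF.
have W0 : 0 < rt (normc (z - z0)) by rewrite rt_gt0 gt_eqF.
have XX : 0 < 1 + rt A by rewrite addr_gt0.
have YY : 0 < 1 + rt B by rewrite addr_gt0.
have m0 : 0 < rt A ^+ (2 * p) * rt B ^+ 56 by rewrite mulr_gt0// exprn_gt0.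
have i0 : 0 < (rt A ^+ (2 * p) * rt B ^+ 56)^-1 by rewrite invr_gt0.
have D2 : 0 < normc (f' z) ^+ 2 by rewrite exprn_gt0.
have W58 : 0 < rt (normc (z - z0)) ^+ 58 by rewrite exprn_gt0.
have N2 : 0 < (r ^+ 2 - normc (z - z0) ^+ 2) ^+ 2 by rewrite exprn_gt0.
have e1 : ln (normc (f' z) ^+ 2) = 2 * ln (normc (f' z)) by rewrite lnXn// mulr_natl.
have e2 : ln (rt (normc (z - z0)) ^+ 58) = 58 / 30 * ln (normc (z - z0)).
  by rewrite lnXn// ln_rt// -mulr_natl; ring.
have e3 : ln ((r ^+ 2 - normc (z - z0) ^+ 2) ^+ 2) = 2 * ln (r ^+ 2 - normc (z - z0) ^+ 2).
  by rewrite lnXn// mulr_natl.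
have e4 : ln (rt A ^+ (2 * p) * rt B ^+ 56)^-1 =
    - (2 * p%:R / 30) * ln A + - (56 / 30) * ln B.
  rewrite lnV ?posrE// lnM ?posrE ?exprn_gt0// (lnXn (2 * p) X0) (lnXn 56 Y0) !ln_rt//.
  by rewrite -[_ *+ (2 * p)]mulr_natl -[_ *+ 56]mulr_natl natrM; ring.
have xe := rt_exp A0; have ye := rt_exp B0.
move: (_ ^+ 2) D2 e1 (_ ^+ 58) W58 e2 (_ ^+ 2) N2 e3 (_^-1) i0 e4.
move=> a a0 ea b b0 eb c c0 ec d d0 ed; split; first by rewrite !mulr_gt0.
by rewrite !lnM ?posrE ?mulr_gt0// ea eb ec ed xe ye; ring.
Qed.

(** The factors come from the curvature inequality (2^72), from [qf2] (900), from the Laplacian of 2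
    ln (r^2 - |z - z0|^2), and from |z - z0| < r in the factor |z - z0|^(29/15). *)
Definition densB (r : R) : R := 2 ^+ 72 * 900 * (8 * r ^+ 2) * rt r ^+ 58.

Lemma densB_ge0 (r : R) : 0 <= densB r.
Proof.
apply: mulr_ge0; last by apply: exprn_ge0; exact: rt_ge0.
apply: mulr_ge0; last by apply: mulr_ge0; [exact: ler0n|exact: sqr_ge0].
by apply: mulr_ge0; [apply: exprn_ge0|]; exact: ler0n.
Qed.

(* Ahlfors' argument: at a maximum of [psi] the Laplacian of its logarithm is
   nonpositive. *)
Lemma psi_max_bound f f' z0 z1 (p : nat) (rho r : R) : (4 <= p <= 29)%N -> 0 < rho ->
  hol f z1 rho -> hol f' z1 rho -> cderiv f z1 (f' z1) ->
  f z1 != 0 -> f z1 - 1 != 0 -> f' z1 != 0 -> z1 - z0 != 0 -> normc (z1 - z0) < r ->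
  (forall z, normc (z - z0) < r -> psi f f' z0 p r z <= psi f f' z0 p r z1) ->
  psi f f' z0 p r z1 <= densB r.
Proof.
move=> hp rho0 fH f'H ff' f0 f1 f'0 zz zr M.
have [s [Ds Es]] := D2_logdens p rho0 fH f'H ff' f0 f1 f'0 zz zr.
have r0 : 0 <= r by rewrite (le_trans (normc_ge0 _) (ltW zr)).
have c1 : normc (z1 - z1) < rho by rewrite subrr normc_zero.
have fc := hol_cont fH c1; have f'c := hol_cont f'H c1.
have f1c : (f v - 1) @[v --> z1] --> f z1 - 1 by exact: (ccvgB fc (ccvg_cst 1 z1)).
have idc : (v - z0) @[v --> z1] --> z1 - z0 by exact: (ccvgB (ccvg_id z1) (ccvg_cst z0 z1)).
have near_le : \forall z \near z1, logdens f f' z0 p r z <= logdens f f' z0 p r z1.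
  have n0 := near_neq0 fc f0.
  have n1 := @near_neq0 _ (fun v => f v - 1) _ f1c f1.
  have n2 := near_neq0 f'c f'0.
  have n3 := @near_neq0 _ (fun v => v - z0) _ idc zz.
  have n4 := near_ball zr.
  near=> z.
  have [//|//|//|//|//|p1 <-] := @ln_psi f f' z0 p r z1.
  have [| | | | |p2 <-] := @ln_psi f f' z0 p r z; try by near: z.
  by rewrite ler_ln ?posrE//; apply: M; near: z.
have sle a b : a ^+ 2 + b ^+ 2 = 1 -> s a b <= 0.
  move=> ab; have [g Dg] := Ds a b; apply: second_derivative_test Dg _.
  have : z1 + (0 : R)%:C * (a +i* b) = z1 by rewrite mul0r addr0.
  move=> ->; have /nbhs_normcP[d d0 Hd] := near_le.
  apply/nbhs_ballP; exists d => //= t; rewrite -?ball_normE /ball_/= sub0r normrN => td.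
  apply: Hd; rewrite addrC addKr normc_mul normc_real.
  by rewrite [normc _](_ : _ = 1) ?mulr1// /normc ab sqrtr1.
have := sle 1 0; have := sle 0 1.
rewrite !expr1n expr0n/= add0r addr0 => /(_ erefl) s1 /(_ erefl) s2.
have Sle : s 1 0 + s 0 1 <= 0 by lra.
move: Sle; rewrite Es /qf2 {s Ds Es s1 s2 sle near_le}.
rewrite -!rt_exp ?normc_gt0// !normc_div.
set A := normc (f z1); set B := normc (f z1 - 1); set d := normc (f' z1).
have A0 : 0 < A by rewrite normc_gt0.
have B0 : 0 < B by rewrite normc_gt0.
have X0 : 0 < rt A by rewrite rt_gt0 gt_eqF.
have Y0 : 0 < rt B by rewrite rt_gt0 gt_eqF.
set N := r ^+ 2 - normc (z1 - z0) ^+ 2.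
have N0 : 0 < N by rewrite subr_gt0 ltrXn2r ?nnegrE ?normc_ge0.
have AB : A <= B + 1.
  by have := normc_leD (f z1 - 1) 1; rewrite subrK normc_one.
have BA : B <= A + 1 by have := normc_leB (f z1) 1; rewrite normc_one.
have AB1 : 1 <= A + B.
  by have := normc_leB (f z1) (f z1 - 1); rewrite opprB addrC subrK normc_one.
have := curvature_ineq hp X0 Y0 (rtK (ltW A0)) (rtK (ltW B0)) AB BA AB1.
set G := (1 + rt A) * (1 + rt B) / _ => curv Sle.
have c0 : (0 : R) < 2 ^+ 72 by rewrite exprn_gt0.
have d0 : 0 <= d ^+ 2 by rewrite sqr_ge0.
(* With T the right-hand side of the curvature inequality, G <= 2^72 T, and the sign of the
   Laplacian says d^2 T <= 900 (8 r^2 / N^2). *)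
have key : d ^+ 2 * G * N ^+ 2 <= 2 ^+ 72 * 900 * (8 * r ^+ 2).
  move: (2 ^+ 72) c0 curv => k k0; rewrite ler_pdivrMl//.
  set T := rt A / _ / _ + _ => h.
  have h2 : d ^+ 2 * T <= 900 * (8 * r ^+ 2 / N ^+ 2).
    have -> : d ^+ 2 * T = 900 * ((d / A) ^+ 2 * (900^-1 * (rt A / (1 + rt A) ^+ 2)) +
       (d / B) ^+ 2 * (900^-1 * (rt B / (1 + rt B) ^+ 2))).
      rewrite /T; field; rewrite !gt_eqF ?addr_gt0//.
    by apply: ler_wpM2l; [exact: ler0n|rewrite -subr_le0].
  rewrite -ler_pdivlMr ?exprn_gt0//; apply: le_trans (ler_wpM2l d0 h) _.
  rewrite mulrCA -!mulrA; apply: ler_wpM2l; first exact: ltW.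
  by move: h2; rewrite -!mulrA.
rewrite /psi /densB -/N /dens -/A -/B -/G -/d mulrAC; apply: ler_pM => //.
- by apply: mulr_ge0; [exact: (dens_ge0 p (f z1) (f' z1))|exact: sqr_ge0].
- by rewrite exprn_ge0// rt_ge0.
- by rewrite lerXn2r ?nnegrE ?rt_ge0// ler_rt ?normc_ge0// ltW.
Unshelve. all: by end_near. Qed.

End DensityBound.

Arguments ccvgX {R} [f z a] n%_N _.

(** * Continuity of the pulled-back density at zeros, 1-points and poles *)

Section DensityContinuity.
Variable R : realType.
Local Notation C := (CC R).
Implicit Types (u v : C -> R) (a z : C).

Lemma rcvgP u a (x : R) : u z @[z --> a] --> x <-> forall e : R, 0 < e ->
  exists2 d : R, 0 < d & forall z, normc (z - a) < d -> `|u z - x| < e.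
Proof.
split=> [H e e0|H A /nbhs_ballP[e /= e0 sub]].
  have /nbhs_normcP[d d0 Hd] : nbhs a (u @^-1` ball x e) by apply: H; exact: nbhsx_ballx.
  by exists d => // z /Hd; rewrite /= -ball_normE /ball_/= distrC.
have [d d0 Hd] := H e e0; apply/nbhs_normcP; exists d => // z /Hd zd; apply: sub.
by rewrite -?ball_normE /ball_/= distrC.
Qed.

Lemma rcvgD u v a (x y : R) : u z @[z --> a] --> x -> v z @[z --> a] --> y ->
  u z + v z @[z --> a] --> x + y.
Proof. by move=> hu hv; apply: (cvgD hu hv). Qed.

Lemma rcvgM u v a (x y : R) : u z @[z --> a] --> x -> v z @[z --> a] --> y ->
  u z * v z @[z --> a] --> x * y.
Proof. by move=> hu hv; apply: (cvgM hu hv). Qed.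

Lemma rcvg_cst a (x : R) : (fun _ : C => x) z @[z --> a] --> x.
Proof.
move=> A /nbhs_ballP[e /= e0 sub]; apply: (@filterE _ (nbhs a)) => z; apply: sub.
exact: ballxx.
Qed.
Arguments rcvg_cst : clear implicits.

Lemma rcvgV u a (x : R) : x != 0 -> u z @[z --> a] --> x -> (u z)^-1 @[z --> a] --> x^-1.
Proof. by move=> x0 hu; apply: (cvgV x0 hu). Qed.

Lemma rcvgX u a (x : R) n : u z @[z --> a] --> x -> u z ^+ n @[z --> a] --> x ^+ n.
Proof.
move=> hu; elim: n => [|n IH]; first exact: (rcvg_cst a).
rewrite (_ : (fun z => u z ^+ n.+1) = fun z => u z * u z ^+ n); last first.
  by apply/funext => z; rewrite exprS.
by rewrite exprS; exact: rcvgM.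
Qed.

Arguments rcvgX [u a x] n%_N _.

Lemma rcvg_normc (w : C -> C) a (x : C) : w z @[z --> a] --> x ->
  normc (w z) @[z --> a] --> normc x.
Proof. by move=> hw; apply: (@cvg_normc R C (nbhs a) (nbhs_filter a) w x hw). Qed.

Lemma rcvg_rt u a (x : R) : u z @[z --> a] --> x -> rt (u z) @[z --> a] --> rt x.
Proof. by move=> hu; apply: (@cvg_comp _ _ _ u (@rt R) (nbhs a) (nbhs x) _ hu (@rt_cont R x)). Qed.

Lemma rcvg_rtn (w : C -> C) a (x : C) : w z @[z --> a] --> x ->
  rt (normc (w z)) @[z --> a] --> rt (normc x).
Proof. by move=> hw; exact: rcvg_rt (rcvg_normc hw). Qed.

Lemma dens_cont (p : nat) (w d : C -> C) a : w a != 0 -> w a - 1 != 0 ->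
  w z @[z --> a] --> w a -> d z @[z --> a] --> d a ->
  dens p (w z) (d z) @[z --> a] --> dens p (w a) (d a).
Proof.
move=> w0 w1 hw hd; have hX := rcvg_rtn hw.
have hw1 : (w z - 1) @[z --> a] --> w a - 1 by exact: (ccvgB hw (ccvg_cst 1 a)).
have hY := rcvg_rtn hw1.
have n0 : rt (normc (w a)) ^+ (2 * p) * rt (normc (w a - 1)) ^+ 56 != 0.
  by rewrite mulf_neq0// expf_neq0// gt_eqF// rt_gt0 normc_eq0.
exact: (rcvgM (rcvgX 2 (rcvg_normc hd))
  (rcvgM (rcvgM (rcvgD (rcvg_cst a 1) hX) (rcvgD (rcvg_cst a 1) hY))
     (rcvgV n0 (rcvgM (rcvgX (2 * p) hX) (rcvgX 56 hY))))).
Qed.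

Lemma rt_dist_cvg0 a n : rt (normc (z - a)) ^+ n.+1 @[z --> a] --> (0 : R).
Proof.
have h : rt (normc (z - a)) @[z --> a] --> rt (normc (a - a)).
  exact: (rcvg_rtn (ccvgB (ccvg_id a) (ccvg_cst a a))).
by have := rcvgX n.+1 h; rewrite subrr normc_zero rt0 expr0n.
Qed.

(** A positive power of |z - a| times a convergent factor tends to 0, which is the value at a. The
    factorization is needed only off a, where the conventions for division by 0 do not interfere. *)
Lemma cvg_vanish (th U : C -> R) a (b : R) n : (\forall z \near a, z != a ->
    th z = rt (normc (z - a)) ^+ n.+1 * U z) -> U z @[z --> a] --> b -> th a = 0 ->
  th z @[z --> a] --> th a.
Proof.
move=> /nbhs_normcP[d0 d00 E] hU t0; have H := rcvgM (rt_dist_cvg0 a n) hU; rewrite mul0r in H.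
rewrite t0; apply/rcvgP => e e0; have /rcvgP/(_ _ e0)[d1 d10 H1] := H.
exists (Num.min d0 d1); first by rewrite lt_min d00.
move=> z; rewrite lt_min => /andP[z0 z1]; have [->|za] := eqVneq z a.
  by rewrite t0 subrr normr0.
by rewrite E//; exact: H1.
Qed.

Lemma dens_alg (a b K G H Y : R) : b != 0 -> a * b * K * (G / (b * H * Y)) = a * (K * (G / (H * Y))).
Proof.
move=> b0; rewrite !invfM.
have -> : a * b * K * (G * (b^-1 * H^-1 * Y^-1)) = b / b * (a * (K * (G * (H^-1 * Y^-1)))) by ring.
by rewrite divff// mul1r.
Qed.

Lemma dens_alg_pole (t s n K G G1 P Q tP tQ : R) : t != 0 -> s != 0 -> tP * tQ = n * (s ^+ 2 * t ^+ 2) ->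
  K * s ^- 2 * ((1 + G / t) * (1 + G1 / t) / (P * tP^-1 * (Q * tQ^-1))) =
  n * (K * ((t + G) * (t + G1) / (P * Q))).
Proof.
move=> t0 s0 e1.
have -> : (P * tP^-1 * (Q * tQ^-1))^-1 = P^-1 * tP * (Q^-1 * tQ) by rewrite !invfM !invrK.
rewrite (invfM P Q).
have -> : K * s ^- 2 * ((1 + G / t) * (1 + G1 / t) * (P^-1 * tP * (Q^-1 * tQ))) =
  (tP * tQ) * (s ^- 2 * (1 + G / t) * (1 + G1 / t)) * (K * (P^-1 * Q^-1)) by ring.
rewrite e1; have -> : n * (s ^+ 2 * t ^+ 2) * (s ^- 2 * (1 + G / t) * (1 + G1 / t)) =
  n * ((t + G) * (t + G1)) by field; rewrite ?s0 ?t0.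
ring.
Qed.

(** In powers of [rt] of |z - a|, |d|^2 contributes the order 60 (m - 1) and the denominator takes
    away 2 p m: the hypothesis says that the total is positive. U is the convergent remaining
    factor. *)
Lemma dens_zero (p m : nat) (w d h k : C -> C) a : (0 < p)%N -> (2 * p * m < 60 * m.-1)%N ->
  w a = 0 -> h a != 0 -> h z @[z --> a] --> h a -> k z @[z --> a] --> k a ->
  (\forall z \near a, z != a -> w z = (z - a) ^+ m * h z /\ d z = (z - a) ^+ m.-1 * k z) ->
  dens p (w z) (d z) @[z --> a] --> dens p (w a) (d a).
Proof.
move=> p0 hm wa ha hh hk E.
have m0 : (0 < m)%N by case: m hm {E} => //; rewrite muln0.
pose H z := rt (normc (h z)); pose X z := rt (normc (z - a)) ^+ m * H z.
pose Y z := rt (normc ((z - a) ^+ m * h z - 1)).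
pose U z := normc (k z) ^+ 2 * ((1 + X z) * (1 + Y z) / (H z ^+ (2 * p) * Y z ^+ 56)).
have hz : (z - a) @[z --> a] --> a - a by exact: (ccvgB (ccvg_id a) (ccvg_cst a a)).
have hH : H z @[z --> a] --> H a by exact: rcvg_rtn.
have hX : X z @[z --> a] --> X a by exact: (rcvgM (rcvgX m (rcvg_rtn hz)) hH).
have hY : Y z @[z --> a] --> Y a.
  exact: (rcvg_rtn (ccvgB (ccvgM (ccvgX m hz) hh) (ccvg_cst 1 a))).
have hU : U z @[z --> a] --> U a.
  have n0 : H a ^+ (2 * p) * Y a ^+ 56 != 0.
    rewrite mulf_neq0// expf_neq0// gt_eqF// rt_gt0 normc_eq0//.
    by rewrite subrr expr0n gtn_eqF// mul0r sub0r oppr_eq0 oner_eq0.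
  exact: (rcvgM (rcvgX 2 (rcvg_normc hk))
    (rcvgM (rcvgM (rcvgD (rcvg_cst a 1) hX) (rcvgD (rcvg_cst a 1) hY))
       (rcvgV n0 (rcvgM (rcvgX (2 * p) hH) (rcvgX 56 hY))))).
apply: (@cvg_vanish _ U a (U a) (60 * m.-1 - 2 * p * m).-1) => //; last first.
  rewrite /dens wa normc_zero rt0 expr0n.
  have -> : (2 * p == 0)%N = false by lia.
  by rewrite mul0r invr0 !mulr0.
apply: filterS E => z Ez za; have [-> ->] := Ez za.
rewrite prednK ?subn_gt0// /dens /U -/(Y z).
have t0 : 0 < rt (normc (z - a)) by rewrite rt_gt0 normc_eq0 subr_eq0.
rewrite !normc_mul !normc_exp rtM rtX -/(H z) -/(X z).
have nz : normc (z - a) = rt (normc (z - a)) ^+ 30 by rewrite rtK// normc_ge0.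
have e2 : X z ^+ (2 * p) = rt (normc (z - a)) ^+ (m * (2 * p)) * H z ^+ (2 * p).
  by rewrite /X exprMn -exprM.
rewrite e2 {1}nz; move: (rt (normc (z - a))) t0 => t t0.
have e1 : (t ^+ 30) ^+ m.-1 ^+ 2 = t ^+ (60 * m.-1 - 2 * p * m) * t ^+ (m * (2 * p)).
  by rewrite -!exprM -exprD; congr (_ ^+ _); lia.
rewrite exprMn e1; apply: dens_alg; exact: expf_neq0 (lt0r_neq0 t0).
Qed.

(** The orders are 60 (m - 1) from |d|^2, -56 m from the denominator and 58 from the extra factor: 4
    m - 2 in all, positive for every m >= 1. *)
Lemma dens_one (p m : nat) (w d h k : C -> C) a : (0 < m)%N ->
  w a = 1 -> h a != 0 -> h z @[z --> a] --> h a -> k z @[z --> a] --> k a ->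
  (\forall z \near a, z != a -> w z - 1 = (z - a) ^+ m * h z /\ d z = (z - a) ^+ m.-1 * k z) ->
  dens p (w z) (d z) * rt (normc (z - a)) ^+ 58 @[z --> a] -->
  dens p (w a) (d a) * rt (normc (a - a)) ^+ 58.
Proof.
move=> m0 wa ha hh hk E.
pose H z := rt (normc (h z)); pose Y z := rt (normc (z - a)) ^+ m * H z.
pose X z := rt (normc ((z - a) ^+ m * h z + 1)).
pose U z := normc (k z) ^+ 2 * ((1 + X z) * (1 + Y z) / (H z ^+ 56 * X z ^+ (2 * p))).
have hz : (z - a) @[z --> a] --> a - a by exact: (ccvgB (ccvg_id a) (ccvg_cst a a)).
have hH : H z @[z --> a] --> H a by exact: rcvg_rtn.
have hY : Y z @[z --> a] --> Y a by exact: (rcvgM (rcvgX m (rcvg_rtn hz)) hH).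
have hX : X z @[z --> a] --> X a.
  exact: (rcvg_rtn (ccvgD (ccvgM (ccvgX m hz) hh) (ccvg_cst 1 a))).
have hU : U z @[z --> a] --> U a.
  have n0 : H a ^+ 56 * X a ^+ (2 * p) != 0.
    rewrite mulf_neq0// expf_neq0// gt_eqF// rt_gt0 normc_eq0//.
    by rewrite subrr expr0n gtn_eqF// mul0r add0r oner_eq0.
  exact: (rcvgM (rcvgX 2 (rcvg_normc hk))
    (rcvgM (rcvgM (rcvgD (rcvg_cst a 1) hX) (rcvgD (rcvg_cst a 1) hY))
       (rcvgV n0 (rcvgM (rcvgX 56 hH) (rcvgX (2 * p) hX))))).
apply: (@cvg_vanish (fun z => dens p (w z) (d z) * rt (normc (z - a)) ^+ 58) U a (U a) (4 * m - 2).-1).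
- apply: filterS E => z Ez za; have [w1 ->] := Ez za.
  have wE : w z = (z - a) ^+ m * h z + 1 by rewrite -w1 subrK.
  rewrite prednK ?subn_gt0; last by lia.
  rewrite /dens /U w1 wE -/(X z).
  have t0 : 0 < rt (normc (z - a)) by rewrite rt_gt0 normc_eq0 subr_eq0.
  rewrite !normc_mul !normc_exp rtM rtX -/(H z) -/(Y z).
  have nz : normc (z - a) = rt (normc (z - a)) ^+ 30 by rewrite rtK// normc_ge0.
  have e2 : Y z ^+ 56 = rt (normc (z - a)) ^+ (m * 56) * H z ^+ 56.
    by rewrite /Y exprMn -exprM.
  rewrite e2 {1}nz; move: (rt (normc (z - a))) t0 => t t0.
  have e1 : (t ^+ 30) ^+ m.-1 ^+ 2 * t ^+ 58 = t ^+ (4 * m - 2) * t ^+ (m * 56).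
    by rewrite -!exprM -!exprD; congr (_ ^+ _); lia.
  rewrite exprMn (mulrAC _ _ (t ^+ 58)) (mulrAC _ _ (t ^+ 58)) e1 (mulrC (X z ^+ _)).
  by apply: dens_alg; exact: expf_neq0 (lt0r_neq0 t0).
- exact: hU.
- by rewrite subrr normc_zero rt0 expr0n mulr0.
Qed.

(** The orders are (2 p + 56) m from the denominator, -60 (m + 1) from |d|^2 and -2 m from the two
    factors of the numerator. At a itself w has the dummy value 0 of [finval], where [dens] is 0
    too. *)
Lemma dens_pole (p m : nat) (w d g k : C -> C) a : (0 < p)%N -> (0 < m)%N ->
  (60 * m.+1 + 2 * m < (2 * p + 56) * m)%N ->
  w a = 0 -> g a != 0 -> g z @[z --> a] --> g a -> k z @[z --> a] --> k a ->
  (\forall z \near a, z != a -> w z = g z / (z - a) ^+ m /\ d z = k z / (z - a) ^+ m.+1) ->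
  dens p (w z) (d z) @[z --> a] --> dens p (w a) (d a).
Proof.
move=> p0 m0 hm wa ga hg hk E.
pose G z := rt (normc (g z)); pose G1 z := rt (normc (g z - (z - a) ^+ m)).
pose T z := rt (normc (z - a)) ^+ m.
pose U z := normc (k z) ^+ 2 * ((T z + G z) * (T z + G1 z) / (G z ^+ (2 * p) * G1 z ^+ 56)).
have hz : (z - a) @[z --> a] --> a - a by exact: (ccvgB (ccvg_id a) (ccvg_cst a a)).
have hG : G z @[z --> a] --> G a by exact: rcvg_rtn.
have hG1 : G1 z @[z --> a] --> G1 a by exact: (rcvg_rtn (ccvgB hg (ccvgX m hz))).
have hT : T z @[z --> a] --> T a by exact: (rcvgX m (rcvg_rtn hz)).
have hU : U z @[z --> a] --> U a.
  have n0 : G a ^+ (2 * p) * G1 a ^+ 56 != 0.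
    rewrite mulf_neq0// expf_neq0// gt_eqF// rt_gt0 normc_eq0//.
    by rewrite subrr expr0n gtn_eqF// subr0.
  exact: (rcvgM (rcvgX 2 (rcvg_normc hk)) (rcvgM (rcvgM (rcvgD hT hG) (rcvgD hT hG1))
       (rcvgV n0 (rcvgM (rcvgX (2 * p) hG) (rcvgX 56 hG1))))).
apply: (@cvg_vanish (fun z => dens p (w z) (d z)) U a (U a)
  ((2 * p + 56) * m - (60 * m.+1 + 2 * m)).-1).
- apply: filterS E => z Ez za; have [-> ->] := Ez za.
  rewrite prednK ?subn_gt0// /dens /U.
  have zm : (z - a) ^+ m != 0 by rewrite expf_neq0// subr_eq0.
  have -> : g z / (z - a) ^+ m - 1 = (g z - (z - a) ^+ m) / (z - a) ^+ m by rewrite mulrBl divff.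
  have t0 : 0 < rt (normc (z - a)) by rewrite rt_gt0 normc_eq0 subr_eq0.
  rewrite !normc_div !normc_exp !rtM !rtV rtX -/(G z) -/(G1 z) -/(T z).
  have nz : normc (z - a) = rt (normc (z - a)) ^+ 30 by rewrite rtK// normc_ge0.
  have e3 : normc (z - a) ^+ m.+1 = rt (normc (z - a)) ^+ (30 * m.+1) by rewrite exprM -nz.
  rewrite e3; have T0 : T z != 0 by rewrite expf_neq0// lt0r_neq0.
  have e1 : T z ^+ (2 * p) * T z ^+ 56 =
      rt (normc (z - a)) ^+ ((2 * p + 56) * m - (60 * m.+1 + 2 * m)) *
      (rt (normc (z - a)) ^+ (30 * m.+1) ^+ 2 * T z ^+ 2).
    by rewrite /T -!exprM -!exprD; congr (_ ^+ _); lia.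
  have s0 : rt (normc (z - a)) ^+ (30 * m.+1) != 0.
    by rewrite expf_neq0// lt0r_neq0.
  move: e1 T0 s0; move: (T z) (rt _ ^+ (30 * m.+1)) (rt _ ^+ (_ - _)).
  move=> t s n e1 t0' s0; rewrite !exprMn !exprVn; exact: dens_alg_pole.
- exact: hU.
- rewrite /dens wa normc_zero rt0 expr0n.
  have -> : (2 * p == 0)%N = false by lia.
  by rewrite mul0r invr0 !mulr0.
Qed.

End DensityContinuity.

Arguments rcvgX {R} [u a x] n%_N _.
Arguments rcvg_cst {R} a x.

(** * Meromorphic functions *)

Section MeromorphicLocal.
Variable R : realType.
Local Notation C := (CC R).
Implicit Types (f : C -> sphere R) (g h : C -> C) (a z w : C).

Definition der g z : C := xget 0 [set l | cderiv g z l].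

Lemma derE g z l : cderiv g z l -> der g z = l.
Proof. by move=> gl; exact: (@cderiv_unique _ g z _ _ (xgetI 0 gl) gl). Qed.

Lemma cderiv_der g z : (exists l, cderiv g z l) -> cderiv g z (der g z).
Proof. by move=> [l gl]; rewrite (derE gl). Qed.

Lemma hol_der g z (r : R) : 0 < r -> hol g z r -> hol (der g) z (r / 2).
Proof.
move=> r0 gH; have [g' g'H gg'] := hol_cderiv r0 gH.
by apply: hol_ext g'H => u ur; rewrite (derE (gg' u ur)).
Qed.

Lemma regular_pointP f a : regular_point f a -> exists2 r : R, 0 < r &
  hol (finval f) a r /\ forall z, normc (z - a) < r -> f z = Some (finval f z).
Proof.
move=> [/nbhs_normcP[r1 r10 H1] /holomorphic_atP[r2 r20 H2]].
exists (Num.min r1 r2); first by rewrite lt_min r10.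
split; first by apply: hol_le H2; rewrite ge_min lexx orbT.
move=> z; rewrite lt_min => /andP[z1 _]; have := H1 z z1.
by rewrite /finval; case: (f z).
Qed.

(** 1 / f extended by 0 has a removable singularity at a, and [hol_factor] applies to it. It does
    not vanish identically, f being finite and nonzero around a. *)
Lemma pole_factor f a : is_pole f a -> exists (m : nat) (g : C -> C) (r : R),
  [/\ (0 < m)%N, 0 < r, hol g a r, g a != 0 &
      forall z, normc (z - a) < r -> z != a -> f z = Some (g z / (z - a) ^+ m)].
Proof.
move=> [fa /dnbhs_normcP[r1 r10 H1] finf].
have big (M : R) : exists2 d : R, 0 < d & forall z, normc (z - a) < d -> z != a ->
    M < normc (finval f z).
  by move/cvgryPgt : finf => /(_ M) /dnbhs_normcP.
have [r2 r20 H2] := big 0.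
pose r := Num.min r1 r2; have r0 : 0 < r by rewrite lt_min r10.
have Hr z : normc (z - a) < r -> z != a -> regular_point f z /\ finval f z != 0.
  rewrite lt_min => /andP[z1 z2] za; split; first exact: H1.
  by rewrite -normc_gt0; exact: H2.
pose k z := if z == a then 0 else (finval f z)^-1.
have ka : k a = 0 by rewrite /k eqxx.
have kH : hol k a r.
  apply: hol_removable => // [u ur ua|].
    have [reg n0] := Hr u ur ua; have [s s0 [fH _]] := regular_pointP reg.
    have [|l fl] := fH u; first by rewrite subrr normc_zero.
    eexists; apply: cderiv_near (cderivV n0 fl).
    apply/nbhs_normcP; exists (normc (u - a)); first by rewrite normc_gt0 subr_eq0.
    move=> v vu; rewrite /k ifN//; apply: contraTneq vu => ->.
    by rewrite normc_distC ltxx.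
  apply/ccvgP => e e0; rewrite ka; have [d d0 Hd] := big e^-1.
  apply/nbhs_normcP; exists d => // z zd; rewrite subr0 /k; case: eqVneq => [_|za].
    by rewrite normc_zero.
  have := Hd z zd za => B; rewrite normc_inv -[e]invrK ltf_pV2 ?posrE ?invr_gt0//.
  by apply: lt_trans B; rewrite invr_gt0.
have [[s s0 Hs]|[m [h [s [s0 hH h0 kE]]]]] := hol_factor r0 kH.
  pose d := Num.min r s / 2; have d0 : 0 < d by rewrite divr_gt0// lt_min r0.
  have : d < Num.min r s by rewrite ltr_pdivrMr// ltr_pMr ?ltr1n// lt_min r0.
  rewrite lt_min => /andP[dr ds].
  have nd : normc (a + d%:C - a) = d by rewrite addrC addKr normc_real gtr0_norm.
  have ne : a + d%:C != a by rewrite -subr_eq0 -normc_gt0 nd.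
  have := Hs (a + d%:C); rewrite nd => /(_ ds); rewrite /k ifN// => /eqP.
  have [|_] := Hr (a + d%:C) _ ne; first by rewrite nd.
  by rewrite invr_eq0 => /negbTE ->.
have m0 : (0 < m)%N.
  rewrite lt0n; apply: contra_neqN h0 => /eqP m0.
  by have := kE a; rewrite subrr normc_zero => /(_ s0); rewrite ka m0 expr0 mul1r.
have hc : h v @[v --> a] --> h a by apply: hol_cont hH _; rewrite subrr normc_zero.
have /nbhs_normcP[s1 s10 h1] := near_neq0 hc h0.
pose t := Num.min r (Num.min s s1).
have tr : t <= r by rewrite ge_min lexx.
have ts : t <= s by rewrite !ge_min lexx orbT.
have ts1 : t <= s1 by rewrite !ge_min lexx !orbT.
exists m, (fun z => (h z)^-1), t; split => //.
- by rewrite !lt_min r10 r20 s0 s10.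
- move=> u ut; have [|l hl] := hH u; first exact: lt_le_trans ut ts.
  by eexists; apply: cderivV hl; apply: h1; exact: lt_le_trans ut ts1.
- by rewrite invr_eq0.
move=> z zt za; have [reg n0] := Hr z (lt_le_trans zt tr) za.
have [q q0 [_ fS]] := regular_pointP reg; rewrite fS ?subrr ?normc_zero//; congr Some.
have := kE z (lt_le_trans zt ts); rewrite /k ifN// => E.
by rewrite -[finval f z]invrK E invfM mulrC.
Qed.

(** The part of [psi] whose continuity is in doubt; the remaining factor is a polynomial in |z -
    z0|. *)
Definition Theta f z0 (p : nat) z : R :=
  dens p (finval f z) (der (finval f) z) * rt (normc (z - z0)) ^+ 58.

Lemma dens0 p d : (0 < p)%N -> dens p (0 : C) d = 0.
Proof.
move=> p0; rewrite /dens normc_zero rt0 expr0n.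
have -> : (2 * p == 0)%N = false by lia.
by rewrite mul0r invr0 !mulr0.
Qed.

Lemma rcvg_pow58 z0 a : rt (normc (z - z0)) ^+ 58 @[z --> a] --> rt (normc (a - z0)) ^+ 58.
Proof. exact: (rcvgX 58 (rcvg_rtn (ccvgB (ccvg_id a) (ccvg_cst z0 a)))). Qed.

Lemma der_power_factor g h a (c : C) (m : nat) (r : R) : 0 < r -> hol h a r -> (0 < m)%N ->
  (forall z, normc (z - a) < r -> g z - c = (z - a) ^+ m * h z) ->
  forall z, normc (z - a) < r -> der g z = (z - a) ^+ m.-1 * (m%:R * h z + (z - a) * der h z).
Proof.
move=> r0 hH m0 E z zr; have hd := cderiv_der (hH z zr).
have D := cderivD (cderivM (cderivX m (cderiv_subC a z)) hd) (cderiv_cst c z).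
have D' : cderiv g z (m%:R * (z - a) ^+ m.-1 * 1 * h z + (z - a) ^+ m * der h z + 0).
  apply: cderiv_near D; apply: filterS (near_ball zr) => v vr.
  by rewrite -E// subrK.
have Em : (z - a) ^+ m = (z - a) ^+ m.-1 * (z - a) by rewrite -exprSr prednK.
by rewrite (derE D') Em; ring.
Qed.

Lemma Theta_cont f z0 (p : nat) a : (0 < p)%N ->
  regular_point f a \/ is_pole f a ->
  (forall m, zero_of_multiplicity f a m -> (2 * p * m < 60 * m.-1)%N) ->
  (forall m, pole_of_multiplicity f a m -> (60 * m.+1 + 2 * m < (2 * p + 56) * m)%N) ->
  (f a = Some 1 -> a = z0 /\ \forall z \near a, z != a -> f z <> Some 1) ->
  Theta f z0 p z @[z --> a] --> Theta f z0 p a.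
Proof.
move=> p0 [reg|pole] hzero hpole hone.
  have [r r0 [fH fS]] := regular_pointP reg; set g := finval f in fH fS.
  have aa (s : R) : 0 < s -> normc (a - a) < s by rewrite subrr normc_zero.
  have gc := hol_cont fH (aa _ r0).
  have r2 : 0 < r / 2 by rewrite divr_gt0.
  have g'c := hol_cont (hol_der r0 fH) (aa _ r2).
  have [ga0|ga0] := eqVneq (g a) 0.
    have [[s s0 Hs]|[m [h [s [s0 hH h0 gE]]]]] := hol_factor r0 fH.
      (* f vanishes identically near a, and so does [dens] there by convention. *)
      apply/rcvgP => e e0; exists s => // z zs.
      by rewrite /Theta -/g (Hs z zs) ga0 !dens0// !mul0r subrr normr0.
    have fa : f a = Some 0 by rewrite fS ?aa// ga0.
    have hol_h : holomorphic_at h a by apply/holomorphic_atP; exists s.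
    have mz : zero_of_multiplicity f a m.
      split => //; exists h; split => //; apply/nbhs_normcP.
      exists (Num.min r s); first by rewrite lt_min r0.
      move=> z; rewrite lt_min => /andP[zr zs]; rewrite fS//; congr Some; exact: gE.
    have hm := hzero m mz.
    have m0 : (0 < m)%N by case: (m) hm => //; rewrite muln0.
    have gE' z : normc (z - a) < s -> g z - 0 = (z - a) ^+ m * h z by rewrite subr0; exact: gE.
    have dE := der_power_factor s0 hH m0 gE'.
    apply: rcvgM; last exact: rcvg_pow58.
    pose k z := m%:R * h z + (z - a) * der h z.
    have hc := hol_cont hH (aa _ s0).
    have h'c : der h v @[v --> a] --> der h a.
      by apply: hol_cont (hol_der s0 hH) _; rewrite aa// divr_gt0.
    have kc : k z @[z --> a] --> k a.
      exact: (ccvgD (ccvgM (ccvg_cst m%:R a) hc)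
        (ccvgM (ccvgB (ccvg_id a) (ccvg_cst a a)) h'c)).
    apply: (dens_zero p0 hm ga0 h0 hc kc).
    by apply/nbhs_normcP; exists s => // z zs za; rewrite gE// dE.
  have [ga1|ga1] := eqVneq (g a) 1.
    have fa : f a = Some 1 by rewrite fS ?aa// ga1.
    have [az0 /nbhs_normcP[r1 r10 no1]] := hone fa; rewrite -az0.
    have g1H : hol (fun z => g z - 1) a r.
      by move=> u /fH[l fl]; exists (l - 0); exact: cderivB fl (cderiv_cst 1 u).
    have [[s s0 Hs]|[m [h [s [s0 hH h0 gE]]]]] := hol_factor r0 g1H.
      (* If f were identically 1 near a, the point a + d would be a second 1-point, against the
         isolation of a. *)
      pose d := Num.min r (Num.min r1 s) / 2.
      have d0 : 0 < d by rewrite divr_gt0// !lt_min r0 r10.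
      have : d < Num.min r (Num.min r1 s).
        by rewrite ltr_pdivrMr// ltr_pMr ?ltr1n// !lt_min r0 r10.
      rewrite !lt_min => /and3P[dr dr1 ds].
      have nd : normc (a + d%:C - a) = d by rewrite addrC addKr normc_real gtr0_norm.
      have ne : a + d%:C != a by rewrite -subr_eq0 -normc_gt0 nd.
      have := no1 (a + d%:C); rewrite nd => /(_ dr1 ne); case.
      rewrite fS ?nd//; congr Some; apply/eqP; rewrite -subr_eq0; apply/eqP.
      by apply: Hs; rewrite nd.
    have m0 : (0 < m)%N.
      rewrite lt0n; apply: contra_neqN h0 => /eqP m0.
      by have := gE a (aa _ s0); rewrite m0 expr0 mul1r ga1 subrr.
    have dE := der_power_factor s0 hH m0 gE.
    pose k z := m%:R * h z + (z - a) * der h z.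
    have hc := hol_cont hH (aa _ s0).
    have h'c : der h v @[v --> a] --> der h a.
      by apply: hol_cont (hol_der s0 hH) _; rewrite aa// divr_gt0.
    have kc : k z @[z --> a] --> k a.
      exact: (ccvgD (ccvgM (ccvg_cst m%:R a) hc)
        (ccvgM (ccvgB (ccvg_id a) (ccvg_cst a a)) h'c)).
    have nE : \forall z \near a, z != a ->
        g z - 1 = (z - a) ^+ m * h z /\ der g z = (z - a) ^+ m.-1 * k z.
      by apply/nbhs_normcP; exists s => // z zs za; rewrite gE// dE.
    exact: (@dens_one _ p m g (der g) h k a m0 ga1 h0 hc kc nE).
  apply: rcvgM; last exact: rcvg_pow58.
  have ga1' : g a - 1 != 0 by rewrite subr_eq0.
  exact: (@dens_cont _ p g (der g) a ga0 ga1' gc g'c).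
have [m [g [r [m0 r0 gH g0 fE]]]] := pole_factor pole.
have aa (s : R) : 0 < s -> normc (a - a) < s by rewrite subrr normc_zero.
have mp : pole_of_multiplicity f a m.
  split => //; exists g; split => //; first by apply/holomorphic_atP; exists r.
  by apply/dnbhs_normcP; exists r.
have hm := hpole m mp; have [fa _ _] := pole.
have fva : finval f a = 0 by rewrite /finval fa.
apply: rcvgM; last exact: rcvg_pow58.
pose k z := der g z * (z - a) - m%:R * g z.
have gc := hol_cont gH (aa _ r0).
have g'c : der g v @[v --> a] --> der g a.
  by apply: hol_cont (hol_der r0 gH) _; rewrite aa// divr_gt0.
have kc : k z @[z --> a] --> k a.
  exact: (ccvgB (ccvgM g'c (ccvgB (ccvg_id a) (ccvg_cst a a))) (ccvgM (ccvg_cst m%:R a) gc)).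
apply: (dens_pole p0 m0 hm fva g0 gc kc).
apply/nbhs_normcP; exists r => // z zr za; split; first by rewrite /finval fE.
have zm : (z - a) ^+ m != 0 by rewrite expf_neq0// subr_eq0.
have D := @cderivF _ g (fun v => (v - a) ^+ m) z _ _ zm (cderiv_der (gH z zr))
  (@cderivX _ (fun v => v - a) z _ m (cderiv_subC a z)).
have D' := @cderiv_near _ (fun v => g v / (v - a) ^+ m) (finval f) z _ _ D.
rewrite (derE (D' _)).
  have za0 : z - a != 0 by rewrite subr_eq0.
  have zn0 : (z - a) ^+ m.-1 != 0 by rewrite expf_neq0.
  have Em : (z - a) ^+ m = (z - a) ^+ m.-1 * (z - a) by rewrite -exprSr prednK.
  rewrite /k [(z - a) ^+ m.+1]exprSr Em; move: ((z - a) ^+ m.-1) (z - a) zn0 za0 => y x y0 x0.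
  by field; rewrite x0.
apply/nbhs_normcP; exists (Num.min (r - normc (z - a)) (normc (z - a))).
  by rewrite lt_min subr_gt0 zr normc_gt0 subr_eq0.
move=> v; rewrite lt_min => /andP[v1 v2]; rewrite /finval fE//.
  by have := normc_dist_tri z v a; lra.
by apply: contraTneq v2 => ->; rewrite normc_distC ltxx.
Qed.

End MeromorphicLocal.

(** * Uniform bounds on a disc *)

Section DiscBound.
Variable R : realType.
Local Notation C := (CC R).
Implicit Types (f : C -> sphere R) (a z w : C).

(* The two inequalities say that [dens] pulled back by [f] vanishes at the zeros
   and at the poles of [f]. They hold for p = 14 when zeros have multiplicity
   >= 2 and poles >= 3, and for p = 19 in the opposite case. *)
Record admissible f z0 (p : nat) (r : R) : Prop := Admissible {
  adm_mero : forall a, normc (a - z0) <= r -> regular_point f a \/ is_pole f a;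
  adm_zero : forall a m, normc (a - z0) <= r -> zero_of_multiplicity f a m ->
    (2 * p * m < 60 * m.-1)%N;
  adm_pole : forall a m, normc (a - z0) <= r -> pole_of_multiplicity f a m ->
    (60 * m.+1 + 2 * m < (2 * p + 56) * m)%N;
  adm_one : forall a, normc (a - z0) <= r -> f a = Some 1 -> a = z0 }.

(** [psi] is continuous on the closed disc and attains its maximum. If this is positive, no factor
    vanishes at the maximum point, which is then interior, distinct from z0 and regular for f, with
    f different from 0 and 1 and f' nonzero: Ahlfors' argument applies. *)
Lemma psi_bound f z0 (p : nat) (r : R) : (4 <= p <= 29)%N -> 0 < r -> admissible f z0 p r ->
  forall z, normc (z - z0) <= r ->
  psi (finval f) (der (finval f)) z0 p r z <= densB r.
Proof.
move=> hp r0 [H1 H2 H3 H4].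
have p0 : (0 < p)%N by lia.
set ps := psi (finval f) (der (finval f)) z0 p r.
pose K := [set w : C | normc (w - z0) <= r].
have psE z : ps z = Theta f z0 p z * (r ^+ 2 - normc (z - z0) ^+ 2) ^+ 2 by [].
have psc a : normc (a - z0) <= r -> ps z @[z --> a] --> ps a.
  move=> ar; have Tc : Theta f z0 p z @[z --> a] --> Theta f z0 p a.
    apply: Theta_cont => //; [exact: H1|by move=> m; exact: H2|by move=> m; exact: H3|].
    move=> fa; have az := H4 a ar fa; split => //.
    apply/nbhs_normcP; exists r => // z zr za fz; move/eqP: za; apply.
    by rewrite az; apply: H4 => //; rewrite -az ltW.
  have Nc : r ^+ 2 + -1 * normc (z - z0) ^+ 2 @[z --> a] --> r ^+ 2 + -1 * normc (a - z0) ^+ 2.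
    exact: (rcvgD (rcvg_cst a (r ^+ 2)) (rcvgM (rcvg_cst a (-1))
      (rcvgX 2 (rcvg_normc (ccvgB (ccvg_id a) (ccvg_cst z0 a)))))).
  have := rcvgM Tc (rcvgX 2 Nc); rewrite mulN1r.
  rewrite (_ : (fun z => _ * _) = ps)//.
  by apply/funext => z; rewrite mulN1r.
have K0 : K !=set0 by exists z0; rewrite /K /= subrr normc_zero ltW.
have cK : {within K, continuous ps}.
  apply: continuous_in_subspaceT => a; rewrite inE => aK; exact: psc.
have [z1] := compact_EVT_max K0 (@compact_closed_disc R z0 r) cK.
rewrite inE => z1r max1.
have max z : normc (z - z0) <= r -> ps z <= ps z1 by move=> zr; apply: max1; rewrite inE.
have B0 := densB_ge0 r.
suff B1 : ps z1 <= densB r.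
  by move=> z zr; apply: le_trans (max z zr) B1.
have [|pp] := lerP (ps z1) 0; first by move=> /le_trans; apply.
have nn : ps z1 != 0 by rewrite gt_eqF.
have fz0 : finval f z1 != 0.
  by apply: contraNneq nn => E; rewrite /ps /psi E dens0// !mul0r.
have fz1 : finval f z1 - 1 != 0.
  apply: contraNneq nn => E; rewrite /ps /psi /dens E normc_zero rt0 expr0n.
  by rewrite [false%:R]/= mulr0 invr0 !mulr0 !mul0r.
have dz : der (finval f) z1 != 0.
  apply: contraNneq nn => E; rewrite /ps /psi /dens E normc_zero expr0n.
  by rewrite [false%:R]/= !mul0r.
have zz : z1 - z0 != 0.
  apply: contraNneq nn => E; rewrite /ps /psi E normc_zero rt0 expr0n.
  by rewrite [false%:R]/= mulr0 mul0r.
have zr : normc (z1 - z0) < r.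
  rewrite lt_neqAle z1r andbT; apply: contraNneq nn => E.
  by rewrite /ps /psi E subrr expr0n mulr0.
have [reg|[fN _ _]] := H1 z1 z1r; last by rewrite /finval fN eqxx in fz0.
have [s s0 [fH _]] := regular_pointP reg.
have s2 : 0 < s / 2 by rewrite divr_gt0.
have s2s : s / 2 <= s by lra.
have ff' : cderiv (finval f) z1 (der (finval f) z1).
  by apply: cderiv_der; apply: fH; rewrite subrr normc_zero.
apply: (psi_max_bound hp s2 (hol_le s2s fH) (hol_der s0 fH) ff' fz0 fz1 dz zz zr).
by move=> z zr'; apply: max; exact: ltW.
Qed.

(** In 8 = 2 x 4, the 2 comes from [density_lower] and the 4 from (r^2 - |z - z0|^2)^2 >= r^4 / 4 on
    the half disc; the root undoes the square in [dens]. *)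
Definition lipc (r : R) : R := Num.sqrt (8 * densB r / r ^+ 4).

Lemma lipc_ge0 r : 0 <= lipc r. Proof. exact: sqrtr_ge0. Qed.

(** At a zero [dens] is 0 by convention and bounds nothing; there the multiplicity itself makes the
    derivative vanish. *)
Lemma der_zero f a : regular_point f a -> finval f a = 0 ->
  (forall m, zero_of_multiplicity f a m -> (1 < m)%N) -> der (finval f) a = 0.
Proof.
move=> reg fa hm; have [r r0 [fH fS]] := regular_pointP reg; set g := finval f in fa fH fS *.
have aa (s : R) : 0 < s -> normc (a - a) < s by rewrite subrr normc_zero.
have [[s s0 Hs]|[m [h [s [s0 hH h0 gE]]]]] := hol_factor r0 fH.
  apply: derE; apply: cderiv_near (cderiv_cst 0 a).
  by apply/nbhs_normcP; exists s => // z /Hs.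
have /hm m1 : zero_of_multiplicity f a m.
  split; first by rewrite fS ?aa// fa.
  exists h; split => //; first by apply/holomorphic_atP; exists s.
  apply/nbhs_normcP; exists (Num.min r s); first by rewrite lt_min r0.
  move=> z; rewrite lt_min => /andP[zr zs]; rewrite fS//; congr Some; exact: gE.
have gE' z : normc (z - a) < s -> g z - 0 = (z - a) ^+ m * h z by rewrite subr0; exact: gE.
rewrite (der_power_factor s0 hH (ltnW m1) gE' (aa _ s0)) subrr expr0n.
by case: m m1 {hm gE gE'} => [|[|m]] // _; rewrite mul0r.
Qed.

Lemma spherical_derivative_bound f z0 (p : nat) (r : R) z : (4 <= p <= 29)%N -> 0 < r ->
  admissible f z0 p r -> normc (z - z0) < r / 2 -> z != z0 -> regular_point f z ->
  normc (der (finval f) z) * rt (normc (z - z0)) ^+ 29 <= lipc r * (1 + normc (finval f z) ^+ 2).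
Proof.
move=> hp r0 adm zr zz reg; have zr' : normc (z - z0) <= r by lra.
have r4 : 0 < r ^+ 4 by rewrite exprn_gt0.
have [g0|g0] := eqVneq (finval f z) 0.
  rewrite der_zero// ?normc_zero ?mul0r ?mulr_ge0 ?lipc_ge0// ?addr_ge0 ?sqr_ge0//.
  by move=> m /(adm_zero adm zr'); case: m => [|[|m]]; rewrite ?muln0.
have g1 : finval f z - 1 != 0.
  rewrite subr_eq0; apply: contraNneq zz => E; apply/eqP/(adm_one adm) => //.
  have [s s0 [_ fS]] := regular_pointP reg.
  by rewrite fS ?E// subrr normc_zero.
have := psi_bound hp r0 adm zr'; rewrite /psi /dens /lipc.
have := densB_ge0 r; move: (densB r) => B B0; set A := normc (finval f z); set Y := rt (normc (finval f z - 1)).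
have A0 : 0 < A by rewrite normc_gt0.
have X0 : 0 < rt A by rewrite rt_gt0 gt_eqF.
have Y0 : 0 < Y by rewrite rt_gt0 normc_eq0.
have BA : normc (finval f z - 1) <= A + 1 by have := normc_leB (finval f z) 1; rewrite normc_one.
have p30 : (p <= 30)%N by case/andP: hp => _ /leq_trans; apply.
have lo := density_lower p30 (ltW X0) (ltW Y0) (rtK (ltW A0)) (rtK (normc_ge0 _)) BA.
have N0 : r ^+ 2 / 2 <= r ^+ 2 - normc (z - z0) ^+ 2.
  have : normc (z - z0) ^+ 2 <= (r / 2) ^+ 2.
    by rewrite lerXn2r ?nnegrE ?normc_ge0//; [rewrite divr_ge0// ltW|exact: ltW].
  have -> : (r / 2) ^+ 2 = r ^+ 2 / 4 by field.
  have := sqr_ge0 r; lra.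
have N1 : r ^+ 4 / 4 <= (r ^+ 2 - normc (z - z0) ^+ 2) ^+ 2.
  have -> : r ^+ 4 / 4 = (r ^+ 2 / 2) ^+ 2 by field.
  rewrite lerXn2r ?nnegrE ?divr_ge0 ?sqr_ge0//.
  by apply: le_trans N0; rewrite divr_ge0// sqr_ge0.
set N := (_ - _) ^+ 2 in N1 *; set d := normc (der _ z); set Z := rt (normc (z - z0)).
have Z0 : 0 <= Z by exact: rt_ge0.
have d0 : 0 <= d by exact: normc_ge0.
have W0 : 0 < 1 + A ^+ 2 by rewrite ltr_wpDr ?sqr_ge0.
have den : 0 < rt A ^+ (2 * p) * Y ^+ 56 by rewrite mulr_gt0// exprn_gt0.
move: lo den; set Q := rt A ^+ _ * _ => lo den.
have Gl : (2 * (1 + A ^+ 2) ^+ 2)^-1 <= (1 + rt A) * (1 + Y) / Q.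
  apply: (@le_trans _ _ Q^-1); first by rewrite lef_pV2 ?posrE// mulr_gt0// exprn_gt0.
  rewrite ler_peMl ?invr_ge0 ?(ltW den)//.
  apply: (@le_trans _ _ (1 * 1)); first by rewrite mulr1.
  by apply: ler_pM => //; rewrite lerDl ltW.
move: Gl; set G := _ / Q => Gl; set Z58 := Z ^+ 58 => psb.
have Z58E : Z58 = (Z ^+ 29) ^+ 2 by rewrite /Z58 -exprM.
have Z29 : 0 <= Z ^+ 29 by rewrite exprn_ge0.
move: (Z ^+ 29) Z29 Z58E => y Z29 Z58E.
rewrite -(@ler_pXn2r _ 2) ?nnegrE ?(mulr_ge0 d0 Z29) ?(mulr_ge0 (sqrtr_ge0 _) (ltW W0))//.
rewrite (exprMn 2 d y) (exprMn 2 (Num.sqrt _)) sqr_sqrtr; last by apply: divr_ge0; [apply: mulr_ge0|exact: ltW].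
rewrite -Z58E.
have Z580 : 0 <= Z58 by rewrite exprn_ge0.
have d20 : 0 <= d ^+ 2 by rewrite sqr_ge0.
have W2 : 0 < (1 + A ^+ 2) ^+ 2 by rewrite exprn_gt0.
have step : d ^+ 2 * (2 * (1 + A ^+ 2) ^+ 2)^-1 * Z58 * (r ^+ 4 / 4) <= B.
  apply: le_trans psb; apply: ler_pM => //.
  - by rewrite !mulr_ge0// invr_ge0 mulr_ge0// ltW.
  - by rewrite divr_ge0// ltW.
  - by rewrite ler_wpM2r// ler_wpM2l.
have E : d ^+ 2 * Z58 = d ^+ 2 * (2 * (1 + A ^+ 2) ^+ 2)^-1 * Z58 * (r ^+ 4 / 4) *
    (8 * (1 + A ^+ 2) ^+ 2 / r ^+ 4).
  move: (r ^+ 4) (Z58) ((1 + A ^+ 2) ^+ 2) r4 W2 => x' y' w x0 w0.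
  by field; rewrite !gt_eqF.
have -> : 8 * B / r ^+ 4 * (1 + A ^+ 2) ^+ 2 = B * (8 * (1 + A ^+ 2) ^+ 2 / r ^+ 4).
  by move: (r ^+ 4) ((1 + A ^+ 2) ^+ 2) (B) => x' y' w; ring.
by rewrite E ler_wpM2r// divr_ge0 ?(ltW r4)// mulr_ge0// ltW.
Qed.

End DiscBound.

(** * The chordal metric and equicontinuity *)

Section ChordalMetric.
Variable R : realType.
Local Notation C := (CC R).
Implicit Types (p q : sphere R) (f : C -> sphere R) (a z w : C).

(** Homogeneous coordinates: the chordal distance becomes a determinant divided by two norms, with
    no case distinction at infinity. *)
Definition hom p : C * C := if p is Some z then (z, 1) else (1, 0).
Definition hnorm p : R := Num.sqrt (normc (hom p).2 ^+ 2 + normc (hom p).1 ^+ 2).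
Definition hdet p q : C := (hom p).1 * (hom q).2 - (hom p).2 * (hom q).1.

Lemma hnormS z : hnorm (Some z) = Num.sqrt (1 + normc z ^+ 2).
Proof.
rewrite /hnorm (_ : (hom (Some z)).2 = 1)// (_ : (hom (Some z)).1 = z)//.
by rewrite normc_one expr1n.
Qed.

Lemma hnormN : hnorm None = 1.
Proof.
rewrite /hnorm (_ : (hom None).2 = 0)// (_ : (hom None).1 = 1)//.
by rewrite normc_one normc_zero expr1n expr0n add0r sqrtr1.
Qed.

Lemma hnorm_gt0 p : 0 < hnorm p.
Proof.
case: p => [z|]; last by rewrite hnormN.
by rewrite hnormS sqrtr_gt0 ltr_wpDr// sqr_ge0.
Qed.

Lemma hnorm_sqr p : hnorm p ^+ 2 = normc (hom p).2 ^+ 2 + normc (hom p).1 ^+ 2.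
Proof. by rewrite sqr_sqrtr// addr_ge0 ?sqr_ge0. Qed.

Lemma chordalE p q : chordal_dist p q = normc (hdet p q) / (hnorm p * hnorm q).
Proof.
case: p q => [z|] [w|]; rewrite ?hnormS ?hnormN /hdet /chordal_dist /hom.
- by rewrite mulr1 mul1r.
- by rewrite mulr0 mul1r sub0r normc_opp normc_one mulr1 div1r.
- by rewrite mulr1 mul0r subr0 normc_one !mul1r.
- by rewrite mulr0 mul0r subr0 normc_zero mul0r.
Qed.

Lemma chordal_ge0 p q : 0 <= chordal_dist p q.
Proof. by rewrite chordalE divr_ge0 ?normc_ge0// mulr_ge0// ltW// hnorm_gt0. Qed.

Lemma chordalC p q : chordal_dist p q = chordal_dist q p.
Proof.
rewrite !chordalE (mulrC (hnorm q)); congr (_ / _).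
by rewrite -normc_opp /hdet; congr normc; ring.
Qed.

Lemma chordalxx p : chordal_dist p p = 0.
Proof.
by rewrite chordalE /hdet (mulrC (hom p).2) subrr normc_zero mul0r.
Qed.

Lemma normc_conj (x : C) : normc (conjc x : C) = normc x.
Proof. by case: x => x y /=; rewrite sqrrN. Qed.

Lemma mul_conj (x : C) : x * conjc x = (normc x ^+ 2)%:C.
Proof.
rewrite normc_sqr; case: x => x y; apply/eqP; rewrite eq_complex /=.
by apply/andP; split; apply/eqP; ring.
Qed.

(* With [x, y] the determinant and <x, y> the Hermitian product on C ^ 2,
   [p, r] <q, q> = [p, q] <r, q> + [q, r] <p, q>; then Cauchy-Schwarz. *)
Lemma chordal_tri q p r : chordal_dist p r <= chordal_dist p q + chordal_dist q r.
Proof.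
rewrite !chordalE; have p0 := hnorm_gt0 p; have q0 := hnorm_gt0 q; have r0 := hnorm_gt0 r.
pose ip s t : C := (hom s).1 * conjc (hom t).1 + (hom s).2 * conjc (hom t).2.
have ip_le s t : normc (ip s t) <= hnorm s * hnorm t.
  apply: (le_trans (normc_leD _ _)); rewrite !normc_mul !normc_conj.
  have s0 := hnorm_gt0 s; have t0 := hnorm_gt0 t.
  rewrite -(@ler_pXn2r _ 2) ?nnegrE ?addr_ge0 ?mulr_ge0 ?normc_ge0 ?(ltW s0) ?(ltW t0)//.
  rewrite (exprMn 2 (hnorm s)) !hnorm_sqr.
  move: (normc (hom s).1) (normc (hom s).2) (normc (hom t).1) (normc (hom t).2).
  move=> x1 x2 y1 y2; rewrite -subr_ge0 (_ : _ - _ = (x1 * y2 - x2 * y1) ^+ 2) ?sqr_ge0//.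
  by ring.
have E : hdet p r * (hnorm q ^+ 2)%:C = hdet p q * ip r q + hdet q r * ip p q.
  have -> : (hnorm q ^+ 2)%:C = (hom q).2 * conjc (hom q).2 + (hom q).1 * conjc (hom q).1 :> C.
    by rewrite hnorm_sqr !mul_conj -rmorphD.
  rewrite /hdet /ip; move: (conjc (hom q).1) (conjc (hom q).2) => X Y; ring.
have H : normc (hdet p r) * hnorm q ^+ 2 <=
    normc (hdet p q) * (hnorm r * hnorm q) + normc (hdet q r) * (hnorm p * hnorm q).
  have <- : normc (hdet p r * (hnorm q ^+ 2)%:C) = normc (hdet p r) * hnorm q ^+ 2.
    by rewrite normc_mul normc_real ger0_norm// sqr_ge0.
  rewrite E; apply: (le_trans (normc_leD _ _)); rewrite !normc_mul.
  by apply: lerD; rewrite ler_wpM2l ?normc_ge0.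
have d0 : 0 < hnorm p * hnorm r * hnorm q ^+ 2 by rewrite !mulr_gt0.
rewrite -(ler_pM2r d0).
have -> : normc (hdet p r) / (hnorm p * hnorm r) * (hnorm p * hnorm r * hnorm q ^+ 2) =
    normc (hdet p r) * hnorm q ^+ 2 by field; rewrite !gt_eqF.
apply: le_trans H _; rewrite le_eqVlt; apply/orP; left; apply/eqP.
by field; rewrite !gt_eqF.
Qed.

Lemma rcvg_sqrt (u : C -> R) a (x : R) : u z @[z --> a] --> x ->
  Num.sqrt (u z) @[z --> a] --> Num.sqrt x.
Proof.
by move=> hu; apply: (@cvg_comp _ _ _ u (@Num.sqrt R) (nbhs a) (nbhs x) _ hu (@sqrt_continuous R x)).
Qed.

(** The constant is the spherical derivative |f'| / (1 + |f|^2) at a, enlarged by e. *)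
Lemma chordal_lip_regular f a (e : R) : 0 < e -> regular_point f a ->
  exists2 d : R, 0 < d & forall z, normc (z - a) < d ->
  chordal_dist (f z) (f a) <=
    (normc (der (finval f) a) / (1 + normc (finval f a) ^+ 2) + e) * normc (z - a).
Proof.
move=> e0 reg; have [r r0 [fH fS]] := regular_pointP reg; set g := finval f in fH fS *.
have aa : normc (a - a) < r by rewrite subrr normc_zero.
have ga := cderiv_der (fH a aa); have gc := cderiv_cont ga.
have [phi phic /nbhs_normcP[r1 r10 gphi]] := ga.
pose s z := Num.sqrt (1 + normc (g z) ^+ 2).
have s0 z : 0 < s z by rewrite sqrtr_gt0 ltr_wpDr// sqr_ge0.
have sc : s z @[z --> a] --> s a.
  exact: (rcvg_sqrt (rcvgD (rcvg_cst a 1) (rcvgX 2 (rcvg_normc gc)))).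
have ss : s a * s a != 0 by rewrite mulf_neq0// gt_eqF.
pose k z := normc (phi z) * (s z * s a)^-1.
have kc : k z @[z --> a] --> normc (der g a) * (s a * s a)^-1.
  exact: (rcvgM (rcvg_normc phic) (rcvgV ss (rcvgM sc (rcvg_cst a (s a))))).
have -> : normc (der g a) / (1 + normc (g a) ^+ 2) = normc (der g a) * (s a * s a)^-1.
  by rewrite -expr2 sqr_sqrtr// addr_ge0// sqr_ge0.
have /rcvgP/(_ _ e0)[d d0 Hd] := kc.
exists (Num.min r (Num.min r1 d)); first by rewrite !lt_min r0 r10.
move=> z; rewrite !lt_min => /and3P[zr zr1 zd].
have -> : chordal_dist (f z) (f a) = k z * normc (z - a).
  by rewrite !fS//= gphi// normc_mul /k mulrAC.
rewrite ler_wpM2r ?normc_ge0//; have := ler_norm (k z - normc (der g a) * (s a * s a)^-1).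
by have := Hd z zd; lra.
Qed.

(** The chordal distance to infinity is at most 1 / |f|, of order |z - a|^m, so that m > 1 makes the
    spherical derivative vanish at the pole. *)
Lemma chordal_lip_pole f a (e : R) : 0 < e -> is_pole f a ->
  (forall m, pole_of_multiplicity f a m -> (1 < m)%N) ->
  exists2 d : R, 0 < d & forall z, normc (z - a) < d ->
  chordal_dist (f z) (f a) <= e * normc (z - a).
Proof.
move=> e0 pole hm; have [m [g [r [m0 r0 gH g0 fE]]]] := pole_factor pole.
have /hm m1 : pole_of_multiplicity f a m.
  split => //; exists g; split => //; first by apply/holomorphic_atP; exists r.
  by apply/dnbhs_normcP; exists r.
have [fa _ _] := pole.
have aa : normc (a - a) < r by rewrite subrr normc_zero.
have gc := hol_cont gH aa; have /nbhs_normcP[r1 r10 gn] := near_neq0 gc g0.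
have zc : normc (z - a) @[z --> a] --> (0 : R).
  by have := rcvg_normc (ccvgB (ccvg_id a) (ccvg_cst a a)); rewrite subrr normc_zero.
have n0 : normc (g a) != 0 by rewrite normc_eq0.
have := rcvgM (rcvgX m.-1 zc) (rcvgV n0 (rcvg_normc gc)).
rewrite expr0n -[m.-1 == 0%N]negbK -lt0n -ltnS prednK// m1 mul0r => /rcvgP/(_ _ e0)[d d0 Hd].
exists (Num.min r (Num.min r1 d)); first by rewrite !lt_min r0 r10.
move=> z; rewrite !lt_min => /and3P[zr zr1 zd].
have [->|za] := eqVneq z a; first by rewrite chordalxx subrr normc_zero mulr0.
have := Hd z zd; rewrite subr0 fE// fa => /(le_lt_trans (ler_norm _)) H.
have z0 : 0 < normc (z - a) by rewrite normc_gt0 subr_eq0.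
have gz : 0 < normc (g z) by rewrite normc_gt0 gn.
have zm : 0 < normc (z - a) ^+ m by rewrite exprn_gt0.
apply: (@le_trans _ _ (normc (z - a) ^+ m / normc (g z))).
  have -> : normc (z - a) ^+ m / normc (g z) = (normc (g z) / normc (z - a) ^+ m)^-1.
    by rewrite invf_div.
  rewrite /= lef_pV2 ?posrE ?sqrtr_gt0 ?divr_gt0//; last by rewrite ltr_wpDr// sqr_ge0.
  rewrite normc_div normc_exp -[leLHS]ger0_norm ?divr_ge0 ?(ltW gz) ?(ltW zm)// -sqrtr_sqr.
  by rewrite ler_wsqrtr// lerDr.
rewrite -(prednK m0) exprSr mulrAC ler_wpM2r ?(ltW z0)//; exact: ltW.
Qed.

(** Replaces the integration of the spherical derivative along a path. The supremum of the
    parameters up to which the bound holds satisfies it too, and could be increased if it were below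
    b. *)
Lemma path_lipschitz (phi : R -> sphere R) (M a b : R) : a <= b ->
  (forall t, a <= t <= b -> exists2 d : R, 0 < d & forall s, a <= s <= b -> `|s - t| < d ->
     chordal_dist (phi s) (phi t) <= M * `|s - t|) ->
  chordal_dist (phi a) (phi b) <= M * (b - a).
Proof.
move=> ab H.
pose S := [set t | a <= t <= b /\ chordal_dist (phi a) (phi t) <= M * (t - a)].
have Sa : S a by split; [rewrite lexx|rewrite chordalxx subrr mulr0].
have Sub : has_sup S by split; [exists a|exists b => t [/andP[]]].
set c := sup S.
have cb : c <= b by apply: ge_sup; [exists a|move=> t [/andP[]]].
have ac : a <= c by apply: ub_le_sup => //; exact: Sub.2.
have cab : a <= c <= b by rewrite ac.
have [d d0 Hd] := H c cab.
have Sc : S c.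
  have [t [/andP[at_ tb] Mt] ct] := sup_adherent d0 Sub.
  have tc : t <= c by apply: ub_le_sup; [exact: Sub.2|split => //; rewrite at_].
  split => //; apply: (le_trans (chordal_tri (phi t) _ _)).
  have tab : a <= t <= b by rewrite at_.
  have tcd : `|t - c| < d by rewrite distrC ger0_norm ?subr_ge0//; rewrite -/c in ct; lra.
  have := Hd t tab tcd; rewrite distrC ger0_norm ?subr_ge0//; lra.
have [|cb'] := leP b c; first by move=> bc; have -> : b = c by [apply/eqP; rewrite eq_le bc]; exact: Sc.2.
pose s := Num.min b (c + d / 2).
have cs : c < s by rewrite lt_min cb' ltrDl divr_gt0.
have sb : s <= b by rewrite ge_min lexx.
have sab : a <= s <= b by rewrite sb (le_trans ac (ltW cs)).
have scd : `|s - c| < d.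
  rewrite gtr0_norm ?subr_gt0// ltrBlDl (@le_lt_trans _ _ (c + d / 2))//.
    by rewrite ge_min lexx orbT.
  by rewrite ltrD2l; lra.
have Ss : S s.
  split => //; apply: (le_trans (chordal_tri (phi c) _ _)); rewrite (chordalC (phi c)).
  have := Hd s sab scd; rewrite gtr0_norm ?subr_gt0//; have := Sc.2; lra.
by have := ub_le_sup Sub.2 Ss; rewrite -/c leNgt cs.
Qed.

Lemma pow_lip (n : nat) (t e : R) : 0 <= t -> 0 < e -> exists2 d : R, 0 < d &
  forall s, `|s - t| < d -> `|s ^+ n - t ^+ n| <= (n%:R * t ^+ n.-1 + e) * `|s - t|.
Proof.
move=> t0 e0; have D : is_derive t 1 (fun s : R => s ^+ n) (n%:R * t ^+ n.-1).
  have := is_deriveX n (is_derive_id t (1 : R)); rewrite /GRing.scale /= mulr1.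
  rewrite (_ : (id : R -> R) ^+ n = fun s => s ^+ n)//.
  by apply/funext => s; rewrite fctE.
have [d d0 Hd] := is_derive_small D e0; exists d => // s sd.
have := Hd _ sd; rewrite subrKC => h.
rewrite mulrDl; apply: le_trans (lerD (lexx _) h).
have -> : n%:R * t ^+ n.-1 * `|s - t| = `|n%:R * t ^+ n.-1 * (s - t)|.
  by rewrite normrM (ger0_norm (mulr_ge0 _ _))// exprn_ge0.
by apply: le_trans (ler_normD _ _); rewrite subrKC.
Qed.

End ChordalMetric.

(** * The Hoelder estimate along radial paths *)

Section Equicontinuity.
Variable R : realType.
Local Notation C := (CC R).
Implicit Types (f : C -> sphere R) (a z w : C).

Lemma adm_pole_gt1 f z0 (p : nat) (r : R) a m : (p <= 29)%N -> admissible f z0 p r ->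
  normc (a - z0) <= r -> pole_of_multiplicity f a m -> (1 < m)%N.
Proof. by move=> hp adm ar /(adm_pole adm ar); case: m => [|[|m]]; lia. Qed.

Lemma chordal_lip_admissible f z0 (p : nat) (r t : R) u : (4 <= p <= 29)%N -> 0 < r ->
  admissible f z0 p r -> 0 < t -> normc (u - z0) = t ^+ 30 -> t ^+ 30 < r / 2 ->
  forall e : R, 0 < e -> exists2 d : R, 0 < d & forall v, normc (v - u) < d ->
  chordal_dist (f v) (f u) <= (lipc r / t ^+ 29 + e) * normc (v - u).
Proof.
move=> hp r0 adm t0 ut tr e e0; have [p4 p29] := andP hp.
have ur : normc (u - z0) <= r by rewrite ut; lra.
have tn : 0 < t ^+ 29 by rewrite exprn_gt0.
have [reg|pole] := adm_mero adm ur.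
  have [d d0 Hd] := chordal_lip_regular e0 reg; exists d => // v /Hd.
  move/le_trans; apply; rewrite ler_wpM2r ?normc_ge0// lerD2r.
  have uz : u != z0 by rewrite -subr_eq0 -normc_gt0 ut exprn_gt0.
  have ur2 : normc (u - z0) < r / 2 by rewrite ut.
  have := spherical_derivative_bound hp r0 adm ur2 uz reg.
  rewrite ut rt_exprK ?(ltW t0)// => H.
  by rewrite ler_pdivrMr ?ltr_wpDr ?sqr_ge0// mulrAC ler_pdivlMr.
have [d d0 Hd] := chordal_lip_pole e0 pole (fun m => @adm_pole_gt1 f z0 p r u m p29 adm ur).
exists d => // v /Hd; move/le_trans; apply; rewrite ler_wpM2r ?normc_ge0//.
by rewrite lerDr divr_ge0 ?lipc_ge0// ltW.
Qed.

(* Along the path t |-> z0 + t ^ 30 e the spherical derivative of [f], at most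
   lipc r / t ^ 29, is compensated by the speed 30 t ^ 29. *)
Theorem chordal_hoelder f z0 (p : nat) (r : R) z : (4 <= p <= 29)%N -> 0 < r ->
  admissible f z0 p r -> normc (z - z0) < r / 2 ->
  chordal_dist (f z) (f z0) <= 30 * lipc r * rt (normc (z - z0)).
Proof.
move=> hp r0 adm zr; have [p4 p29] := andP hp.
have [->|zz] := eqVneq z z0; first by rewrite chordalxx subrr normc_zero rt0 mulr0.
have L0 := lipc_ge0 r; set L := lipc r in L0 *.
set rho := normc (z - z0) in zr *; have rho0 : 0 < rho by rewrite normc_gt0 subr_eq0.
pose e : C := (z - z0) / rho%:C; set T := rt rho.
have T0 : 0 < T by rewrite rt_gt0 gt_eqF.
have T30 : T ^+ 30 = rho by rewrite rtK// ltW.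
have rhoC : rho%:C != 0 :> C by rewrite -normc_gt0 normc_real gtr0_norm.
have ne : normc e = 1 by rewrite /e normc_div normc_real gtr0_norm// -/rho divff// gt_eqF.
pose ga (t : R) : C := z0 + (t ^+ 30)%:C * e.
have gaD s t : normc (ga s - ga t) = `|s ^+ 30 - t ^+ 30|.
  by rewrite /ga opprD addrACA subrr add0r -mulrBl -rmorphB normc_mul ne mulr1 normc_real.
have ga0 : ga 0 = z0 by rewrite /ga expr0n mul0r addr0.
have gaT : ga T = z by rewrite /ga T30 /e mulrC mulfVK// addrC subrK.
have gan t : 0 <= t -> normc (ga t - z0) = t ^+ 30.
  by move=> t0; have := gaD t 0; rewrite ga0 expr0n subr0 (ger0_norm (exprn_ge0 30 t0)).
(* The path starts at a > 0 because lipc r / t^29 is unbounded near t = 0. The gap is closed by a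
   local Lipschitz constant K of f at z0: it depends on f, but its contribution K a^30 tends to 0
   with a. *)
have step1 (eta a : R) : 0 < eta -> 0 < a -> a <= T ->
    chordal_dist (f (ga a)) (f z) <= (30 * L + eta) * (T - a).
  move=> eta0 a0 aT; rewrite -gaT; apply: (@path_lipschitz _ (fun t => f (ga t))) => //.
  move=> t /andP[at_ tT]; have t0 := lt_le_trans a0 at_.
  have tr : t ^+ 30 < r / 2.
    by apply: le_lt_trans zr; rewrite -T30 lerXn2r// nnegrE ltW.
  have tn : 0 < t ^+ 29 by rewrite exprn_gt0.
  have L1 : 0 < L + 1 by rewrite ltr_wpDl.
  (* e1 and e2 are chosen to have (L / t^29 + e1) (30 t^29 + e2) <= 30 L + eta. *)
  pose e2 := eta * t ^+ 29 / (2 * (L + 1)).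
  have e20 : 0 < e2 by rewrite divr_gt0 ?mulr_gt0.
  pose q := 30 * t ^+ 29 + e2; have q0 : 0 < q by rewrite addr_gt0// mulr_gt0.
  pose e1 := eta / (2 * q); have e10 : 0 < e1 by rewrite divr_gt0// mulr_gt0.
  have [d1 d10 H1] := chordal_lip_admissible hp r0 adm t0 (gan t (ltW t0)) tr e10.
  have [d2 d20 H2] := pow_lip 30 (ltW t0) e20.
  exists (Num.min d2 (d1 / q)); first by rewrite lt_min d20 (divr_gt0 d10 q0).
  move=> s _; rewrite lt_min => /andP[sd2 sd1].
  have H : `|s ^+ 30 - t ^+ 30| <= q * `|s - t| := H2 s sd2.
  have : normc (ga s - ga t) < d1.
    by rewrite gaD; apply: le_lt_trans H _; rewrite mulrC -ltr_pdivlMr.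
  move=> /H1; rewrite gaD => H3.
  have c0 : 0 <= L / t ^+ 29 + e1 := addr_ge0 (divr_ge0 L0 (ltW tn)) (ltW e10).
  apply: le_trans H3 _; apply: le_trans (ler_wpM2l c0 H) _.
  rewrite mulrA ler_wpM2r//.
  have -> : (L / t ^+ 29 + e1) * q = 30 * L + (eta * (L / (2 * (L + 1))) + eta / 2).
    have E1 : e1 * q = eta / 2 by rewrite /e1; field; rewrite gt_eqF.
    have E2 : L / t ^+ 29 * q = 30 * L + eta * (L / (2 * (L + 1))).
      rewrite /q /e2; have y0 := lt0r_neq0 tn; have l0 := lt0r_neq0 L1.
      by move: (t ^+ 29) y0 => y y0; field; rewrite ?y0 ?l0.
    by rewrite mulrDl E1 E2 addrA.
  rewrite lerD2l.
  have : L / (2 * (L + 1)) <= 1 / 2.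
    by rewrite ler_pdivrMr ?mulr_gt0//; lra.
  move/(ler_wpM2l (ltW eta0)); lra.
have [K [K0 [d d0 Hd]]] : exists K : R, 0 <= K /\ exists2 d : R, 0 < d & forall v, normc (v - z0) < d ->
    chordal_dist (f v) (f z0) <= K * normc (v - z0).
  have zz0 : normc (z0 - z0) <= r by rewrite subrr normc_zero ltW.
  have [reg|pole] := adm_mero adm zz0.
    have [d d0 Hd] := chordal_lip_regular ltr01 reg; eexists; split; last by exists d; [|exact: Hd].
    by rewrite addr_ge0// divr_ge0 ?normc_ge0// addr_ge0// sqr_ge0.
  have [d d0 Hd] := chordal_lip_pole ltr01 pole (fun m => @adm_pole_gt1 f z0 p r z0 m p29 adm zz0).
  by exists 1; split => //; exists d.
apply/ler_addgt0Pl => eps eps0.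
(* The path costs an extra eta T and the initial gap at most eta. *)
pose eta := eps / (T + 2).
have T2 : 0 < T + 2 by rewrite addr_gt0.
have eta0 : 0 < eta by rewrite divr_gt0.
pose a := Num.min T (Num.min 1 (Num.min (d / 2) (eta / (K + 1)))).
have K1 : 0 < K + 1 by rewrite ltr_wpDl.
have a0 : 0 < a by rewrite !lt_min T0 ltr01 !divr_gt0.
have aT : a <= T by rewrite ge_min lexx.
have a1 : a <= 1 by rewrite !ge_min lexx orbT.
have ad : a <= d / 2 by rewrite !ge_min lexx !orbT.
have ae : a <= eta / (K + 1) by rewrite !ge_min lexx !orbT.
have a30 : a ^+ 30 <= a by rewrite -[leRHS]expr1 ler_wiXn2l// ltW.
have : normc (ga a - z0) < d by rewrite gan ?(ltW a0)//; lra.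
move=> /Hd; rewrite gan ?(ltW a0)// => H1.
have H2 : K * a ^+ 30 <= eta.
  apply: le_trans (ler_wpM2l K0 (le_trans a30 ae)) _.
  by rewrite mulrA mulrAC ler_piMl ?(ltW eta0)// ler_pdivrMr// mul1r lerDl.
have := step1 eta a eta0 a0 aT; have := chordal_tri (f (ga a)) (f z) (f z0).
rewrite (chordalC (f z) (f (ga a))) => H3 H4.
have H5 : (30 * L + eta) * (T - a) <= (30 * L + eta) * T.
  apply: ler_wpM2l; last by lra.
  by apply: addr_ge0; [rewrite mulr_ge0|exact: ltW].
have E : eps = eta * T + eta * 2 by rewrite /eta; field; rewrite gt_eqF.
have : (30 * L + eta) * T = 30 * L * T + eta * T by ring.
rewrite E; lra.
Qed.

End Equicontinuity.

(** * Equicontinuity of the family at each point *)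

Section FamilyEquicontinuity.
Variable R : realType.
Local Notation C := (CC R).
Implicit Types (f g : C -> sphere R) (a z w : C) (D : set C) (F : set (C -> sphere R)).

Lemma isolated_one f z0 : regular_point f z0 \/ is_pole f z0 ->
  exists2 r : R, 0 < r & (forall z, normc (z - z0) < r -> f z = Some 1) \/
    (forall z, normc (z - z0) < r -> z != z0 -> f z <> Some 1).
Proof.
move=> [reg|[_ _ finf]].
  have [r r0 [fH fS]] := regular_pointP reg.
  have gH : hol (fun z => finval f z - 1) z0 r.
    by move=> u /fH[l fl]; exists (l - 0); exact: cderivB fl (cderiv_cst 1 u).
  have [[s s0 Hs]|[m [h [s [s0 hH h0 gE]]]]] := hol_factor r0 gH.
    exists (Num.min r s); first by rewrite lt_min r0.
    left=> z; rewrite lt_min => /andP[zr zs]; rewrite fS//; congr Some.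
    by apply/eqP; rewrite -subr_eq0 Hs.
  have zz : normc (z0 - z0) < s by rewrite subrr normc_zero.
  have /nbhs_normcP[s1 s10 hn] := near_neq0 (hol_cont hH zz) h0.
  exists (Num.min r (Num.min s s1)); first by rewrite !lt_min r0 s0.
  right=> z; rewrite !lt_min => /and3P[zr zs zs1] za; rewrite fS// => -[E].
  have /eqP := gE z zs; rewrite E subrr eq_sym mulf_eq0 expf_eq0 subr_eq0 (negbTE za) andbF.
  by rewrite (negbTE (hn z zs1)).
move/cvgryPgt : finf => /(_ 1) /dnbhs_normcP[r r0 H]; exists r => //; right=> z zr za fz.
have := H z zr za; rewrite (_ : finval f z = 1); last by rewrite /finval fz.
by rewrite normc_one ltxx.
Qed.

(** u is a reference member: sharing transfers its 1-points to every f in F, so the radius of the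
    disc is determined by u and D alone. *)
Lemma family_equicont D F (u : C -> sphere R) z0 :
  domain D -> (forall f, F f -> meromorphic D f) ->
  ((forall f, F f -> poles_multiplicity_ge D f 3 /\ zeros_multiplicity_ge D f 2) \/
   (forall f, F f -> poles_multiplicity_ge D f 2 /\ zeros_multiplicity_ge D f 3)) ->
  (forall f g, F f -> F g -> share_one_IM D f g) -> F u -> D z0 ->
  forall e : R, 0 < e -> exists2 d : R, 0 < d & forall f z, F f -> normc (z - z0) < d ->
    D z /\ chordal_dist (f z) (f z0) < e.
Proof.
move=> [_ oD _] hF hmult hshare Fu Dz0 e e0.
have /nbhs_normcP[r1 r10 rD] : nbhs z0 D by move: oD; rewrite openE => /(_ _ Dz0).
have share f z : F f -> D z -> (u z = Some 1) <-> (f z = Some 1).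
  move=> Ff Dz; have E := hshare _ _ Fu Ff; split => H.
    have : [set z | D z /\ u z = Some 1] z by [].
    by rewrite E => -[].
  have : [set z | D z /\ f z = Some 1] z by [].
  by rewrite -E => -[].
have [r2 r20 [all1|no1]] := isolated_one (hF _ Fu _ Dz0).
  exists (Num.min r1 r2); first by rewrite lt_min r10.
  move=> f z Ff; rewrite lt_min => /andP[z1 z2]; have Dz := rD z z1; split => //.
  rewrite (iffLR (share f z Ff Dz) (all1 z z2)) (iffLR (share f z0 Ff Dz0)) ?chordalxx//.
  by apply: all1; rewrite subrr normc_zero.
pose r := Num.min r1 r2 / 2; have r0 : 0 < r by rewrite divr_gt0// lt_min r10.
have : r < Num.min r1 r2 by rewrite ltr_pdivrMr// ltr_pMr ?ltr1n// lt_min r10.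
rewrite lt_min => /andP[rr1 rr2].
have [p hp adm] : exists2 p : nat, (4 <= p <= 29)%N & forall f, F f -> admissible f z0 p r.
  have inD a : normc (a - z0) <= r -> D a by move=> ar; apply: rD; exact: le_lt_trans ar rr1.
  have one f a : F f -> normc (a - z0) <= r -> f a = Some 1 -> a = z0.
    move=> Ff ar fa; apply/eqP; apply: contrapT => /negP az.
    apply: (no1 a _ az); first exact: le_lt_trans ar rr2.
    by apply/(share f a Ff (inD a ar)).
  (* For p = 14, 28 m < 60 (m - 1) when m >= 2 and 60 (m + 1) + 2 m < 84 m when m >= 3. For p = 19,
     38 m < 60 (m - 1) when m >= 3 and 60 (m + 1) + 2 m < 94 m when m >= 2. *)
  case: hmult => hm.
    exists 14%N => // f Ff; have [hp hz] := hm f Ff; split.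
    - by move=> a ar; apply: (hF f Ff); exact: inD.
    - by move=> a m ar /(hz a m (inD a ar)); lia.
    - by move=> a m ar /(hp a m (inD a ar)); lia.
    - by move=> a; exact: one.
  exists 19%N => // f Ff; have [hp hz] := hm f Ff; split.
  - by move=> a ar; apply: (hF f Ff); exact: inD.
  - by move=> a m ar /(hz a m (inD a ar)); lia.
  - by move=> a m ar /(hp a m (inD a ar)); lia.
  - by move=> a; exact: one.
have L0 := lipc_ge0 r; set L := lipc r in L0.
have L1 : 0 < 30 * L + 1 by rewrite ltr_wpDl// mulr_ge0.
pose c := e / (30 * L + 1); have c0 : 0 < c by rewrite divr_gt0.
exists (Num.min (r / 2) (c ^+ 30)); first by rewrite lt_min divr_gt0//= exprn_gt0.
move=> f z Ff; rewrite lt_min => /andP[zr zc]; split; first by apply: rD; lra.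
apply: le_lt_trans (chordal_hoelder hp r0 (adm f Ff) zr) _; rewrite -/L.
have zrt : rt (normc (z - z0)) <= c.
  by rewrite -[leRHS]rt_exprK ?(ltW c0)//; apply: ler_rt; [exact: normc_ge0|exact: ltW].
have L30 : 0 <= 30 * L by rewrite mulr_ge0.
apply: le_lt_trans (ler_wpM2l L30 zrt) _.
by rewrite /c mulrA mulrAC gtr_pMl// ltr_pdivrMr// mul1r ltrDl.
Qed.

End FamilyEquicontinuity.

(** * A convergent subsequence *)

Section ArzelaAscoli.
Variable R : realType.
Local Notation C := (CC R).
Implicit Types (z w : C).

Lemma chordal_le_normc z w : chordal_dist (Some z) (Some w) <= normc (z - w).
Proof.
have s1 (x : C) : 1 <= Num.sqrt (1 + normc x ^+ 2).
  by rewrite -{1}sqrtr1 ler_wsqrtr// lerDl sqr_ge0.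
rewrite /= ler_pdivrMr; last by rewrite mulr_gt0// (lt_le_trans ltr01).
rewrite ler_peMr ?normc_ge0//; apply: (@le_trans _ _ (1 * 1)); first by rewrite mulr1.
by apply: ler_pM.
Qed.

Lemma chordal_infty_le z (M : R) : 0 < M -> M <= normc z -> chordal_dist (Some z) None <= M^-1.
Proof.
move=> M0 Mz; rewrite /= lef_pV2 ?posrE//; last by rewrite sqrtr_gt0 ltr_wpDr// sqr_ge0.
apply: le_trans Mz _; rewrite -[leLHS]ger0_norm ?normc_ge0// -sqrtr_sqr.
by rewrite ler_wsqrtr// lerDr.
Qed.

(** Either a closed disc contains the terms along U, and its compactness gives a finite limit, or
    for every M the terms that are infinite or of modulus above M form a set of U, and the limit is
    infinity. *)
Lemma sphere_ultra_lim (U : set_system nat) (x : nat -> sphere R) : UltraFilter U ->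
  exists l, forall e : R, 0 < e -> U [set n | chordal_dist (x n) l < e].
Proof.
move=> UU.
pose small (M : R) := [set n | if x n is Some w then normc w <= M else False].
have [[M UM]|H] := pselect (exists M, U (small M)).
  pose v n : C := odflt 0 (x n).
  have UK : (v @ U) [set w : C | normc (w - 0) <= M].
    rewrite /fmap /=; apply: filterS UM => n; rewrite /small /v /=.
    by case: (x n) => //= w; rewrite subr0.
  have [l [_ cl]] := @compact_closed_disc R 0 M (v @ U) _ UK.
  exists (Some l) => e e0.
  have [UA|UA] := in_ultra_setVsetC [set n | normc (v n - l) < e] UU.
    apply: filterS (filterI UM UA) => n []; rewrite /small /v /mkset.
    by case: (x n) => // w _ h; exact: le_lt_trans (chordal_le_normc w l) h.
  have nb : nbhs l [set w : C | normc (w - l) < e] by apply/nbhs_normcP; exists e.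
  have := cl [set w | ~ (normc (w - l) < e)] _ UA nb.
  by move=> -[w []].
exists None => e e0; pose M := 2 / e; have M0 : 0 < M by rewrite divr_gt0.
have [UM|] := in_ultra_setVsetC (small M) UU; first by exfalso; apply: H; exists M.
move=> UC; apply: filterS UC => n; rewrite /small /setC /mkset; case: (x n) => [w|] //.
move=> /negP; rewrite -ltNge => /ltW /(chordal_infty_le M0) /le_lt_trans; apply.
by rewrite /M invf_div; lra.
Qed.

Lemma dense_seq : exists q : nat -> C, forall z (e : R), 0 < e -> exists j, normc (q j - z) < e.
Proof.
pose q n : C := if unpickle n is Some (a, b) then ratr (a : rat) +i* ratr (b : rat) else 0.
exists q => z e e0.
have rat_near (x : R) : exists a : rat, `|ratr a - x| < e / 2.
  have [|a] := @rat_in_itvoo R (x - e / 2) (x + e / 2); first by lra.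
  rewrite in_itv/= => /andP[h1 h2]; exists a; rewrite ltr_norml; apply/andP; split; lra.
have [a Ha] := rat_near (complex.Re z); have [b Hb] := rat_near (complex.Im z).
exists (pickle (a, b)); rewrite /q pickleK; apply: (le_lt_trans (normc_leReIm _)).
by move: Ha Hb; case: (z) => x y /= Ha Hb; lra.
Qed.

Lemma spherical_small (e : R) : 0 < e -> exists2 c : R, 0 < c & forall p q : sphere R,
  chordal_dist p q < c -> spherical_dist p q < e.
Proof.
move=> e0; have e2 : 0 < e / 2 by rewrite divr_gt0.
have asin0 : asin (0 : R) = 0.
  rewrite -{1}(@sin0 R) sinK// in_itv/= oppr_le0.
  by rewrite divr_ge0// pi_ge0.
have c : {for (0 : R), continuous asin} by apply: continuous_asin; rewrite ltrN10 ltr01.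
have /cvgrPdist_lt/(_ _ e2)/nbhs_ballP[d /= d0 H] := c.
exists d => // p q pq; rewrite /spherical_dist.
have := H (chordal_dist p q); rewrite -ball_normE /ball_/= asin0 !sub0r !normrN.
rewrite ger0_norm ?chordal_ge0// => /(_ pq) /(le_lt_trans (ler_norm _)); lra.
Qed.

Variables (D : set C) (u : nat -> C -> sphere R).
Hypothesis equi : forall z0, D z0 -> forall e : R, 0 < e -> exists2 d : R, 0 < d &
  forall n z, normc (z - z0) < d -> D z /\ chordal_dist (u n z) (u n z0) < e.

(* [l] is the pointwise limit along an ultrafilter finer than [\oo]; the
   subsequence is chosen to converge to [l] on a countable dense set. *)
Lemma arzela_ascoli : exists (s : nat -> nat) (l : C -> sphere R),
  [/\ {homo s : m n / (m < n)%N},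
   forall z0, D z0 -> forall e : R, 0 < e -> exists2 d : R, 0 < d &
     forall z, normc (z - z0) < d -> D z /\ chordal_dist (l z) (l z0) < e &
   forall z0, D z0 -> forall e : R, 0 < e -> exists2 d : R, 0 < d &
     exists N, forall k z, (N <= k)%N -> normc (z - z0) < d -> chordal_dist (u (s k) z) (l z) < e].
Proof.
have [U [UU Uoo]] := ultraFilterLemma (F := \oo) _.
have [l ll] := choice (fun z => sphere_ultra_lim (fun n => u n z) UU).
have [q qd] := dense_seq.
have UN N : U [set n | (N < n)%N] by apply: Uoo; exists N.+1.
have UA k : U [set n | forall j, (j <= k)%N -> chordal_dist (u n (q j)) (l (q j)) < k.+1%:R^-1].
  have : forall K, U [set n | forall j, (j <= K)%N -> chordal_dist (u n (q j)) (l (q j)) < k.+1%:R^-1].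
    elim=> [|K IH].
      apply: filterS (ll (q 0%N) k.+1%:R^-1 _); last by rewrite invr_gt0.
      by move=> n h j; rewrite leqn0 => /eqP ->.
    apply: filterS (filterI IH (ll (q K.+1) k.+1%:R^-1 _)); last by rewrite invr_gt0.
    move=> n [h1 h2] j; rewrite leq_eqVlt => /predU1P[->//|]; rewrite ltnS; exact: h1.
  exact.
have ex (kN : nat * nat) : exists n, (kN.2 < n)%N /\
    forall j, (j <= kN.1)%N -> chordal_dist (u n (q j)) (l (q j)) < kN.1.+1%:R^-1.
  have [n [h1 h2]] := filter_ex (filterI (UN kN.2) (UA kN.1)).
  by exists n.
have [pick pickP] := choice ex.
(* Diagonal choice: the index s k exceeds the previous one and approximates l at q 0, ..., q k at
   once. *)
pose s := fix s k := if k is k'.+1 then pick (k, s k') else pick (0, 0)%N.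
have sP k j : (j <= k)%N -> chordal_dist (u (s k) (q j)) (l (q j)) < k.+1%:R^-1.
  by case: k => [|k]; [exact: (pickP (0, 0)%N).2|exact: (pickP (k.+1, s k)).2].
have sS k : (s k < s k.+1)%N by exact: (pickP (k.+1, s k)).1.
have lequi z0 : D z0 -> forall e : R, 0 < e -> exists2 d : R, 0 < d &
     forall z, normc (z - z0) < d -> D z /\ chordal_dist (l z) (l z0) < e.
  move=> Dz0 e e0; have e4 : 0 < e / 4 by rewrite divr_gt0.
  have [d d0 Hd] := equi Dz0 e4; exists d => // z zd.
  have [n [h1 h2]] := filter_ex (filterI (ll z _ e4) (ll z0 _ e4)).
  rewrite /= in h1 h2; have [Dz h3] := Hd n z zd; split => //.
  have := chordal_tri (u n z) (l z) (l z0); have := chordal_tri (u n z0) (u n z) (l z0).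
  rewrite (chordalC (l z) (u n z)); lra.
exists s, l; split => //.
  by apply: homo_ltn => // y x z; exact: ltn_trans.
(* Five steps of less than e / 6: from u z to u z0, u (q j), l (q j), l z0 and l z, with u taken at
   the index s k. *)
move=> z0 Dz0 e e0; have e6 : 0 < e / 6 by rewrite divr_gt0.
have [d1 d10 H1] := equi Dz0 e6; have [d2 d20 H2] := lequi z0 Dz0 _ e6.
pose d := Num.min d1 d2; have d0 : 0 < d by rewrite lt_min d10.
have [j jd] := qd z0 d d0; exists d => //.
have [N HN] : exists N, forall k, (N <= k)%N -> k.+1%:R^-1 < e / 6.
  have := @cvg_harmonic R; move=> /cvgrPdist_lt/(_ _ e6)[N _ HN]; exists N => k /HN /=.
  by rewrite /harmonic sub0r normrN ger0_norm.
exists (maxn N j) => k z; rewrite geq_max => /andP[kN kj].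
rewrite lt_min => /andP[z1 z2]; move: jd; rewrite lt_min => /andP[j1 j2].
have [_ A1] := H1 (s k) z z1; have [_ A2] := H1 (s k) (q j) j1.
have [_ A3] := H2 (q j) j2; have [_ A4] := H2 z z2.
have A5 := lt_trans (sP k j kj) (HN k kN).
have := chordal_tri (u (s k) z0) (u (s k) z) (l z).
have := chordal_tri (u (s k) (q j)) (u (s k) z0) (l z).
have := chordal_tri (l (q j)) (u (s k) (q j)) (l z).
have := chordal_tri (l z0) (l (q j)) (l z).
rewrite (chordalC (u (s k) z0) (u (s k) (q j))) (chordalC (l z0) (l z)); lra.
Qed.

End ArzelaAscoli.

(** * Limits of meromorphic functions *)

Section LimitFunction.
Variable R : realType.
Local Notation C := (CC R).
Implicit Types (p q : sphere R) (f g : C -> sphere R) (a z w : C).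

Definition sinv p : sphere R :=
  match p with Some w => if w == 0 then None else Some w^-1 | None => Some 0 end.

Lemma sinvK : involutive sinv.
Proof.
case=> [w|] /=; last by rewrite eqxx.
by have [->//|w0] := eqVneq w 0; rewrite /= invr_eq0 (negbTE w0) invrK.
Qed.

(** Inversion swaps the homogeneous coordinates up to a scalar, which cancels in [chordalE]. *)
Lemma chordal_sinv p q : chordal_dist (sinv p) (sinv q) = chordal_dist p q.
Proof.
rewrite !chordalE.
have red p' : exists2 c : C, c != 0 & ((hom p').1 = c * (hom (sinv p')).2 /\
    (hom p').2 = c * (hom (sinv p')).1).
  case: p' => [w|] /=; last by exists 1; [exact: oner_neq0|rewrite mulr1 mulr0].
  have [->|w0] := eqVneq w 0 => /=; first by exists 1; [exact: oner_neq0|rewrite mulr1 mulr0].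
  by exists w => //; rewrite mulr1 divff.
have [c c0 [p1 p2]] := red p; have [d d0 [q1 q2]] := red q.
have hn p' (e : C) : (hom p').1 = e * (hom (sinv p')).2 -> (hom p').2 = e * (hom (sinv p')).1 ->
    hnorm p' = normc e * hnorm (sinv p').
  move=> e1 e2; rewrite /hnorm e1 e2 !normc_mul !(exprMn 2 (normc e)) -mulrDr.
  by rewrite sqrtrM ?sqr_ge0// sqrtr_sqr ger0_norm ?normc_ge0// addrC.
rewrite (hn p c)// (hn q d)// /hdet p1 p2 q1 q2.
have -> : c * (hom (sinv p)).2 * (d * (hom (sinv q)).1) - c * (hom (sinv p)).1 * (d * (hom (sinv q)).2)
  = c * d * ((hom (sinv p)).2 * (hom (sinv q)).1 - (hom (sinv p)).1 * (hom (sinv q)).2) by ring.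
rewrite !normc_mul (normc_distC ((hom (sinv p)).2 * _)).
have cn : normc c != 0 by rewrite normc_eq0.
have dn : normc d != 0 by rewrite normc_eq0.
have hp := lt0r_neq0 (hnorm_gt0 (sinv p)); have hq := lt0r_neq0 (hnorm_gt0 (sinv q)).
move: (normc c) (normc d) (hnorm _) (hnorm _) (normc _) cn dn hp hq => x y s t v x0 y0 s0 t0.
by field; rewrite x0 y0 s0 t0.
Qed.

Lemma regular_pointI f a (r : R) : 0 < r -> hol (finval f) a r ->
  (forall z, normc (z - a) < r -> f z <> None) -> regular_point f a.
Proof.
move=> r0 fH fN; split; first by apply/nbhs_normcP; exists r.
by apply/holomorphic_atP; exists r.
Qed.

Lemma regular_point_near f a : regular_point f a ->
  exists2 r : R, 0 < r & forall z, normc (z - a) < r -> regular_point f z.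
Proof.
move=> reg; have [r r0 [fH fS]] := regular_pointP reg; exists (r / 2); first by rewrite divr_gt0.
move=> z zr; apply: (@regular_pointI f z (r / 2)); first by rewrite divr_gt0.
  by apply: hol_ball fH _; lra.
by move=> u uz; rewrite fS//; have := normc_dist_tri z u a; lra.
Qed.

Lemma regular_sinv f a : regular_point f a -> f a <> Some 0 -> regular_point (sinv \o f) a.
Proof.
move=> reg fa; have [r r0 [fH fS]] := regular_pointP reg.
have aa : normc (a - a) < r by rewrite subrr normc_zero.
have g0 : finval f a != 0 by apply: contra_not_neq fa => E; rewrite fS// E.
have /nbhs_normcP[s s0 gn] := near_neq0 (hol_cont fH aa) g0.
pose t := Num.min r s; have t0 : 0 < t by rewrite lt_min r0.
have E z : normc (z - a) < t -> (sinv \o f) z = Some (finval f z)^-1.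
  by rewrite lt_min => /andP[zr zs]; rewrite /= fS//= (negbTE (gn z zs)).
apply: (@regular_pointI _ a t) => // [|z /E ->//].
apply: (@hol_ext _ (fun z => (finval f z)^-1)); first by move=> z /E h; rewrite {2}/finval h.
move=> z; rewrite lt_min => /andP[zr zs]; have [l fl] := fH z zr.
by eexists; exact: cderivV (gn z zs) fl.
Qed.

Lemma pole_sinv f a : is_pole f a -> regular_point (sinv \o f) a.
Proof.
move=> pole; have [fa _ _] := pole; have [m [g [r [m0 r0 gH g0 fE]]]] := pole_factor pole.
have aa : normc (a - a) < r by rewrite subrr normc_zero.
have /nbhs_normcP[s s0 gn] := near_neq0 (hol_cont gH aa) g0.
pose t := Num.min r s; have t0 : 0 < t by rewrite lt_min r0.
have E z : normc (z - a) < t -> (sinv \o f) z = Some ((z - a) ^+ m / g z).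
  rewrite lt_min => /andP[zr zs]; have [->|za] := eqVneq z a.
    by rewrite /= fa subrr expr0n gtn_eqF//= mul0r.
  rewrite /= fE//= mulf_eq0 (negbTE (gn z zs)) invr_eq0 expf_eq0 subr_eq0 (negbTE za) andbF /=.
  by rewrite invf_div.
apply: (@regular_pointI _ a t) => // [|z /E ->//].
apply: (@hol_ext _ (fun z => (z - a) ^+ m / g z)); first by move=> z /E h; rewrite /finval h.
move=> z; rewrite lt_min => /andP[zr zs]; have [l gl] := gH z zr.
have X := @cderivX _ (fun v => v - a) z _ m (cderiv_subC a z).
by eexists; exact: (@cderivF _ (fun v => (v - a) ^+ m) g z _ _ (gn z zs) X gl).
Qed.

(** At chordal distance at least c from infinity, sqrt (1 + |x|^2) is at most 1 / c. Chordal
    convergence is therefore Euclidean there, as Weierstrass' theorem requires. *)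
Lemma chordal_finite p q (c : R) : 0 < c -> c <= chordal_dist p None -> c <= chordal_dist q None ->
  exists v w, [/\ p = Some v, q = Some w & normc (v - w) <= c ^- 2 * chordal_dist p q].
Proof.
move=> c0; case: p => [v|] cp; last by rewrite chordalxx leNgt c0 in cp.
case: q => [w|] cq; last by rewrite chordalxx leNgt c0 in cq.
exists v, w; split => //.
have s0 (x : C) : 0 < Num.sqrt (1 + normc x ^+ 2) by rewrite sqrtr_gt0 ltr_wpDr// sqr_ge0.
have le_inv (x : C) : c <= chordal_dist (Some x) None -> Num.sqrt (1 + normc x ^+ 2) <= c^-1.
  move=> h; rewrite -[leLHS]invrK lef_pV2 ?posrE ?invr_gt0//.
rewrite -[normc (v - w)](@mulfVK _ (Num.sqrt (1 + normc v ^+ 2) * Num.sqrt (1 + normc w ^+ 2))).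
  rewrite mulrC -exprVn expr2; apply: ler_pM.
  - by rewrite mulr_ge0// ltW.
  - exact: (chordal_ge0 (Some v) (Some w)).
  - by apply: ler_pM; rewrite ?(ltW (s0 _))//; exact: le_inv.
  - exact: lexx.
by rewrite mulf_neq0// gt_eqF.
Qed.

Definition cvg_unif_ball (v : nat -> C -> sphere R) (l : C -> sphere R) z0 (d : R) : Prop :=
  forall e : R, 0 < e -> exists N, forall k z, (N <= k)%N -> normc (z - z0) < d ->
    chordal_dist (v k z) (l z) < e.

(** Near z0 the values of l, and those of [v k] from some rank on, stay away from infinity, so the
    convergence is Euclidean and [hol_limit] applies. Regularity is asked only at finite values,
    which suits both the functions and their inverses. *)
Lemma limit_regular (v : nat -> C -> sphere R) l z0 (d : R) : 0 < d ->
  cvg_unif_ball v l z0 d ->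
  (forall e : R, 0 < e -> exists2 d : R, 0 < d & forall z,
     normc (z - z0) < d -> chordal_dist (l z) (l z0) < e) ->
  (forall k z, normc (z - z0) < d -> v k z <> None -> regular_point (v k) z) ->
  l z0 <> None -> regular_point l z0.
Proof.
move=> d0 vl lc vreg lz0.
pose c := chordal_dist (l z0) None.
have c0 : 0 < c.
  rewrite /c; case: (l z0) lz0 => // w _ /=.
  by rewrite invr_gt0 sqrtr_gt0 ltr_wpDr// sqr_ge0.
have c4 : 0 < c / 4 by rewrite divr_gt0.
have c2 : 0 < c / 2 by rewrite divr_gt0.
have [d1 d10 H1] := lc _ c4; have [N HN] := vl _ c4.
pose r := Num.min d d1; have r0 : 0 < r by rewrite lt_min d0.
have lf z : normc (z - z0) < r -> c / 2 <= chordal_dist (l z) None.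
  rewrite lt_min => /andP[_ zd]; have := H1 z zd.
  have := chordal_tri (l z) (l z0) None; rewrite -/c (chordalC (l z0) (l z)); lra.
have vf k z : (N <= k)%N -> normc (z - z0) < r -> c / 2 <= chordal_dist (v k z) None.
  move=> kN; rewrite lt_min => /andP[zd zd1]; have := H1 z zd1; have := HN k z kN zd.
  have := chordal_tri (l z) (l z0) None; have := chordal_tri (v k z) (l z) None.
  rewrite -/c (chordalC (l z0) (l z)) (chordalC (l z) (v k z)); lra.
have fin q : c / 2 <= chordal_dist q None -> q <> None.
  by move=> + E; rewrite E chordalxx leNgt c2.
have hl : hol (finval l) z0 (r / 2).
  apply: (@hol_limit _ (fun k => finval (v (N + k)%N))) => //.
    move=> k u ur; have reg : regular_point (v (N + k)%N) u.
      apply: vreg; first by move: ur; rewrite lt_min => /andP[].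
      by apply: fin; apply: vf => //; exact: leq_addr.
    have [s s0 [vH _]] := regular_pointP reg; apply: vH.
    by rewrite subrr normc_zero.
  move=> e e0; have e' : 0 < e * (c / 2) ^+ 2 by rewrite mulr_gt0// exprn_gt0.
  have [N' HN'] := vl _ e'; exists N' => z zr.
  have zd : normc (z - z0) < d by move: zr; rewrite lt_min => /andP[].
  have [x [y [E1 E2 B]]] := chordal_finite c2 (vf (N + N')%N z (leq_addr _ _) zr) (lf z zr).
  have := HN' (N + N')%N z (leq_addl _ _) zd => /ltW H.
  rewrite /finval E1 E2 [odflt _ _]/= [odflt _ _]/=.
  apply: le_trans B _; rewrite ler_pdivrMl ?exprn_gt0// mulrC; exact: H.
apply: (@regular_pointI l z0 (r / 2)) => //; first by rewrite divr_gt0.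
by move=> z zr; apply: fin; apply: lf; lra.
Qed.

(* Near a point where [l] is infinite, pass to the inverses. *)
Lemma limit_local (v : nat -> C -> sphere R) l z0 (d : R) : 0 < d ->
  cvg_unif_ball v l z0 d ->
  (forall e : R, 0 < e -> exists2 d : R, 0 < d & forall z,
     normc (z - z0) < d -> chordal_dist (l z) (l z0) < e) ->
  (forall k z, normc (z - z0) < d -> regular_point (v k) z \/ is_pole (v k) z) ->
  (regular_point l z0 \/ is_pole l z0) \/
  (exists2 r : R, 0 < r & forall z, normc (z - z0) < r -> l z = None).
Proof.
move=> d0 vl lc vm; have [lz0|lz0] := pselect (l z0 = None); last first.
  left; left; apply: (limit_regular d0 vl lc) => // k z zd vz.
  by have [//|[]] := vm k z zd.
have reg : regular_point (sinv \o l) z0.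
  apply: (@limit_regular (fun k => sinv \o v k) _ _ d) => //.
  - move=> e e0; have [N HN] := vl e e0; exists N => k z kN zd /=.
    by rewrite chordal_sinv; exact: HN.
  - move=> e e0; have [d' d'0 H] := lc e e0; exists d' => // z zd /=.
    by rewrite chordal_sinv; exact: H.
  - move=> k z zd /= vz; have [r|pl] := vm k z zd; last exact: pole_sinv.
    by apply: regular_sinv => // E; apply: vz; rewrite E /= eqxx.
  - by rewrite /= lz0.
have [r r0 [gH gS]] := regular_pointP reg.
set g := finval (sinv \o l) in gH gS.
have lE z : normc (z - z0) < r -> l z = sinv (Some (g z)).
  by move=> zr; rewrite -(gS z zr) /comp sinvK.
(* g vanishes at z0: identically near z0, and then l is infinite there, or at an isolated zero,
   which is a pole of l. *)
have [[s s0 Hs]|[m [h [s [s0 hH h0 gE]]]]] := hol_factor r0 gH.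
  right; exists (Num.min r s); first by rewrite lt_min r0.
  by move=> z; rewrite lt_min => /andP[zr zs]; rewrite lE// Hs//= eqxx.
left; right.
have zz (t : R) : 0 < t -> normc (z0 - z0) < t by rewrite subrr normc_zero.
have g00 : g z0 = 0 by rewrite /g /finval /= lz0.
have m0 : (0 < m)%N.
  rewrite lt0n; apply: contra_neqN h0 => /eqP m0.
  by have := gE z0 (zz _ s0); rewrite m0 expr0 mul1r g00.
have hc := hol_cont hH (zz _ s0).
have /nbhs_normcP[s1 s10 hn] := near_neq0 hc h0.
pose t := Num.min r (Num.min s s1).
have t0 : 0 < t by rewrite !lt_min r0 s0.
have gn z : normc (z - z0) < t -> z != z0 -> g z != 0.
  rewrite !lt_min => /and3P[zr zs zs1] za; rewrite gE// mulf_neq0 ?hn//.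
  by rewrite expf_neq0// subr_eq0.
have lS z : normc (z - z0) < t -> z != z0 -> l z = Some (g z)^-1.
  move=> zt za; rewrite lE; last by move: zt; rewrite lt_min => /andP[].
  by rewrite /= (negbTE (gn z zt za)).
have [r1 r10 reg1] := regular_point_near reg.
split => //.
- apply/dnbhs_normcP; exists (Num.min t r1); first by rewrite lt_min t0.
  move=> z; rewrite lt_min => /andP[zt zr1] za.
  have := regular_sinv (reg1 z zr1).
  have -> : sinv \o (sinv \o l) = l by apply/funext => x /=; rewrite sinvK.
  apply; rewrite /= (lS z zt za) /= invr_eq0 (negbTE (gn z zt za)) invrK => -[] E.
  by have := gn z zt za; rewrite E eqxx.
- apply/cvgryPgt => A; apply/dnbhs_normcP.
  have gc := hol_cont gH (zz _ r0); rewrite g00 in gc.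
  have A1 : 0 < (`|A| + 1)^-1 by rewrite invr_gt0 ltr_wpDl.
  have /ccvgP/(_ _ A1)/nbhs_normcP[t1 t10 Ht1] := gc.
  exists (Num.min t t1); first by rewrite lt_min t0.
  move=> z; rewrite lt_min => /andP[zt zt1] za; have := Ht1 z zt1; rewrite subr0 => gA.
  have -> : finval l z = (g z)^-1 by rewrite /finval (lS z zt za).
  rewrite normc_inv.
  have g0 : 0 < normc (g z) by rewrite normc_gt0 gn.
  apply: (@lt_trans _ _ (`|A| + 1)); first by have := ler_norm A; lra.
  by rewrite -[ltLHS]invrK ltf_pV2 ?posrE.
Qed.

(** S and T are open and cover D; they are disjoint because l is finite in a punctured neighbourhood
    of each point of T. By connectedness S contains D as soon as it meets it. *)
Lemma meromorphic_or_infty (D : set C) l : domain D ->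
  (forall z, D z -> (regular_point l z \/ is_pole l z) \/
    (exists2 r : R, 0 < r & forall w, normc (w - z) < r -> l w = None)) ->
  meromorphic D l \/ forall z, D z -> l z = None.
Proof.
move=> [_ oD cD] H.
pose S : set C := [set z | exists2 r : R, 0 < r & forall w, normc (w - z) < r -> l w = None].
pose T : set C := [set z | regular_point l z \/ is_pole l z].
have oS : open S.
  rewrite openE => z [r r0 Hr]; apply/nbhs_normcP; exists (r / 2); first by rewrite divr_gt0.
  move=> w wz; exists (r / 2); first by rewrite divr_gt0.
  by move=> x xw; apply: Hr; have := normc_dist_tri w x z; lra.
have oT : open T.
  rewrite openE => z [reg|pole].
    have [r r0 Hr] := regular_point_near reg; apply/nbhs_normcP; exists r => // w wz.
    by left; exact: Hr.
  have [_ /dnbhs_normcP[r r0 Hr] _] := pole; apply/nbhs_normcP; exists r => // w wz.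
  by have [->|wz'] := eqVneq w z; [right|left; exact: Hr].
have regN z : regular_point l z -> l z <> None.
  by move=> /regular_pointP[r r0 [_ lS]]; rewrite lS// subrr normc_zero.
have ST z : S z -> T z -> False.
  move=> [r r0 Hr] [reg|[_ /dnbhs_normcP[s s0 Hs] _]].
    by apply: (regN z reg); apply: Hr; rewrite subrr normc_zero.
  pose d := Num.min r s / 2; have d0 : 0 < d by rewrite divr_gt0// lt_min r0.
  have : d < Num.min r s by rewrite ltr_pdivrMr// ltr_pMr ?ltr1n// lt_min r0.
  rewrite lt_min => /andP[dr ds].
  have nd : normc (z + d%:C - z) = d by rewrite addrC addKr normc_real gtr0_norm.
  have ne : z + d%:C != z by rewrite -subr_eq0 -normc_gt0 nd.
  by apply: (regN (z + d%:C)); [apply: Hs; rewrite ?nd|apply: Hr; rewrite nd].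
have [[z [Dz Sz]]|nS] := pselect (exists z, D z /\ S z); last first.
  by left=> z Dz; have [//|Sz] := H z Dz; exfalso; apply: nS; exists z.
right; have DS : D `&` S = D.
  apply: cD.
  - by exists z.
  - by exists S.
  - exists (~` T); first exact: open_closedC.
    apply/seteqP; split => w [Dw Sw]; split => //; first by move=> Tw; exact: ST Sw Tw.
    by have [Tw|//] := H w Dw; exfalso; exact: Sw.
move=> w Dw; have [_ [r r0 Hr]] : (D `&` S) w by rewrite DS.
by apply: Hr; rewrite subrr normc_zero.
Qed.

End LimitFunction.

Unset Implicit Arguments.
Set Strict Implicit.
Set Printing Implicit Defensive.

Theorem corollary1p2 (R : realType) (D : set (CC R))
    (F : set (CC R -> sphere R))
    (hD : domain D)
    (hF : forall f, F f -> meromorphic D f)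
    (hmult :
      (forall f, F f ->
         poles_multiplicity_ge D f 3 /\ zeros_multiplicity_ge D f 2) \/
      (forall f, F f ->
         poles_multiplicity_ge D f 2 /\ zeros_multiplicity_ge D f 3))
    (hshare : forall f g, F f -> F g -> share_one_IM D f g) :
  normal_family D F.
Proof.
move=> u Fu; have [_ oD _] := hD.
have equi z0 : D z0 -> forall e : R, 0 < e -> exists2 d : R, 0 < d &
    forall n z, normc (z - z0) < d -> D z /\ chordal_dist (u n z) (u n z0) < e.
  move=> Dz0 e e0.
  have [d d0 H] := family_equicont hD hF hmult hshare (Fu 0%N) Dz0 e0.
  by exists d => // n z; apply: H; exact: Fu.
have [s [l [smono lcont ucvg]]] := arzela_ascoli equi.
(* Compactness makes the locally uniform convergence uniform on K. *)
have Kcvg (K : set (CC R)) : compact K -> K `<=` D -> forall e : R, 0 < e ->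
    \forall k \near \oo, forall z, K z -> chordal_dist (u (s k) z) (l z) < e.
  move=> /compact_near_coveringP cK KD e e0.
  apply: (cK nat \oo (fun k z => chordal_dist (u (s k) z) (l z) < e)) => z0 Kz0.
  have [d d0 [N HN]] := ucvg z0 (KD _ Kz0) e e0.
  exists ([set z | normc (z - z0) < d], [set k | (N <= k)%N]).
    by split; [exact: near_normc|exists N].
  by move=> [z k] /= [zd kN]; exact: HN.
exists s; split => //; exists l; split; last first.
  move=> K cK KD e e0; have [c c0 Hc] := @spherical_small R e e0.
  by apply: filterS (Kcvg K cK KD c c0) => k Hk z Kz; apply: Hc; exact: Hk.
apply: meromorphic_or_infty => // z0 Dz0.
have /nbhs_normcP[d d0 dD] : nbhs z0 D by move: oD; rewrite openE => /(_ _ Dz0).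
have d2 : 0 < d / 2 by rewrite divr_gt0.
apply: (@limit_local R (fun k => u (s k)) l z0 (d / 2) d2).
- move=> e e0; have := Kcvg [set w | normc (w - z0) <= d / 2] (@compact_closed_disc R z0 (d / 2)).
  move=> /(_ _ e e0); case=> [z /= zd|N _ HN]; first by apply: dD; lra.
  by exists N => k z kN zd; apply: (HN k kN); exact: ltW.
- move=> e e0; have [d' d'0 H] := lcont z0 Dz0 e e0; exists d' => // z zd.
  by have [] := H z zd.
- by move=> k z zd; apply: (hF _ (Fu _)); apply: dD; lra.
Qed.
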